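(* Let $E=C([-2,0])$ and let $A$ be given by $D(A)=\{f\in C^1([-2,0]):f'(0)=f(-2)-f(-1)\}$, $Af=f'$. Then $A$ generates a $C_0$-semigroup $(e^{tA})_{t\ge0}$ on $E$, and: (i) $A$ has compact resolvent, and $s(A)=0$ is a dominant spectral value; (ii) $s(A)$ is an algebraically simple eigenvalue of $A$ and the associated spectral projection $P$ is positive; (iii) $(e^{tA})_{t\ge0}$ is uniformly asymptotically positive, but it is neither positive nor individually eventually strongly positive with respect to any quasi-interior point of $E_+$.
   Context: $C([-2,0])$ is the complex Banach lattice with sup norm and pointwise order; $d_+(f)=\operatorname{dist}(f,E_+)$; $s(A)$ is the spectral bound, dominant meaning $\sigma(A)\cap(s(A)+i\mathbb{R})=\{s(A)\}$. Uniformly asymptotically positive: $(e^{t(A-s(A))})$ is bounded and for every $\varepsilon>0$ there is $t_0$ with $d_+(e^{t(A-s(A))}f)\le\varepsilon\|f\|$ for all $t\ge t_0$, $f\in E_+$. $u\in E_+$ is quasi-interior if $\{f:|f|\le cu\text{ for some } c\}$ is dense; the semigroup is individually eventually strongly positive with respect to $u$ if for each $f\ge0$, $f\ne0$, there is $t_0>0$ such that for all $t\ge t_0$, $e^{tA}f\ge cu$ for some $c>0$. *)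

(* Defs.v *)
(* E = C([-2,0]; C) with the sup norm.
   Elements of E are represented by functions R -> C; only their values on
   [-2,0] matter (equality in E is [eqE]). Operators are maps
   (R -> C) -> (R -> C), required to respect [eqE] on E. *)
From Stdlib Require Import Reals.
From Coquelicot Require Import Coquelicot.
Open Scope R_scope.

Definition fn := R -> C.
Definition Op := fn -> fn.

Definition Ival (x : R) : Prop := -2 <= x <= 0.

Definition inE (f : fn) : Prop :=
  forall x, Ival x -> forall eps, 0 < eps -> exists d, 0 < d /\
    forall y, Ival y -> Rabs (y - x) < d -> Cmod (Cminus (f y) (f x)) < eps.

Definition eqE (f g : fn) : Prop := forall x, Ival x -> f x = g x.

Definition fzero : fn := fun _ => RtoC 0.
Definition fsub (f g : fn) : fn := fun x => Cminus (f x) (g x).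
Definition fscal (c : C) (f : fn) : fn := fun x => Cmult c (f x).
Definition flin (a : C) (f : fn) (b : C) (g : fn) : fn :=
  fun x => Cplus (Cmult a (f x)) (Cmult b (g x)).

Definition supnorm (f : fn) : R :=
  real (Lub_Rbar (fun r => exists x, Ival x /\ r = Cmod (f x))).

Definition posE (f : fn) : Prop :=
  inE f /\ forall x, Ival x -> Im (f x) = 0 /\ 0 <= Re (f x).

Definition dist_pos (f : fn) : R :=
  real (Glb_Rbar (fun r => exists h, posE h /\ r = supnorm (fsub f h))).

Definition bounded_linear (T : Op) : Prop :=
  (forall f, inE f -> inE (T f)) /\
  (forall f g, inE f -> inE g -> eqE f g -> eqE (T f) (T g)) /\
  (forall a b f g, inE f -> inE g ->
     eqE (T (flin a f b g)) (flin a (T f) b (T g))) /\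
  (exists M, forall f, inE f -> supnorm (T f) <= M * supnorm f).

Definition derivE (f g : fn) : Prop :=
  forall x, Ival x -> forall eps, 0 < eps -> exists d, 0 < d /\
    forall y, Ival y -> y <> x -> Rabs (y - x) < d ->
      Cmod (Cminus (Cdiv (Cminus (f y) (f x)) (RtoC (y - x))) (g x)) < eps.

Definition Agraph (f g : fn) : Prop :=
  inE f /\ inE g /\ derivE f g /\ g 0 = Cminus (f (-2)) (f (-1)).

Definition generates_A (T : R -> Op) : Prop :=
  (forall t, 0 <= t -> bounded_linear (T t)) /\
  (forall f, inE f -> eqE (T 0 f) f) /\
  (forall t s f, 0 <= t -> 0 <= s -> inE f -> eqE (T (t + s) f) (T t (T s f))) /\
  (forall f t, inE f -> 0 <= t -> forall eps, 0 < eps -> exists d, 0 < d /\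
     forall s, 0 <= s -> Rabs (s - t) < d -> supnorm (fsub (T s f) (T t f)) < eps) /\
  (forall f g, inE f -> inE g ->
     (Agraph f g <->
      forall eps, 0 < eps -> exists d, 0 < d /\ forall h, 0 < h < d ->
        supnorm (fsub (fscal (RtoC (/ h)) (fsub (T h f) f)) g) < eps)).

Definition is_resolvent (lam : C) (Rs : Op) : Prop :=
  bounded_linear Rs /\
  (forall g, inE g -> exists h, Agraph (Rs g) h /\
       eqE (fsub (fscal lam (Rs g)) h) g) /\
  (forall f h, Agraph f h -> eqE (Rs (fsub (fscal lam f) h)) f).

Definition in_rho (lam : C) : Prop := exists Rs, is_resolvent lam Rs.
Definition in_spec (lam : C) : Prop := ~ in_rho lam.

Definition spectral_bound : Rbar :=
  Lub_Rbar (fun r => exists lam, in_spec lam /\ r = Re lam).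

Definition compact_op (K : Op) : Prop :=
  forall u : nat -> fn, (forall n, inE (u n) /\ supnorm (u n) <= 1) ->
    exists phi : nat -> nat, (forall n, (phi n < phi (S n))%nat) /\
      exists g, inE g /\ forall eps, 0 < eps -> exists N, forall n, (N <= n)%nat ->
        supnorm (fsub (K (u (phi n))) g) < eps.

Definition compact_resolvent : Prop :=
  exists lam Rs, is_resolvent lam Rs /\ compact_op Rs.

Definition dominant_spectral_value (lam0 : C) : Prop :=
  in_spec lam0 /\ forall lam, in_spec lam -> Re lam = Re lam0 -> lam = lam0.

Definition is_eigenvalue (lam : C) : Prop :=
  exists f g, Agraph f g /\ ~ eqE f fzero /\ eqE g (fscal lam f).

(* Riesz spectral projection at lam0:
   P f = (1 / 2 pi i) \oint_{|lam - lam0| = r} R(lam, A) f dlam,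
   with the punctured closed disc of radius r contained in rho(A);
   the (Bochner) integral is taken pointwise in x. *)
Definition is_spectral_projection (lam0 : C) (P : Op) : Prop :=
  exists r, 0 < r /\ exists Res : C -> Op,
    (forall lam, 0 < Cmod (Cminus lam lam0) <= r -> is_resolvent lam (Res lam)) /\
    forall f, inE f -> forall x, Ival x ->
      P f x = @RInt C_R_CompleteNormedModule
        (fun th => Cmult (Cmult (RtoC (r / (2 * PI))) (cos th, sin th))
                         (Res (Cplus lam0 (Cmult (RtoC r) (cos th, sin th))) f x))
        0 (2 * PI).

Definition rank_one (P : Op) : Prop :=
  exists v, inE v /\ ~ eqE v fzero /\ (exists f, inE f /\ eqE (P f) v) /\
    forall f, inE f -> exists c, eqE (P f) (fscal c v).

Definition algebraically_simple (lam : C) : Prop :=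
  is_eigenvalue lam /\ exists P, is_spectral_projection lam P /\ rank_one P.

Definition positive_op (P : Op) : Prop := forall f, posE f -> posE (P f).

Definition unif_asymp_positive (T : R -> Op) (s : R) : Prop :=
  (exists M, forall t f, 0 <= t -> inE f ->
      supnorm (fscal (RtoC (exp (- s * t))) (T t f)) <= M * supnorm f) /\
  (forall eps, 0 < eps -> exists t0, forall t f, t0 <= t -> 0 <= t -> posE f ->
      dist_pos (fscal (RtoC (exp (- s * t))) (T t f)) <= eps * supnorm f).

Definition positive_semigroup (T : R -> Op) : Prop :=
  forall t f, 0 <= t -> posE f -> posE (T t f).

Definition quasi_interior (u : fn) : Prop :=
  posE u /\ forall g, inE g -> forall eps, 0 < eps -> exists f c,
    inE f /\ (forall x, Ival x -> Cmod (f x) <= c * Re (u x)) /\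
    supnorm (fsub g f) < eps.

Definition ind_ev_strongly_positive (T : R -> Op) (u : fn) : Prop :=
  forall f, posE f -> ~ eqE f fzero -> exists t0, 0 < t0 /\
    forall t, t0 <= t -> exists c, 0 < c /\ posE (fsub (T t f) (fscal (RtoC c) u)).

(* Main.v *)
Require Import Defs.
From Stdlib Require Import Reals ZArith Lra Lia Classical ClassicalEpsilon.
From Coquelicot Require Import Coquelicot.
Open Scope R_scope.

(* The semigroup is the translation semigroup of the delay equation
   x'(t) = x(t-2) - x(t-1), i.e. (S(t) f)(s) = x(t+s) where x extends f.  The right
   hand side is an exact derivative, so x(t) + \int_{t-2}^{t-1} x is a conserved
   quantity c(f) = f(0) + \int_{-2}^{-1} f, and P f = c(f)/2 is the spectral projection
   at 0, visibly positive of rank one.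

   The difference y = x - c(f)/2 satisfies y(t) = - \int_{t-2}^{t-1} y.  If y(t) were
   nearly extremal, so would be y(t-1) and y(t-2), both of sign opposite to y(t) and yet
   of opposite signs; with the Lipschitz bound this makes sup |y| contract by a fixed
   factor, so S(t) converges to P in operator norm, whence asymptotic positivity.  A
   positive f with c(f) = 0, f <> 0, cannot satisfy S(t) f >= c u, because
   c(S(t) f) = 0; and f(s) = - s (s + 2) gives (S(1/2) f)(0) = - 1/4.

   Any other semigroup T generated by A equals S, because s |-> S(t-s) T(s) f has right
   derivative 0 for f in D(A).

   The resolvent is explicit off the zeros of lam + e^{-lam} - e^{-2 lam} = lam D(lam),
   D(lam) = 1 + \int_1^2 e^{-lam s} ds, and D has no zero with Re lam >= 0.  The contour
   integral defining P is evaluated by the mean value property of the holomorphic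
   function lam R(lam, A) f(x), whose value at 0 is c(f)/2. *)

Set Bullet Behavior "Strict Subproofs".

(** The equation is used only in the integrated form [renewal]. This form asks for mere continuity,
    so it defines a trajectory for every initial value in E, not just for those in the domain of A.
    As its coefficients are real, real and imaginary parts evolve separately, and most statements
    are proved for one real component, selected by a boolean.

    Deducing convergence from the spectrum would need a link between the spectrum of A and the
    growth of the semigroup. The contraction of sup |y| replaces that link and gives an explicit
    geometric rate; the spectral facts serve only (i) and (ii).

    Uniqueness of the semigroup matters because (iii) speaks of every T generated by A. Likewise the
    projection P in (ii) comes with an arbitrary admissible radius and an arbitrary family of
    resolvents. Hence resolvents are shown unique, and the mean value property is proved on a disc
    of any radius, with no holomorphy assumed beyond the closed disc.

    Writing the characteristic function as lam D(lam) isolates its zero at 0: D(0) = 2, and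
    multiplication of the resolvent by lam removes the singularity. *)

Ltac eqR := match goal with |- ?a = ?b => change (@eq R a b) end.

(** * Continuity and integration on the real line *)

Definition cont (f : R -> R) : Prop := forall x, continuous f x.

Lemma continuous_eps (f : R -> R) x :
  continuous f x <-> forall eps, 0 < eps -> exists d, 0 < d /\
    forall y, Rabs (y - x) < d -> Rabs (f y - f x) < eps.
Proof.
  split.
  - intros H eps He.
    destruct (proj1 (filterlim_locally _ _) H (mkposreal eps He)) as [d Hd].
    exists d; split; [apply cond_pos|]. intros y Hy. exact (Hd y Hy).
  - intros H. apply filterlim_locally. intros [e He].
    destruct (H e He) as [d [Hd K]].
    exists (mkposreal d Hd). intros y Hy. exact (K y Hy).
Qed.

Lemma cont_const c : cont (fun _ => c).
Proof. intros x; apply continuous_const. Qed.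
Lemma cont_id : cont (fun x => x).
Proof. intros x; apply continuous_id. Qed.
Lemma cont_plus f g : cont f -> cont g -> cont (fun x => f x + g x).
Proof. intros Hf Hg x; apply @continuous_plus; auto. Qed.
Lemma cont_opp f : cont f -> cont (fun x => - f x).
Proof. intros Hf x; apply @continuous_opp; auto. Qed.
Lemma cont_minus f g : cont f -> cont g -> cont (fun x => f x - g x).
Proof. intros Hf Hg; apply cont_plus; auto; now apply cont_opp. Qed.
Lemma cont_mult f g : cont f -> cont g -> cont (fun x => f x * g x).
Proof. intros Hf Hg x; apply @continuous_mult; auto. Qed.
Lemma cont_comp f g : cont f -> cont g -> cont (fun x => f (g x)).
Proof. intros Hf Hg x; apply (continuous_comp g f); auto. Qed.
Lemma cont_derive (f df : R -> R) : (forall x, is_derive f x (df x)) -> cont f.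
Proof. intros H x. apply (@ex_derive_continuous R_AbsRing R_NormedModule). exists (df x); apply H. Qed.
Lemma cont_Rmax_l c : cont (fun x => Rmax c x).
Proof.
  intros x. apply continuous_eps. intros e He. exists e; split; auto.
  intros y. unfold Rmax; repeat destruct Rle_dec; unfold Rabs;
    repeat destruct Rcase_abs; lra.
Qed.
Lemma cont_Rmin_l c : cont (fun x => Rmin c x).
Proof.
  intros x. apply continuous_eps. intros e He. exists e; split; auto.
  intros y. unfold Rmin; repeat destruct Rle_dec; unfold Rabs;
    repeat destruct Rcase_abs; lra.
Qed.

Create HintDb cont.
#[global] Hint Resolve cont_const cont_id cont_plus cont_opp cont_minus cont_mult
  cont_Rmax_l cont_Rmin_l : cont.

Lemma cont_ext f g : (forall x, f x = g x) -> cont f -> cont g.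
Proof. intros H Hf x. apply continuous_ext with f; auto. Qed.

Lemma cont_ex_RInt f a b : cont f -> ex_RInt f a b.
Proof. intros H. apply @ex_RInt_continuous; auto. Qed.
#[global] Hint Resolve cont_ex_RInt : cont.

Lemma cont_Chasles f a b c : cont f -> RInt f a b + RInt f b c = RInt f a c.
Proof. intros H. apply (RInt_Chasles f); auto with cont. Qed.

Lemma RInt_refl (f : R -> R) a : RInt f a a = 0.
Proof. apply (RInt_point a f). Qed.

Lemma RInt_flip (f : R -> R) a b : cont f -> RInt f a b = - RInt f b a.
Proof. intros H. pose proof (cont_Chasles f a b a H). rewrite RInt_refl in H0. lra. Qed.

Lemma cont_RInt_derive f a x : cont f -> is_derive (fun t => RInt f a t) x (f x).
Proof.
  intros H. apply (is_derive_RInt f _ a x); auto.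
  exists (mkposreal 1 Rlt_0_1). intros y _. apply (RInt_correct f). auto with cont.
Qed.

Lemma cont_RInt f a : cont f -> cont (fun t => RInt f a t).
Proof. intros H. apply cont_derive with f. intros; now apply cont_RInt_derive. Qed.

Lemma cont_RInt_comp f a b : cont f -> cont a -> cont b ->
  cont (fun t => RInt f (a t) (b t)).
Proof.
  intros Hf Ha Hb. apply cont_ext with (fun t => RInt f 0 (b t) - RInt f 0 (a t)).
  - intros x. pose proof (cont_Chasles f 0 (a x) (b x) Hf). lra.
  - apply cont_minus; apply (cont_comp (RInt f 0)); auto; now apply cont_RInt.
Qed.
#[global] Hint Resolve cont_RInt cont_RInt_comp : cont.

Lemma RInt_bound f a b M : cont f -> a <= b ->
  (forall t, a <= t <= b -> Rabs (f t) <= M) -> Rabs (RInt f a b) <= M * (b - a).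
Proof.
  intros Hf Hab H. rewrite Rmult_comm. apply abs_RInt_le_const; auto with cont.
Qed.

Lemma RInt_shift f a b v : cont f ->
  RInt (fun s => f (s + v)) a b = RInt f (a + v) (b + v).
Proof.
  intros H. pose proof (RInt_comp_lin f 1 v a b) as E.
  rewrite !Rmult_1_l in E. rewrite <- E; auto with cont.
  apply RInt_ext. intros x _. unfold scal; simpl; unfold mult; simpl.
  now rewrite !Rmult_1_l.
Qed.

Lemma RInt_add f g a b : cont f -> cont g ->
  RInt (fun s => f s + g s) a b = RInt f a b + RInt g a b.
Proof. intros. apply (RInt_plus f g); auto with cont. Qed.
Lemma RInt_mulc c f a b : cont f -> RInt (fun s => c * f s) a b = c * RInt f a b.
Proof. intros. apply (RInt_scal f a b c); auto with cont. Qed.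
Lemma RInt_sub f g a b : cont f -> cont g ->
  RInt (fun s => f s - g s) a b = RInt f a b - RInt g a b.
Proof. intros. apply (RInt_minus f g); auto with cont. Qed.
Lemma RInt_constR c a b : RInt (fun _ => c) a b = (b - a) * c.
Proof. rewrite (RInt_const a b c). reflexivity. Qed.
(** Integrates the one-sided Lipschitz envelopes of [renewal_contract_upper]; [p] is the point where
    the value is known. *)
Lemma RInt_affine l m p a b :
  RInt (fun s => l + m * (s - p)) a b = l * (b - a) + m / 2 * ((b - p)^2 - (a - p)^2).
Proof.
  apply is_RInt_unique. evar_last.
  - apply (is_RInt_derive (fun s => l * s + m / 2 * (s - p)^2)
      (fun s => l + m * (s - p))).
    + intros x _. auto_derive; auto. field.
    + intros x _. apply (cont_plus (fun _ => l)); auto with cont.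
  - unfold minus, plus, opp; simpl. ring.
Qed.
Lemma RInt_eq (f g : R -> R) a b : a <= b ->
  (forall x, a <= x <= b -> f x = g x) -> RInt f a b = RInt g a b.
Proof.
  intros Hab H. apply RInt_ext. intros x. rewrite Rmin_left, Rmax_right; auto.
  intros; apply H; lra.
Qed.
Lemma RInt_mono f g a b : cont f -> cont g -> a <= b ->
  (forall x, a <= x <= b -> f x <= g x) -> RInt f a b <= RInt g a b.
Proof. intros. apply RInt_le; auto with cont. intros; apply H2; lra. Qed.

Lemma cont_bounded_on f a b : cont f -> exists M, 0 <= M /\
  forall x, a <= x <= b -> Rabs (f x) <= M.
Proof.
  intros H. destruct (Rle_dec a b) as [Hab|Hab].
  2: { exists 0; split; [lra|]. intros; lra. }
  destruct (continuity_ab_maj (fun x => Rabs (f x)) a b Hab) as [m [Hm _]].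
  - intros c _. apply continuity_pt_comp with (f2 := Rabs).
    + apply continuity_pt_filterlim, H.
    + apply Rcontinuity_abs.
  - exists (Rabs (f m)); split; [apply Rabs_pos|exact Hm].
Qed.

Lemma unif_cont f a b : cont f -> forall eps, 0 < eps -> exists d, 0 < d /\
  forall x y, a <= x <= b -> a <= y <= b -> Rabs (x - y) < d -> Rabs (f x - f y) < eps.
Proof.
  intros H eps He.
  destruct (@Heine_cor2 f a b) with (eps := mkposreal eps He) as [d Hd].
  - intros x _. apply continuity_pt_filterlim, H.
  - exists d; split; [apply cond_pos|exact Hd].
Qed.

(* Supremum argument: the increment stays below [eps * (s - a)] up to every [s]. *)
Lemma right_deriv0_const (f : R -> R) a b : a <= b ->
  (forall x, a <= x <= b -> forall eps, 0 < eps -> exists d, 0 < d /\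
     forall y, a <= y <= b -> Rabs (y - x) < d -> Rabs (f y - f x) < eps) ->
  (forall x, a <= x < b -> forall eps, 0 < eps -> exists d, 0 < d /\
     forall h, 0 < h < d -> x + h <= b -> Rabs (f (x + h) - f x) <= eps * h) ->
  f b = f a.
Proof.
  intros Hab Hc Hd.
  assert (K : forall eps, 0 < eps -> Rabs (f b - f a) <= eps * (b - a)).
  { intros eps He.
    set (S := fun s => a <= s <= b /\ Rabs (f s - f a) <= eps * (s - a)).
    assert (Sa : S a).
    { split; [lra|]. replace (f a - f a) with 0 by ring. rewrite Rabs_R0; lra. }
    destruct (completeness S) as [m [Hub Hlub]].
    { exists b. intros s [Hs _]; lra. }
    { now exists a. }
    assert (Hm : a <= m <= b).
    { split; [now apply Hub|]. apply Hlub. intros s [Hs _]; lra. }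
    assert (Sm : S m).
    { split; auto. apply Rnot_lt_le. intros Hlt.
      set (g := Rabs (f m - f a) - eps * (m - a)).
      assert (Hg : 0 < g / 2) by (unfold g; lra).
      destruct (Hc m Hm (g/2) Hg) as [d [Hd0 Hd1]].
      assert (E : exists s, S s /\ m - d < s).
      { apply NNPP. intros N. assert (m <= m - d); [|lra].
        apply Hlub. intros s Hs. apply Rnot_lt_le. intros C; apply N; now exists s. }
      destruct E as [s [Hs Hsd]]. pose proof (Hub s Hs) as Hsm. destruct Hs as [Hs1 Hs2].
      assert (A : Rabs (f s - f m) < g/2).
      { apply Hd1; auto. rewrite Rabs_left1; lra. }
      assert (B : Rabs (f m - f a) <= Rabs (f s - f m) + Rabs (f s - f a)).
      { replace (f m - f a) with (-(f s - f m) + (f s - f a)) by ring.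
        eapply Rle_trans; [apply Rabs_triang|]. rewrite Rabs_Ropp; lra. }
      assert (eps * (s - a) <= eps * (m - a)) by (apply Rmult_le_compat_l; lra).
      unfold g in *; lra. }
    destruct (Req_dec m b) as [->|Hne]; [apply Sm|].
    exfalso. assert (Hmb : a <= m < b) by lra.
    destruct (Hd m Hmb eps He) as [d [Hd0 Hd1]].
    set (h := Rmin (d/2) (b - m)).
    assert (Hh : 0 < h < d /\ m + h <= b).
    { unfold h, Rmin; destruct Rle_dec; lra. }
    destruct Hh as [Hh1 Hh2].
    assert (S (m + h)); [|pose proof (Hub _ H); lra].
    split; [lra|]. specialize (Hd1 h Hh1 Hh2).
    replace (f (m+h) - f a) with ((f (m+h) - f m) + (f m - f a)) by ring.
    eapply Rle_trans; [apply Rabs_triang|].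
    destruct Sm as [_ Sm]. lra. }
  destruct (Req_dec (f b) (f a)) as [E|N]; auto.
  exfalso. assert (P : 0 < Rabs (f b - f a)) by (apply Rabs_pos_lt; lra).
  destruct (Req_dec a b) as [->|Hne]; [lra|].
  specialize (K (Rabs (f b - f a) / (2 * (b - a)))).
  assert (0 < Rabs (f b - f a) / (2 * (b - a))) by (apply Rdiv_lt_0_compat; lra).
  specialize (K H). replace (Rabs (f b - f a) / (2 * (b - a)) * (b - a))
    with (Rabs (f b - f a) / 2) in K by (field; lra). lra.
Qed.

(** * The delay equation *)

(** The time derivative of the left side is x'(t) + x(t-1) - x(t-2), so this is the delay equation
    without a derivative. *)
Definition renewal (x : R -> R) (c : R) : Prop :=
  forall t, 0 <= t -> x t + RInt x (t - 2) (t - 1) = c.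

(** Method of steps: x(t) reads the past only up to t - 1, so agreement spreads by one unit of time
    per induction step. The two constants agree because the equation at t = 0 involves the history
    alone. *)
Lemma renewal_unique x1 x2 c1 c2 : cont x1 -> cont x2 ->
  renewal x1 c1 -> renewal x2 c2 -> (forall t, -2 <= t <= 0 -> x1 t = x2 t) ->
  forall t, -2 <= t -> x1 t = x2 t.
Proof.
  intros C1 C2 R1 R2 H.
  assert (E : c1 = c2).
  { rewrite <- (R1 0), <- (R2 0) by lra. f_equal; [apply H; lra|].
    apply RInt_eq; [lra|]. intros; apply H; lra. }
  assert (K : forall n t, -2 <= t <= INR n -> x1 t = x2 t).
  { induction n as [|n IH]; intros t Ht.
    - apply H; simpl in Ht; lra.
    - rewrite S_INR in Ht. destruct (Rle_dec t 0) as [Ht0|Ht0]; [apply H; lra|].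
      pose proof (R1 t ltac:(lra)) as A1. pose proof (R2 t ltac:(lra)) as A2.
      assert (RInt x1 (t - 2) (t - 1) = RInt x2 (t - 2) (t - 1)); [|lra].
      apply RInt_eq; [lra|]. intros; apply IH; lra. }
  intros t Ht. destruct (INR_unbounded t) as [n Hn]. apply (K n); lra.
Qed.

Definition clamp (x : R) : R := Rmax (-2) (Rmin 0 x).

Lemma clamp_I x : Ival (clamp x).
Proof. unfold clamp, Ival, Rmax, Rmin; repeat destruct Rle_dec; lra. Qed.
Lemma clamp_id x : Ival x -> clamp x = x.
Proof. unfold clamp, Ival, Rmax, Rmin; repeat destruct Rle_dec; lra. Qed.
Lemma clamp_cont : cont clamp.
Proof. apply (cont_comp (Rmax (-2)) (Rmin 0)); auto with cont. Qed.
Lemma clamp_lip x y : Rabs (clamp y - clamp x) <= Rabs (y - x).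
Proof.
  unfold clamp, Rmax, Rmin; repeat destruct Rle_dec; unfold Rabs;
    repeat destruct Rcase_abs; lra.
Qed.

(** Picard iteration. [Rmax 0 t] makes the bracket vanish for t <= 0, so the history [g] is
    preserved; for t >= 0 a fixed point satisfies the integrated equation once [g] is constant
    there. *)
Fixpoint iterate_sol (g : R -> R) (k : nat) : R -> R :=
  match k with
  | O => g
  | S k => let y := iterate_sol g k in
      fun t => g t + (RInt y (-2) (-1) - RInt y (Rmax 0 t - 2) (Rmax 0 t - 1))
  end.

(* Iterates of order at least [k] agree on [t <= k], so this is their limit. *)
Definition solution (g : R -> R) (t : R) : R :=
  iterate_sol g (Z.to_nat (up t)) t.

Section Solution.
Variable g : R -> R.
Hypothesis g_cont : cont g.
Hypothesis g_const : forall t, 0 <= t -> g t = g 0.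

Lemma iterate_cont k : cont (iterate_sol g k).
Proof.
  induction k as [|k IH]; simpl; auto.
  apply cont_plus; auto. apply cont_minus; auto with cont.
Qed.

(** The shortest delay is 1: at time t <= k + 1 the next iterate reads the previous one only up to
    time k, where it is already final. *)
Lemma iterate_stable k t : t <= INR k -> iterate_sol g (S k) t = iterate_sol g k t.
Proof.
  revert t; induction k as [|k IH]; intros t Ht.
  - simpl in *. rewrite Rmax_left by auto.
    replace (0 - 2) with (-2) by ring. replace (0 - 1) with (-1) by ring. ring.
  - rewrite S_INR in Ht. pose proof (pos_INR k).
    change (g t + (RInt (iterate_sol g (S k)) (-2) (-1)
       - RInt (iterate_sol g (S k)) (Rmax 0 t - 2) (Rmax 0 t - 1)) =
      g t + (RInt (iterate_sol g k) (-2) (-1)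
       - RInt (iterate_sol g k) (Rmax 0 t - 2) (Rmax 0 t - 1))).
    assert (Hm : Rmax 0 t <= INR k + 1) by (apply Rmax_lub; lra).
    assert (A : forall a b, a <= b -> b <= INR k ->
      RInt (iterate_sol g (S k)) a b = RInt (iterate_sol g k) a b).
    { intros a b Hab Hb. apply RInt_eq; auto. intros; apply IH; lra. }
    rewrite !A by lra. reflexivity.
Qed.

Lemma iterate_stable_le k m t : t <= INR k -> (k <= m)%nat ->
  iterate_sol g m t = iterate_sol g k t.
Proof.
  intros Ht Hk. induction Hk as [|m Hm IH]; auto.
  rewrite <- IH. apply iterate_stable. apply Rle_trans with (1 := Ht). now apply le_INR.
Qed.

Lemma le_up_nat t : t <= INR (Z.to_nat (up t)).
Proof.
  destruct (archimed t) as [H _].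
  destruct (Z.lt_ge_cases (up t) 0) as [Hz|Hz].
  - pose proof (pos_INR (Z.to_nat (up t))). apply IZR_lt in Hz. lra.
  - rewrite INR_IZR_INZ, Z2Nat.id by auto. lra.
Qed.

Lemma solution_iterate k t : t <= INR k -> solution g t = iterate_sol g k t.
Proof.
  intros Ht. unfold solution.
  destruct (Nat.le_ge_cases (Z.to_nat (up t)) k) as [H|H].
  - symmetry. apply iterate_stable_le; auto. apply le_up_nat.
  - apply iterate_stable_le; auto.
Qed.

Lemma solution_cont : cont (solution g).
Proof.
  intros t. destruct (INR_unbounded (t + 1)) as [k Hk].
  apply continuous_ext_loc with (iterate_sol g k); [|apply iterate_cont].
  exists (mkposreal 1 Rlt_0_1). intros y Hy. symmetry. apply solution_iterate.
  unfold ball in Hy; simpl in Hy; unfold AbsRing_ball, abs, minus, plus, opp in Hy;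
    simpl in Hy. apply Rabs_def2 in Hy. lra.
Qed.

Lemma solution_past t : t <= 0 -> solution g t = g t.
Proof. intros H. now apply (solution_iterate 0). Qed.

Lemma solution_renewal : renewal (solution g) (g 0 + RInt g (-2) (-1)).
Proof.
  intros t Ht. destruct (INR_unbounded t) as [k Hk].
  assert (A : forall a b, a <= b <= INR k ->
     RInt (iterate_sol g k) a b = RInt (solution g) a b).
  { intros a b Hab. apply RInt_eq; [lra|]. intros; symmetry; apply solution_iterate; lra. }
  rewrite (solution_iterate (S k)) by (rewrite S_INR; lra).
  simpl. rewrite Rmax_right by auto. rewrite !A by (pose proof (pos_INR k); lra).
  rewrite g_const by auto.
  rewrite (RInt_eq (solution g) g (-2) (-1)); [ring|lra|].
  intros; apply solution_past; lra.
Qed.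
End Solution.

Lemma renewal_shift x c s : cont x -> 0 <= s -> renewal x c ->
  renewal (fun t => x (t + s)) c.
Proof.
  intros Hx Hs H t Ht. rewrite RInt_shift by auto. rewrite <- (H (t + s)) by lra.
  f_equal. f_equal; ring.
Qed.

Lemma renewal_lin x y c d a b : cont x -> cont y -> renewal x c -> renewal y d ->
  renewal (fun t => a * x t + b * y t) (a * c + b * d).
Proof.
  intros Hx Hy H K t Ht. rewrite RInt_add, !RInt_mulc by auto with cont.
  rewrite <- (H t), <- (K t) by auto. ring.
Qed.

(** The window has length 1, so the constant c / 2 is the equilibrium whose conserved quantity is
    c. *)
Lemma renewal_center x c : cont x -> renewal x c -> renewal (fun t => x t - c / 2) 0.
Proof.
  intros Hx H t Ht. rewrite RInt_sub by auto with cont. rewrite RInt_constR.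
  pose proof (H t Ht). lra.
Qed.

(** With conserved quantity 0, y(t) is minus the mean of y over a window of length 1, so no new
    extremum can appear. *)
Lemma renewal_bound y M : cont y -> renewal y 0 ->
  (forall t, -2 <= t <= 0 -> Rabs (y t) <= M) -> forall t, -2 <= t -> Rabs (y t) <= M.
Proof.
  intros Hy H HM.
  assert (K : forall n t, -2 <= t <= INR n -> Rabs (y t) <= M).
  { induction n as [|n IH]; intros t Ht.
    - apply HM; simpl in Ht; lra.
    - rewrite S_INR in Ht. destruct (Rle_dec t 0); [apply HM; lra|].
      replace (y t) with (- RInt y (t - 2) (t - 1)) by (pose proof (H t ltac:(lra)); lra).
      rewrite Rabs_Ropp. eapply Rle_trans.
      + apply RInt_bound with (M := M); auto; [lra|]. intros; apply IH; lra.
      + lra. }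
  intros t Ht. destruct (INR_unbounded t) as [n Hn]. apply (K n); lra.
Qed.

(* If [y t] is close to [M], then [y] is close to [-M] on [t-2, t-1]; but
   [y (t-1)] close to [-M] forces [y (t-2)] close to [M]. *)
Lemma renewal_contract_upper y M t : cont y -> renewal y 0 -> 1 <= t ->
  0 <= M ->
  (forall s, t - 3 <= s <= t - 1 -> Rabs (y s) <= M) ->
  (forall s s', t - 3 <= s <= t - 1 -> t - 3 <= s' <= t - 1 ->
     Rabs (y s - y s') <= 2 * M * Rabs (s - s')) ->
  y t <= 63 / 64 * M.
Proof.
  intros Hy H Ht HM Hb HL.
  assert (E : y t = - RInt y (t - 2) (t - 1)) by (pose proof (H t ltac:(lra)); lra).
  assert (B : forall a b, t - 3 <= a <= b -> b <= t - 1 -> - M * (b - a) <= RInt y a b <= M * (b - a)).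
  { intros a b Hab Hbt. pose proof (RInt_bound y a b M Hy ltac:(lra)
      ltac:(intros; apply Hb; lra)) as K. apply Rabs_le_between in K. lra. }
  (* [y] lies above a tent of slope 2 M with value [l] at [p]; on an interval to one side of [p] the
     slope costs M (b - a)^2. *)
  assert (Lo : forall a b l p, t - 3 <= a <= b -> b <= t - 1 -> p = a \/ p = b ->
     l <= y p -> l * (b - a) - M * (b - a)^2 <= RInt y a b).
  { intros a b l p Hab Hbt Hp Hl.
    assert (F : cont (fun s => l - 2 * M * Rabs (s - p))) by
      (apply cont_minus; auto with cont; apply cont_mult; auto with cont;
       apply (cont_comp Rabs); [intros x; apply continuous_Rabs|auto with cont]).
    replace (l * (b - a) - M * (b - a) ^ 2) with (RInt (fun s => l - 2 * M * Rabs (s - p)) a b).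
    - apply RInt_mono; auto; [lra|].
      intros x Hx. assert (K : Rabs (y x - y p) <= 2 * M * Rabs (x - p))
        by (apply HL; destruct Hp; lra).
      apply Rabs_le_between in K. lra.
    - destruct Hp as [-> | ->].
      + transitivity (RInt (fun s => l + - (2 * M) * (s - a)) a b).
        * apply RInt_eq; [lra|]. intros x Hx. rewrite Rabs_right by lra. ring.
        * rewrite RInt_affine. eqR. field.
      + transitivity (RInt (fun s => l + 2 * M * (s - b)) a b).
        * apply RInt_eq; [lra|]. intros x Hx. rewrite Rabs_left1 by lra. ring.
        * rewrite RInt_affine. eqR. field. }
  assert (Up : forall a b l, t - 3 <= a <= b -> b <= t - 1 -> y b <= l ->
     RInt y a b <= l * (b - a) + M * (b - a)^2).
  { intros a b l Hab Hbt Hl.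
    replace (l * (b - a) + M * (b - a) ^ 2) with (RInt (fun s => l + - (2 * M) * (s - b)) a b).
    - apply RInt_mono; auto with cont; [lra|].
      intros x Hx. pose proof (HL b x ltac:(lra) ltac:(lra)) as K.
      rewrite (Rabs_right (b - x)) in K by lra. apply Rabs_le_between in K. lra.
    - rewrite RInt_affine. eqR. field. }
  (* If y(t-2) >= 0, the half window next to t-2 has integral at least -M/4 instead of -M/2, and
     y(t) <= 3M/4 follows at once. *)
  destruct (Rle_dec 0 (y (t - 2))) as [P|N].
  - pose proof (Lo (t-2) (t-3/2) 0 (t-2) ltac:(lra) ltac:(lra) ltac:(auto) P) as A1.
    pose proof (B (t-3/2) (t-1) ltac:(lra) ltac:(lra)) as A2.
    pose proof (cont_Chasles y (t-2) (t-3/2) (t-1) Hy).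
    replace (t - 3/2 - (t-2)) with (1/2) in A1 by lra.
    replace (t - 1 - (t-3/2)) with (1/2) in A2 by lra. lra.
  (* If y(t-2) < 0, the integral of [y] over the window [t-3, t-2] is at most 3M/4, so y(t-1) >=
     -3M/4 stays away from -M. *)
  - pose proof (Up (t-5/2) (t-2) 0 ltac:(lra) ltac:(lra) ltac:(lra)) as A1.
    pose proof (B (t-3) (t-5/2) ltac:(lra) ltac:(lra)) as A2.
    pose proof (cont_Chasles y (t-3) (t-5/2) (t-2) Hy).
    assert (E' : y (t - 1) = - RInt y (t - 3) (t - 2)).
    { pose proof (H (t - 1) ltac:(lra)) as K.
      replace (t - 1 - 2) with (t - 3) in K by ring.
      replace (t - 1 - 1) with (t - 2) in K by ring. lra. }
    replace (t - 2 - (t-5/2)) with (1/2) in A1 by lra.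
    replace (t - 5/2 - (t-3)) with (1/2) in A2 by lra.
    assert (Q : - (3/4) * M <= y (t - 1)) by lra.
    (* A piece of length d before t-1 gains M (d/4 - d^2) over the trivial bound -M d. The choice d
       = 1/8 maximises this gain, which is then M/64; hence the factor 63/64. *)
    pose proof (Lo (t-9/8) (t-1) (-(3/4)*M) (t-1) ltac:(lra) ltac:(lra) ltac:(auto) Q) as A3.
    pose proof (B (t-2) (t-9/8) ltac:(lra) ltac:(lra)) as A4.
    pose proof (cont_Chasles y (t-2) (t-9/8) (t-1) Hy).
    replace (t - 1 - (t-9/8)) with (1/8) in A3 by lra.
    replace (t - 9/8 - (t-2)) with (7/8) in A4 by lra. lra.
Qed.

Lemma renewal_opp y : cont y -> renewal y 0 -> renewal (fun t => - y t) 0.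
Proof.
  intros Hy H t Ht. pose proof (H t Ht).
  replace (RInt (fun t => - y t) (t - 2) (t - 1)) with (- RInt y (t - 2) (t - 1)).
  - lra.
  - symmetry. apply (RInt_opp y); auto with cont.
Qed.

(** Formally y' = y(t-2) - y(t-1) is bounded by 2M. In integrated form, shifting the window changes
    the integral only through its two end pieces. *)
Lemma renewal_lipschitz y M tau : cont y -> renewal y 0 -> 0 <= tau ->
  (forall s, tau - 2 <= s -> Rabs (y s) <= M) ->
  forall s s', tau <= s -> tau <= s' -> Rabs (y s - y s') <= 2 * M * Rabs (s - s').
Proof.
  intros Hy H Ht HM.
  assert (W : forall s s', tau <= s <= s' -> Rabs (y s - y s') <= 2 * M * Rabs (s - s')).
  { intros s s' Hs.
    pose proof (H s ltac:(lra)) as E1. pose proof (H s' ltac:(lra)) as E2.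
    pose proof (cont_Chasles y (s-2) (s-1) (s'-1) Hy) as C1.
    pose proof (cont_Chasles y (s-2) (s'-2) (s'-1) Hy) as C2.
    replace (y s - y s') with (RInt y (s-1) (s'-1) - RInt y (s-2) (s'-2)) by lra.
    pose proof (RInt_bound y (s-1) (s'-1) M Hy ltac:(lra) ltac:(intros; apply HM; lra)) as B1.
    pose proof (RInt_bound y (s-2) (s'-2) M Hy ltac:(lra) ltac:(intros; apply HM; lra)) as B2.
    rewrite (Rabs_left1 (s - s')) by lra.
    apply Rabs_le_between in B1. apply Rabs_le_between in B2.
    apply Rabs_le_between. lra. }
  intros s s' Hs Hs'. destruct (Rle_dec s s'); [apply W; lra|].
  rewrite Rabs_minus_sym, (Rabs_minus_sym s). apply W; lra.
Qed.

(** The Lipschitz bound holds from [tau] on and the one-step estimate at t looks back to t - 3,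
    whence [tau + 3]. The lower bound comes from applying the upper one to -y. *)
Lemma renewal_contract y M tau : cont y -> renewal y 0 -> 0 <= tau ->
  (forall s, tau - 2 <= s -> Rabs (y s) <= M) ->
  forall t, tau + 3 <= t -> Rabs (y t) <= 63 / 64 * M.
Proof.
  intros Hy H Ht HM t Htt.
  assert (M0 : 0 <= M) by (eapply Rle_trans; [apply Rabs_pos|apply (HM tau); lra]).
  assert (L := renewal_lipschitz y M tau Hy H Ht HM).
  assert (U : y t <= 63 / 64 * M).
  { apply renewal_contract_upper; auto; try lra.
    - intros; apply HM; lra.
    - intros; apply L; lra. }
  assert (V : - y t <= 63 / 64 * M).
  { apply (renewal_contract_upper (fun t => - y t)); auto; try lra.
    - auto with cont.
    - now apply renewal_opp.
    - intros; rewrite Rabs_Ropp; apply HM; lra.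
    - intros s s' Hs Hs'. replace (- y s - - y s') with (- (y s - y s')) by ring.
      rewrite Rabs_Ropp. apply L; lra. }
  apply Rabs_le_between. lra.
Qed.

(** Each contraction costs 5 units of time: 3 for the estimate and 2 because its bound must hold
    from [tau - 2] on. *)
Lemma renewal_decay y M : cont y -> renewal y 0 ->
  (forall t, -2 <= t <= 0 -> Rabs (y t) <= M) ->
  forall n t, 5 * INR n - 2 <= t -> Rabs (y t) <= (63 / 64)^n * M.
Proof.
  intros Hy H HM n. induction n as [|n IH]; intros t Ht.
  - simpl in *. rewrite Rmult_1_l. apply renewal_bound; auto. lra.
  - rewrite S_INR in Ht. simpl. rewrite Rmult_assoc.
    pose proof (pos_INR n).
    apply renewal_contract with (tau := 5 * INR n); auto; lra.
Qed.

(** * The space E *)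

(** A boolean index for the two real components lets one real argument serve both real and imaginary
    parts. *)
Definition cp (b : bool) (z : C) : R := if b then fst z else snd z.

Lemma cp_ext z w : (forall b, cp b z = cp b w) -> z = w.
Proof. intros H. apply injective_projections; [apply (H true)|apply (H false)]. Qed.
Lemma cp_plus b z w : cp b (Cplus z w) = cp b z + cp b w.
Proof. now destruct b. Qed.
Lemma cp_minus b z w : cp b (Cminus z w) = cp b z - cp b w.
Proof. now destruct b. Qed.
Lemma cp_opp b z : cp b (Copp z) = - cp b z.
Proof. now destruct b. Qed.
Lemma cp_scal b r z : cp b (Cmult (RtoC r) z) = r * cp b z.
Proof. destruct b; simpl; ring. Qed.
Lemma cp_Cmod b z : Rabs (cp b z) <= Cmod z.
Proof.
  pose proof (Rmax_Cmod z). pose proof (Rmax_l (Rabs (fst z)) (Rabs (snd z))).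
  pose proof (Rmax_r (Rabs (fst z)) (Rabs (snd z))). destruct b; simpl; lra.
Qed.
Lemma Cmod_cp z : Cmod z <= Rabs (cp true z) + Rabs (cp false z).
Proof.
  simpl. replace z with (Cplus (RtoC (fst z)) (Cmult Ci (RtoC (snd z)))) at 1.
  - eapply Rle_trans; [apply Cmod_triangle|]. rewrite Cmod_mult, Cmod_Ci, !Cmod_R. lra.
  - apply injective_projections; simpl; ring.
Qed.
(** The factor 2, cruder than sqrt 2, is where the doubled constants in the complex bounds below
    come from. *)
Lemma Cmod_cp_le z m : (forall b, Rabs (cp b z) <= m) -> Cmod z <= 2 * m.
Proof. intros H. pose proof (Cmod_cp z). pose proof (H true). pose proof (H false). lra. Qed.

(* Constant extension off [-2, 0]: Coquelicot's integrals and limits are two-sided. *)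
Definition comp (b : bool) (f : fn) : R -> R := fun x => cp b (f (clamp x)).

Lemma comp_I b f x : Ival x -> comp b f x = cp b (f x).
Proof. intros H. unfold comp. now rewrite clamp_id. Qed.

Lemma Ival_0 : Ival 0. Proof. unfold Ival; lra. Qed.
#[global] Hint Resolve Ival_0 : core.

(** Passes from the epsilon-delta condition on [-2, 0] to continuity on the whole line; [clamp] is
    1-Lipschitz, so the same radius works. *)
Lemma inE_comp f : inE f <-> forall b, cont (comp b f).
Proof.
  split.
  - intros H b x. apply continuous_eps. intros eps He.
    destruct (H (clamp x) (clamp_I x) eps He) as [d [Hd K]].
    exists d; split; auto. intros y Hy. unfold comp.
    rewrite <- cp_minus. eapply Rle_lt_trans; [apply cp_Cmod|].
    apply K; [apply clamp_I|]. eapply Rle_lt_trans; [apply clamp_lip|auto].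
  - intros H x Hx eps He.
    assert (He' : 0 < eps / 3) by lra.
    destruct (proj1 (continuous_eps _ _) (H true x) _ He') as [d1 [Hd1 K1]].
    destruct (proj1 (continuous_eps _ _) (H false x) _ He') as [d2 [Hd2 K2]].
    exists (Rmin d1 d2); split; [now apply Rmin_glb_lt|].
    intros y Hy Hxy. pose proof (Rmin_l d1 d2). pose proof (Rmin_r d1 d2).
    eapply Rle_lt_trans; [apply Cmod_cp|].
    rewrite !cp_minus, <- !(comp_I _ f) by auto.
    specialize (K1 y ltac:(lra)). specialize (K2 y ltac:(lra)). lra.
Qed.

Lemma comp_eqE b f g : eqE f g -> forall x, comp b f x = comp b g x.
Proof. intros H x. unfold comp. rewrite (H (clamp x)); auto. apply clamp_I. Qed.

Lemma inE_eqE f g : eqE f g -> inE f -> inE g.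
Proof.
  intros E H. apply inE_comp. intros b. apply cont_ext with (comp b f).
  - now apply comp_eqE.
  - now apply inE_comp.
Qed.

Lemma inE_fn (F : R -> C) : (forall b, cont (fun x => cp b (F x))) -> inE F.
Proof.
  intros H. apply inE_comp. intros b.
  apply (cont_comp (fun x => cp b (F x)) clamp); auto. apply clamp_cont.
Qed.

Lemma inE_const c : inE (fun _ => c).
Proof. apply inE_fn. intros; auto with cont. Qed.
Lemma inE_fsub f g : inE f -> inE g -> inE (fsub f g).
Proof.
  rewrite !inE_comp. intros Hf Hg b. apply cont_ext with (fun x => comp b f x - comp b g x).
  - intros x. unfold comp, fsub. now rewrite cp_minus.
  - auto with cont.
Qed.
Lemma inE_flin a f c g : inE f -> inE g -> inE (flin a f c g).
Proof.
  rewrite !inE_comp. intros Hf Hg b.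
  destruct b; unfold comp, flin; simpl;
    pose proof (Hf true); pose proof (Hf false); pose proof (Hg true);
    pose proof (Hg false); unfold comp, cp in *; auto 10 with cont.
Qed.
Lemma inE_fscal a f : inE f -> inE (fscal a f).
Proof.
  intros H. apply (inE_eqE (flin a f (RtoC 0) f)).
  - intros x _. unfold flin, fscal. ring.
  - now apply inE_flin.
Qed.
#[global] Hint Resolve inE_const inE_fsub inE_flin inE_fscal : cont.

Lemma supnorm_le f M : (forall x, Ival x -> Cmod (f x) <= M) -> supnorm f <= M.
Proof.
  intros H. unfold supnorm.
  destruct (Lub_Rbar_correct (fun r => exists x, Ival x /\ r = Cmod (f x))) as [U L].
  assert (A : Rbar_le (Lub_Rbar (fun r => exists x, Ival x /\ r = Cmod (f x))) (Finite M)).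
  { apply L. intros r [x [Hx ->]]. simpl. auto. }
  assert (B : 0 <= M) by (eapply Rle_trans; [apply Cmod_ge_0|apply (H 0); auto]).
  destruct (Lub_Rbar _); simpl in *; lra.
Qed.

Lemma supnorm_lt f M e : M < e -> (forall x, Ival x -> Cmod (f x) <= M) -> supnorm f < e.
Proof. intros H K. apply Rle_lt_trans with M; auto. now apply supnorm_le. Qed.

(** An infinite supremum would be sent to 0 by [real]; continuity on the compact interval excludes
    this. *)
Lemma supnorm_ge f x : inE f -> Ival x -> Cmod (f x) <= supnorm f.
Proof.
  intros Hf Hx. unfold supnorm.
  destruct (Lub_Rbar_correct (fun r => exists x, Ival x /\ r = Cmod (f x))) as [U L].
  pose proof (proj1 (inE_comp f) Hf) as Hc.
  destruct (cont_bounded_on _ (-2) 0 (Hc true)) as [m1 [P1 H1]].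
  destruct (cont_bounded_on _ (-2) 0 (Hc false)) as [m2 [P2 H2]].
  assert (A : Rbar_le (Lub_Rbar (fun r => exists x, Ival x /\ r = Cmod (f x))) (Finite (m1 + m2))).
  { apply L. intros r [y [Hy ->]]. simpl.
    eapply Rle_trans; [apply Cmod_cp|]. rewrite <- !(comp_I _ f) by auto.
    apply Rplus_le_compat; auto. }
  specialize (U (Cmod (f x)) (ex_intro _ x (conj Hx eq_refl))).
  destruct (Lub_Rbar _); simpl in *; lra.
Qed.

Lemma supnorm_pos f : 0 <= supnorm f.
Proof.
  unfold supnorm.
  destruct (Lub_Rbar_correct (fun r => exists x, Ival x /\ r = Cmod (f x))) as [U L].
  specialize (U (Cmod (f 0)) (ex_intro _ 0 (conj Ival_0 eq_refl))).
  pose proof (Cmod_ge_0 (f 0)). destruct (Lub_Rbar _); simpl in *; lra.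
Qed.

Lemma comp_supnorm b f x : inE f -> Rabs (comp b f x) <= supnorm f.
Proof.
  intros H. unfold comp. eapply Rle_trans; [apply cp_Cmod|].
  apply supnorm_ge; auto. apply clamp_I.
Qed.

Lemma dist_pos_le f h : posE h -> Defs.dist_pos f <= supnorm (fsub f h).
Proof.
  intros H. unfold Defs.dist_pos.
  destruct (Glb_Rbar_correct (fun r => exists h, posE h /\ r = supnorm (fsub f h))) as [U L].
  specialize (U (supnorm (fsub f h)) (ex_intro _ h (conj H eq_refl))).
  assert (A : Rbar_le (Finite 0) (Glb_Rbar (fun r => exists h, posE h /\ r = supnorm (fsub f h)))).
  { apply L. intros r [k [Hk ->]]. simpl. apply supnorm_pos. }
  pose proof (supnorm_pos (fsub f h)).
  destruct (Glb_Rbar _); simpl in *; lra.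
Qed.

(** First-order expansion of the integral on both sides of [x], without division, to be matched with
    the difference quotients in [derivE]. *)
Lemma RInt_increment g x eps : cont g -> 0 < eps -> exists d, 0 < d /\
  forall y, Rabs (y - x) < d -> Rabs (RInt g x y - (y - x) * g x) <= eps * Rabs (y - x).
Proof.
  intros Hg He. destruct (proj1 (continuous_eps g x) (Hg x) eps He) as [d [Hd K]].
  exists d; split; auto. intros y Hy.
  assert (W : forall a b, a <= b -> (forall s, a <= s <= b -> Rabs (s - x) < d) ->
    Rabs (RInt g a b - (b - a) * g x) <= eps * (b - a)).
  { intros a b Hab Hs. rewrite <- (RInt_constR (g x) a b), <- RInt_sub by auto with cont.
    apply RInt_bound; auto with cont. intros t Ht. left. apply K, Hs, Ht. }
  destruct (Rle_dec x y) as [P|N].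
  - rewrite (Rabs_right (y - x)) in * by lra. apply W; auto.
    intros s Hs. rewrite Rabs_right; lra.
  - rewrite (Rabs_left (y - x)) in * by lra. rewrite RInt_flip by auto.
    replace (- RInt g y x - (y - x) * g x) with (- (RInt g y x - (x - y) * g x)) by ring.
    rewrite Rabs_Ropp. replace (- (y - x)) with (x - y) by ring.
    apply W; [lra|]. intros s Hs. rewrite Rabs_left1; lra.
Qed.

Lemma Cmod_quotient u v r : r <> 0 ->
  Cmod (Cminus (Cdiv u (RtoC r)) v) = Cmod (Cminus u (Cmult (RtoC r) v)) / Rabs r.
Proof.
  intros Hr. assert (RtoC r <> RtoC 0) by (intros E; apply Hr; now injection E).
  rewrite <- Cmod_R, <- Cmod_div by auto. f_equal. field. auto.
Qed.

(* One-sided differentiability at the end points is all that [derivE] provides,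
   and [right_deriv0_const] needs no more. *)
Lemma derivE_RInt f h : inE f -> inE h -> (derivE f h <->
  forall b x, Ival x -> comp b f x = comp b f 0 + RInt (comp b h) 0 x).
Proof.
  intros Hf Hh. split.
  - intros HD b.
    assert (Cf := proj1 (inE_comp f) Hf b). assert (Ch := proj1 (inE_comp h) Hh b).
    set (F := fun x => comp b f x - RInt (comp b h) (-2) x).
    assert (CF : cont F) by (unfold F; auto with cont).
    assert (K : forall x, Ival x -> F x = F (-2)).
    { intros x Hx. destruct Hx as [Hx1 Hx2]. apply right_deriv0_const; auto.
      - intros z _ eps He. destruct (proj1 (continuous_eps F z) (CF z) eps He) as [d [Hd K]].
        exists d; auto.
      - intros z Hz eps He. assert (Iz : Ival z) by (unfold Ival; lra).
        destruct (HD z Iz (eps/2) ltac:(lra)) as [d1 [Hd1 K1]].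
        destruct (RInt_increment (comp b h) z (eps/2) Ch ltac:(lra)) as [d2 [Hd2 K2]].
        exists (Rmin d1 d2). split; [now apply Rmin_glb_lt|].
        intros k Hk Hkx. pose proof (Rmin_l d1 d2). pose proof (Rmin_r d1 d2).
        assert (Ak : Rabs (z + k - z) = k) by (replace (z + k - z) with k by ring; apply Rabs_right; lra).
        specialize (K1 (z + k) ltac:(unfold Ival; lra) ltac:(lra) ltac:(lra)).
        specialize (K2 (z + k) ltac:(lra)).
        rewrite Cmod_quotient, Ak in K1 by lra.
        apply (Rlt_div_l _ _ k) in K1; [|lra].
        pose proof (cp_Cmod b (Cminus (Cminus (f (z + k)) (f z)) (Cmult (RtoC (z + k - z)) (h z)))) as K3.
        rewrite !cp_minus, cp_scal, <- !(comp_I b) in K3 by (unfold Ival; lra).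
        rewrite Ak in K2. unfold F.
        pose proof (cont_Chasles (comp b h) (-2) z (z + k) Ch) as E.
        replace (z + k - z) with k in * by ring.
        replace (_ - _) with ((comp b f (z + k) - comp b f z - k * comp b h z)
           - (RInt (comp b h) z (z + k) - k * comp b h z)) by lra.
        eapply Rle_trans; [apply Rabs_triang|]. rewrite Rabs_Ropp. lra. }
    intros x Hx. pose proof (K x Hx) as E1. pose proof (K 0 Ival_0) as E2. unfold F in *.
    pose proof (cont_Chasles (comp b h) (-2) 0 x Ch). lra.
  - intros H x Hx eps He.
    destruct (RInt_increment (comp true h) x (eps/3) (proj1 (inE_comp h) Hh true) ltac:(lra)) as [d1 [Hd1 K1]].
    destruct (RInt_increment (comp false h) x (eps/3) (proj1 (inE_comp h) Hh false) ltac:(lra)) as [d2 [Hd2 K2]].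
    exists (Rmin d1 d2). split; [now apply Rmin_glb_lt|].
    intros y Hy Hne Hyx. pose proof (Rmin_l d1 d2). pose proof (Rmin_r d1 d2).
    specialize (K1 y ltac:(lra)). specialize (K2 y ltac:(lra)).
    rewrite Cmod_quotient by lra.
    assert (0 < Rabs (y - x)) by (apply Rabs_pos_lt; lra).
    apply Rlt_div_l; auto. eapply Rle_lt_trans; [apply Cmod_cp|].
    rewrite !cp_minus, !cp_scal, <- !(comp_I _ h), <- !(comp_I _ f) by auto.
    rewrite !(H _ x), !(H _ y) by auto.
    assert (E : forall b, RInt (comp b h) 0 y = RInt (comp b h) 0 x + RInt (comp b h) x y)
      by (intros b; symmetry; apply cont_Chasles, inE_comp; auto).
    rewrite !E.
    replace (comp true f 0 + (RInt (comp true h) 0 x + RInt (comp true h) x y) -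
      (comp true f 0 + RInt (comp true h) 0 x) - (y - x) * comp true h x) with
      (RInt (comp true h) x y - (y - x) * comp true h x) by ring.
    replace (comp false f 0 + (RInt (comp false h) 0 x + RInt (comp false h) x y) -
      (comp false f 0 + RInt (comp false h) 0 x) - (y - x) * comp false h x) with
      (RInt (comp false h) x y - (y - x) * comp false h x) by ring.
    assert (0 < eps * Rabs (y - x)) by (apply Rmult_lt_0_compat; auto). lra.
Qed.

(** * The semigroup *)

Definition X (b : bool) (f : fn) : R -> R := solution (comp b f).

Definition functional (b : bool) (f : fn) : R := comp b f 0 + RInt (comp b f) (-2) (-1).

Definition semigroup (t : R) : Op := fun f x => (X true f (t + x), X false f (t + x)).

Lemma cp_semigroup b t f x : cp b (semigroup t f x) = X b f (t + x).
Proof. now destruct b. Qed.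

Lemma comp_const b f t : 0 <= t -> comp b f t = comp b f 0.
Proof.
  intros H. unfold comp. f_equal; f_equal. unfold clamp. now rewrite !Rmin_left by lra.
Qed.

Lemma X_cont b f : inE f -> cont (X b f).
Proof. intros H. apply solution_cont, inE_comp; auto. Qed.
#[global] Hint Resolve X_cont : cont.

Lemma X_past b f t : t <= 0 -> X b f t = comp b f t.
Proof. apply solution_past. Qed.

Lemma X_renewal b f : inE f -> renewal (X b f) (functional b f).
Proof.
  intros _. apply solution_renewal, comp_const.
Qed.

(** The algebraic laws of the semigroup all reduce to this: it suffices to exhibit a continuous
    solution with the right history. *)
Lemma X_unique b f x c : inE f -> cont x -> renewal x c ->
  (forall t, Ival t -> x t = cp b (f t)) -> forall t, -2 <= t -> x t = X b f t.
Proof.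
  intros Hf Hx Hr H. apply renewal_unique with c (functional b f); auto with cont.
  - now apply X_renewal.
  - intros t Ht. rewrite X_past, comp_I by (apply Ht). now apply H.
Qed.

Lemma X_eqE b f g t : inE f -> eqE f g -> -2 <= t -> X b f t = X b g t.
Proof.
  intros Hf E Ht. apply X_unique with (c := functional b f); auto with cont.
  - now apply inE_eqE with f.
  - now apply X_renewal.
  - intros s Hs. rewrite X_past, comp_I by (apply Hs). now rewrite E.
Qed.

Lemma X_flin b a1 f a2 g t : inE f -> inE g -> -2 <= t ->
  X b (flin a1 f a2 g) t =
  cp b (Cplus (Cmult a1 (X true f t, X false f t)) (Cmult a2 (X true g t, X false g t))).
Proof.
  intros Hf Hg Ht. symmetry.
  pose proof (X_renewal true f Hf) as R1. pose proof (X_renewal false f Hf) as R2.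
  pose proof (X_renewal true g Hg) as R3. pose proof (X_renewal false g Hg) as R4.
  pose proof (X_cont true f Hf) as C1. pose proof (X_cont false f Hf) as C2.
  pose proof (X_cont true g Hg) as C3. pose proof (X_cont false g Hg) as C4.
  (* Complex multiplication mixes the components, so each component of the combination is a real
     combination of four real trajectories; the coefficients are chosen at the end, separately for
     each component. *)
  assert (K : forall p1 p2 q1 q2,
    (forall s, Ival s -> cp b (flin a1 f a2 g s) =
       p1 * cp true (f s) + p2 * cp false (f s) + (q1 * cp true (g s) + q2 * cp false (g s))) ->
    1 * (p1 * X true f t + p2 * X false f t) + 1 * (q1 * X true g t + q2 * X false g t)
    = X b (flin a1 f a2 g) t).
  { intros p1 p2 q1 q2 H.
    apply (X_unique b _ (fun t => 1 * (p1 * X true f t + p2 * X false f t)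
       + 1 * (q1 * X true g t + q2 * X false g t))
      (1 * (p1 * functional true f + p2 * functional false f)
        + 1 * (q1 * functional true g + q2 * functional false g))); auto 10 with cont.
    - apply renewal_lin; auto with cont; apply renewal_lin; auto with cont.
    - intros s Hs. rewrite H by auto. rewrite !X_past, !comp_I by (auto; apply Hs). ring. }
  destruct b.
  - rewrite <- (K (fst a1) (- snd a1) (fst a2) (- snd a2)); [simpl; ring|].
    intros s _. unfold flin; simpl. ring.
  - rewrite <- (K (snd a1) (fst a1) (snd a2) (fst a2)); [simpl; ring|].
    intros s _. unfold flin; simpl. ring.
Qed.

Lemma fsub_flin f g : eqE (fsub f g) (flin (RtoC 1) f (RtoC (-1)) g).
Proof.
  intros x _. unfold fsub, flin. apply injective_projections; simpl; ring.
Qed.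

Lemma X_fsub b f g t : inE f -> inE g -> -2 <= t -> X b (fsub f g) t = X b f t - X b g t.
Proof.
  intros Hf Hg Ht. rewrite (X_eqE b _ _ t (inE_fsub _ _ Hf Hg) (fsub_flin f g) Ht).
  rewrite X_flin by auto. destruct b; simpl; ring.
Qed.

Lemma functional_bound b f : inE f -> Rabs (functional b f) <= 2 * supnorm f.
Proof.
  intros H. unfold functional. pose proof (comp_supnorm b f 0 H).
  assert (Rabs (RInt (comp b f) (-2) (-1)) <= supnorm f * (-1 - -2)).
  { apply RInt_bound; [apply inE_comp; auto|lra|]. intros; now apply comp_supnorm. }
  eapply Rle_trans; [apply Rabs_triang|]. lra.
Qed.

Lemma X_center_past b f t : inE f -> -2 <= t <= 0 ->
  Rabs (X b f t - functional b f / 2) <= 2 * supnorm f.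
Proof.
  intros H Ht. rewrite X_past by lra. pose proof (comp_supnorm b f t H).
  pose proof (functional_bound b f H) as K. apply Rabs_le_between in H0, K.
  apply Rabs_le_between. lra.
Qed.

Lemma X_decay b f n t : inE f -> 5 * INR n - 2 <= t ->
  Rabs (X b f t - functional b f / 2) <= (63 / 64)^n * (2 * supnorm f).
Proof.
  intros H Ht. apply (renewal_decay (fun t => X b f t - functional b f / 2)); auto with cont.
  - apply renewal_center; auto with cont. now apply X_renewal.
  - intros; now apply X_center_past.
Qed.

(** Distance at most 2 |f| to the limit, which itself has size at most |f|. *)
Lemma X_bound b f t : inE f -> -2 <= t -> Rabs (X b f t) <= 3 * supnorm f.
Proof.
  intros H Ht. pose proof (X_decay b f 0 t H ltac:(simpl; lra)) as D.
  pose proof (functional_bound b f H) as K. simpl in D. apply Rabs_le_between in D, K.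
  apply Rabs_le_between. lra.
Qed.

Lemma inE_semigroup t f : inE f -> inE (semigroup t f).
Proof.
  intros H. apply inE_fn. intros b. apply cont_ext with (fun x => X b f (t + x)).
  - intros; symmetry; apply cp_semigroup.
  - apply (cont_comp (X b f)); auto with cont.
Qed.
#[global] Hint Resolve inE_semigroup : cont.

Lemma semigroup_bound t f : inE f -> 0 <= t -> supnorm (semigroup t f) <= 6 * supnorm f.
Proof.
  intros H Ht. apply supnorm_le. intros x Hx.
  replace (6 * supnorm f) with (2 * (3 * supnorm f)) by ring. apply Cmod_cp_le.
  intros b. rewrite cp_semigroup. apply X_bound; auto. destruct Hx; lra.
Qed.

Lemma semigroup_bounded_linear t : 0 <= t -> bounded_linear (semigroup t).
Proof.
  intros Ht. repeat split.
  - apply inE_semigroup.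
  - intros f g Hf Hg E x Hx. apply cp_ext. intros b. rewrite !cp_semigroup.
    apply X_eqE; auto. destruct Hx; lra.
  - intros a1 a2 f g Hf Hg x Hx. apply cp_ext. intros b.
    rewrite cp_semigroup, X_flin by (auto; destruct Hx; lra). reflexivity.
  - exists 6. intros; now apply semigroup_bound.
Qed.

Lemma X_shift b f s t : inE f -> 0 <= s -> -2 <= t ->
  X b (semigroup s f) t = X b f (t + s).
Proof.
  intros Hf Hs Ht. symmetry.
  apply (X_unique b _ (fun t => X b f (t + s)) (functional b f)); auto with cont.
  - apply (cont_comp (X b f)); auto with cont.
  - apply renewal_shift; auto with cont. now apply X_renewal.
  - intros r _. rewrite cp_semigroup. f_equal; ring.
Qed.

Lemma semigroup_continuous f t : inE f -> 0 <= t -> forall eps, 0 < eps ->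
  exists d, 0 < d /\ forall s, 0 <= s -> Rabs (s - t) < d ->
    supnorm (fsub (semigroup s f) (semigroup t f)) < eps.
Proof.
  intros Hf Ht eps He.
  destruct (unif_cont (X true f) (-2) (t + 1) (X_cont _ _ Hf) (eps/4) ltac:(lra)) as [d1 [P1 K1]].
  destruct (unif_cont (X false f) (-2) (t + 1) (X_cont _ _ Hf) (eps/4) ltac:(lra)) as [d2 [P2 K2]].
  (* The bound 1 keeps [s + x] inside [-2, t + 1], where uniform continuity is known. *)
  exists (Rmin 1 (Rmin d1 d2)). split; [repeat apply Rmin_glb_lt; lra|].
  intros s Hs Hst. pose proof (Rmin_l 1 (Rmin d1 d2)). pose proof (Rmin_r 1 (Rmin d1 d2)).
  pose proof (Rmin_l d1 d2). pose proof (Rmin_r d1 d2).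
  apply supnorm_lt with (2 * (eps / 4)); [lra|]. intros x [Hx1 Hx2].
  apply Cmod_cp_le. intros b. unfold fsub. rewrite cp_minus, !cp_semigroup.
  assert (Rabs (s + x - (t + x)) = Rabs (s - t)) by (f_equal; ring).
  assert (s - t < 1) by (eapply Rle_lt_trans; [apply Rle_abs|]; lra).
  destruct b; left; [apply K1|apply K2]; lra.
Qed.

Lemma RInt_comp b (F : fn) x : Ival x ->
  RInt (comp b F) 0 x = RInt (fun s => cp b (F s)) 0 x.
Proof.
  intros [H1 H2]. apply RInt_ext. intros s. rewrite Rmin_right, Rmax_left by lra.
  intros Hs. apply comp_I. unfold Ival; lra.
Qed.

(* For [f] in the domain the compatibility condition at [0] makes the whole
   trajectory continuously differentiable. *)
Lemma X_domain_C1 f g : Agraph f g -> forall b, exists Z, cont Z /\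
  (forall s, Ival s -> Z s = comp b g s) /\
  (forall t, -2 <= t -> X b f t = X b f 0 + RInt Z 0 t).
Proof.
  intros [Hf [Hg [HD HB]]] b. pose proof (X_cont b f Hf) as CX.
  pose proof (proj1 (inE_comp g) Hg b) as Cg.
  (* For s >= 0 the two values of [comp b g] cancel and the right hand side of the delay equation
     remains; for s <= 0 the compatibility condition cancels the other terms and [comp b g s]
     remains. *)
  set (Z := fun s => comp b g s + (X b f (Rmax 0 s - 2) - X b f (Rmax 0 s - 1)) - comp b g 0).
  assert (CZ : cont Z).
  { unfold Z. apply cont_minus; auto with cont. apply cont_plus; auto.
    apply cont_minus; apply (cont_comp (X b f)); auto with cont. }
  assert (E0 : comp b g 0 = X b f (-2) - X b f (-1)).
  { rewrite !X_past by lra. rewrite !comp_I by (unfold Ival; lra). rewrite HB. apply cp_minus. }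
  assert (EZ : forall s, s <= 0 -> Z s = comp b g s).
  { intros s Hs. unfold Z. rewrite Rmax_left by lra.
    replace (0 - 2) with (-2) by ring. replace (0 - 1) with (-1) by ring. lra. }
  exists Z. split; [|split]; auto.
  - intros s [_ Hs]; auto.
  - intros t Ht. destruct (Rle_dec t 0) as [Hn|Hp].
    + rewrite !X_past by lra. rewrite (proj1 (derivE_RInt f g Hf Hg) HD b t) by (split; lra).
      f_equal. apply RInt_ext. intros s. rewrite Rmin_right, Rmax_left by lra.
      intros Hs. symmetry; apply EZ; lra.
    + pose proof (X_renewal b f Hf t ltac:(lra)) as R1.
      pose proof (X_renewal b f Hf 0 ltac:(lra)) as R0.
      replace (0 - 2) with (-2) in R0 by ring. replace (0 - 1) with (-1) in R0 by ring.
      assert (E : RInt Z 0 t = RInt (fun s => X b f (s + -2) - X b f (s + -1)) 0 t).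
      { apply RInt_eq; [lra|]. intros s Hs. unfold Z.
        rewrite Rmax_right, (comp_const b g s) by lra.
        replace (s + -2) with (s - 2) by ring. replace (s + -1) with (s - 1) by ring. ring. }
      rewrite E, RInt_sub, !RInt_shift by
        (auto; apply (cont_comp (X b f)); auto with cont).
      pose proof (cont_Chasles (X b f) (-2) (-1) (t - 1) CX).
      pose proof (cont_Chasles (X b f) (-2) (t - 2) (t - 1) CX).
      replace (0 + -2) with (-2) by ring. replace (0 + -1) with (-1) by ring.
      replace (t + -2) with (t - 2) by ring. replace (t + -1) with (t - 1) by ring. lra.
Qed.

Lemma quotient_eq h u v w : h <> 0 ->
  Cmod (Cminus (Cmult (RtoC (/ h)) (Cminus u v)) w) =
  Cmod (Cminus (Cminus u v) (Cmult (RtoC h) w)) / Rabs h.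
Proof.
  intros Hh. rewrite <- Cmod_quotient by auto. f_equal. f_equal.
  unfold Cdiv. rewrite RtoC_inv by auto. ring.
Qed.

(** The trajectory has a derivative that is uniformly continuous on [-2, 1], so its difference
    quotients converge uniformly in x. *)
Lemma domain_generator f g : Agraph f g -> forall eps, 0 < eps ->
  exists d, 0 < d /\ forall h, 0 < h < d ->
   supnorm (fsub (fscal (RtoC (/ h)) (fsub (semigroup h f) f)) g) < eps.
Proof.
  intros HA eps He. pose proof HA as [Hf [Hg _]].
  assert (K : forall b, exists d, 0 < d /\ forall h, 0 < h < d -> forall x, Ival x ->
     Rabs (X b f (h + x) - comp b f x - h * comp b g x) <= eps / 4 * h).
  { intros b. destruct (X_domain_C1 f g HA b) as [Z [CZ [EZ HZ]]].
    destruct (unif_cont Z (-2) 1 CZ (eps/4) ltac:(lra)) as [d [Hd U]].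
    exists (Rmin 1 d). split; [apply Rmin_glb_lt; lra|].
    intros h Hh x Hx. pose proof (Rmin_l 1 d). pose proof (Rmin_r 1 d). pose proof Hx as [Hx1 Hx2].
    rewrite <- (X_past b f x), (HZ (h + x)), (HZ x) by lra. rewrite <- (EZ x Hx).
    pose proof (cont_Chasles Z 0 x (h + x) CZ) as E.
    assert (B : Rabs (RInt (fun s => Z s - Z x) x (h + x)) <= eps / 4 * (h + x - x)).
    { apply RInt_bound; auto with cont; [lra|]. intros s Hs. left. apply U; try lra.
      rewrite Rabs_right; lra. }
    rewrite RInt_sub, RInt_constR in B by auto with cont.
    replace (h + x - x) with h in B by ring.
    replace (_ - _ - _) with (RInt Z x (h + x) - h * Z x) by lra. auto. }
  destruct (K true) as [d1 [P1 K1]]. destruct (K false) as [d2 [P2 K2]].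
  exists (Rmin d1 d2). split; [now apply Rmin_glb_lt|].
  intros h Hh. pose proof (Rmin_l d1 d2). pose proof (Rmin_r d1 d2).
  apply supnorm_lt with (2 * (eps / 4)); [lra|]. intros x Hx. unfold fsub, fscal.
  rewrite quotient_eq, (Rabs_right h) by lra. apply Rle_div_l; [lra|].
  rewrite Rmult_assoc. apply Cmod_cp_le. intros b.
  rewrite !cp_minus, cp_scal, cp_semigroup, <- (comp_I b f), <- (comp_I b g) by auto.
  destruct b; [apply K1|apply K2]; auto; lra.
Qed.

(** For x < 0 the semigroup is a shift, so [g] is the right derivative of [f], which determines a
    continuous function. The boundary condition is read off at x = 0, where the shift leaves the
    initial interval. *)
Lemma generator_domain f g : inE f -> inE g ->
  (forall eps, 0 < eps -> exists d, 0 < d /\ forall h, 0 < h < d ->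
   supnorm (fsub (fscal (RtoC (/ h)) (fsub (semigroup h f) f)) g) < eps) ->
  Agraph f g.
Proof.
  intros Hf Hg H.
  assert (K : forall eps, 0 < eps -> exists d, 0 < d /\ forall h, 0 < h < d ->
     forall b x, Ival x -> Rabs (X b f (x + h) - X b f x - h * comp b g x) <= eps * h).
  { intros eps He. destruct (H eps He) as [d [Hd K]]. exists d; split; auto.
    intros h Hh b x Hx. pose proof Hx as [Hx1 Hx2]. specialize (K h Hh).
    assert (B : Cmod (Cminus (Cmult (RtoC (/ h)) (Cminus (semigroup h f x) (f x))) (g x)) < eps).
    { eapply Rle_lt_trans; [|apply K].
      apply (supnorm_ge (fsub (fscal (RtoC (/ h)) (fsub (semigroup h f) f)) g)); auto with cont. }
    rewrite quotient_eq, (Rabs_right h) in B by lra. apply (Rlt_div_l _ _ h) in B; [|lra].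
    left. eapply Rle_lt_trans; [|apply B].
    eapply Rle_trans; [|apply (cp_Cmod b)].
    rewrite !cp_minus, cp_scal, cp_semigroup, <- (comp_I b f), <- (comp_I b g), <- (X_past b f x) by (auto; lra).
    rewrite (Rplus_comm h x). lra. }
  repeat split; auto.
  - apply derivE_RInt; auto. intros b x Hx.
    pose proof (proj1 (inE_comp g) Hg b) as Cg.
    set (F := fun s => X b f s - RInt (comp b g) (-2) s).
    assert (CF : cont F) by (unfold F; auto with cont).
    assert (E : forall y, Ival y -> F y = F (-2)).
    { intros y [Hy1 Hy2]. apply right_deriv0_const; auto.
      - intros z _ eps He. destruct (proj1 (continuous_eps F z) (CF z) eps He) as [d [Hd L]].
        exists d; auto.
      - intros z Hz eps He.
        destruct (K (eps/2) ltac:(lra)) as [d1 [Hd1 K1]].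
        destruct (RInt_increment (comp b g) z (eps/2) Cg ltac:(lra)) as [d2 [Hd2 K2]].
        exists (Rmin d1 d2). split; [now apply Rmin_glb_lt|].
        intros k Hk _. pose proof (Rmin_l d1 d2). pose proof (Rmin_r d1 d2).
        specialize (K1 k ltac:(lra) b z ltac:(unfold Ival; lra)).
        specialize (K2 (z + k)). replace (z + k - z) with k in K2 by ring.
        rewrite (Rabs_right k) in K2 by lra. specialize (K2 ltac:(lra)).
        pose proof (cont_Chasles (comp b g) (-2) z (z + k) Cg) as E. unfold F.
        replace (_ - _) with ((X b f (z + k) - X b f z - k * comp b g z)
           - (RInt (comp b g) z (z + k) - k * comp b g z)) by lra.
        eapply Rle_trans; [apply Rabs_triang|]. rewrite Rabs_Ropp. lra. }
    pose proof (E x Hx) as E1. pose proof (E 0 Ival_0) as E2. unfold F in *.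
    rewrite !X_past in * by (destruct Hx; lra).
    pose proof (cont_Chasles (comp b g) (-2) 0 x Cg). lra.
  (* By conservation X(h) - X(0) is the integral over [-2, -2 + h] minus that over [-1, -1 + h].
     Divided by h it tends to f(-2) - f(-1), and by [K] also to g(0). *)
  - apply cp_ext. intros b. rewrite cp_minus, <- !(comp_I b) by (unfold Ival; lra).
    apply cond_eq. intros eps He.
    pose proof (X_cont b f Hf) as CX.
    destruct (K (eps/4) ltac:(lra)) as [d [Hd K1]].
    destruct (RInt_increment (X b f) (-2) (eps/4) CX ltac:(lra)) as [d1 [Hd1 L1]].
    destruct (RInt_increment (X b f) (-1) (eps/4) CX ltac:(lra)) as [d2 [Hd2 L2]].
    set (h := Rmin d (Rmin d1 d2) / 2).
    assert (Hm : 0 < Rmin d (Rmin d1 d2)) by (repeat apply Rmin_glb_lt; auto).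
    assert (Hh : 0 < h < d /\ h < d1 /\ h < d2).
    { unfold h. pose proof (Rmin_l d (Rmin d1 d2)). pose proof (Rmin_r d (Rmin d1 d2)).
      pose proof (Rmin_l d1 d2). pose proof (Rmin_r d1 d2). lra. }
    specialize (K1 h ltac:(lra) b 0 Ival_0). rewrite Rplus_0_l in K1.
    specialize (L1 (-2 + h)). specialize (L2 (-1 + h)).
    replace (-2 + h - -2) with h in L1 by ring. replace (-1 + h - -1) with h in L2 by ring.
    rewrite (Rabs_right h) in L1, L2 by lra.
    specialize (L1 ltac:(lra)). specialize (L2 ltac:(lra)).
    pose proof (X_renewal b f Hf h ltac:(lra)) as R1.
    pose proof (X_renewal b f Hf 0 ltac:(lra)) as R0.
    pose proof (cont_Chasles (X b f) (-2) (-1) (-1 + h) CX).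
    pose proof (cont_Chasles (X b f) (-2) (-2 + h) (-1 + h) CX).
    replace (0 - 2) with (-2) in R0 by ring. replace (0 - 1) with (-1) in R0 by ring.
    replace (h - 2) with (-2 + h) in R1 by ring. replace (h - 1) with (-1 + h) in R1 by ring.
    rewrite !(X_past b f (-2)), !(X_past b f (-1)) in * by lra.
    set (D := comp b g 0 - (comp b f (-2) - comp b f (-1))).
    assert (B : Rabs (h * D) <= 3 / 4 * eps * h).
    { apply Rabs_le_between in K1, L1, L2. apply Rabs_le_between. unfold D. lra. }
    rewrite Rabs_mult, (Rabs_right h) in B by lra.
    apply Rmult_lt_reg_l with h; [lra|]. nra.
Qed.

Lemma semigroup_generates : generates_A semigroup.
Proof.
  split; [|split; [|split; [|split]]].
  - apply semigroup_bounded_linear.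
  - intros f Hf x Hx. apply cp_ext. intros b.
    rewrite cp_semigroup, Rplus_0_l, X_past, comp_I by (auto; apply Hx). auto.
  - intros t s f Ht Hs Hf x Hx. apply cp_ext. intros b.
    rewrite !cp_semigroup, X_shift by (auto; destruct Hx; lra). f_equal; ring.
  - intros f t Hf Ht. now apply semigroup_continuous.
  - intros f g Hf Hg. split; [apply domain_generator|now apply generator_domain].
Qed.

(** The approximation is the time average (1/h) int_0^h S(s) f ds. Averaging along the trajectory,
    rather than along a constant extension of [f], is what makes the boundary condition hold. *)
Lemma domain_dense f eps : inE f -> 0 < eps -> exists f' g', Agraph f' g' /\
  supnorm (fsub f f') <= eps.
Proof.
  intros Hf He.
  destruct (unif_cont (X true f) (-2) 1 (X_cont _ _ Hf) (eps/2) ltac:(lra)) as [d1 [P1 K1]].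
  destruct (unif_cont (X false f) (-2) 1 (X_cont _ _ Hf) (eps/2) ltac:(lra)) as [d2 [P2 K2]].
  set (h := Rmin 1 (Rmin d1 d2) / 2).
  assert (Hm : 0 < Rmin 1 (Rmin d1 d2)) by (repeat apply Rmin_glb_lt; lra).
  assert (Hh : 0 < h < 1 /\ h < d1 /\ h < d2).
  { unfold h. pose proof (Rmin_l 1 (Rmin d1 d2)). pose proof (Rmin_r 1 (Rmin d1 d2)).
    pose proof (Rmin_l d1 d2). pose proof (Rmin_r d1 d2). lra. }
  set (av := fun b x => / h * RInt (X b f) x (x + h)).
  set (dav := fun b x => / h * (X b f (x + h) - X b f x)).
  set (f' := (fun x => (av true x, av false x)) : fn).
  set (g' := (fun x => (dav true x, dav false x)) : fn).
  assert (Ef : forall b x, cp b (f' x) = av b x) by (intros []; auto).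
  assert (Eg : forall b x, cp b (g' x) = dav b x) by (intros []; auto).
  assert (CX : forall b, cont (X b f)) by auto with cont.
  assert (CXh : forall b, cont (fun x => X b f (x + h)))
    by (intros b; apply (cont_comp (X b f)); auto with cont).
  assert (Cd : forall b, cont (dav b)) by (intros b; unfold dav; auto with cont).
  assert (Hf' : inE f').
  { apply inE_fn. intros b. apply cont_ext with (av b); [intros; now rewrite Ef|].
    unfold av. apply cont_mult; auto with cont. }
  assert (Hg' : inE g').
  { apply inE_fn. intros b. apply cont_ext with (dav b); [intros; now rewrite Eg|]. auto. }
  exists f', g'. split.
  - repeat split; auto.
    + apply derivE_RInt; auto. intros b x Hx. rewrite RInt_comp, !comp_I, !Ef by auto.
      rewrite (RInt_ext _ (dav b)) by (intros; apply Eg).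
      unfold dav, av. rewrite RInt_mulc, RInt_sub, RInt_shift by auto with cont.
      rewrite <- Rmult_plus_distr_l. f_equal.
      pose proof (cont_Chasles (X b f) 0 x (x + h) (CX b)).
      pose proof (cont_Chasles (X b f) 0 (0 + h) (x + h) (CX b)). lra.
    + apply cp_ext. intros b. rewrite cp_minus, !Ef, Eg. unfold av, dav.
      rewrite <- Rmult_minus_distr_l. f_equal.
      pose proof (X_renewal b f Hf h ltac:(lra)) as R1.
      pose proof (X_renewal b f Hf 0 ltac:(lra)) as R0.
      pose proof (cont_Chasles (X b f) (-2) (-1) (-1 + h) (CX b)).
      pose proof (cont_Chasles (X b f) (-2) (-2 + h) (-1 + h) (CX b)).
      replace (0 - 2) with (-2) in R0 by ring. replace (0 - 1) with (-1) in R0 by ring.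
      replace (h - 2) with (-2 + h) in R1 by ring. replace (h - 1) with (-1 + h) in R1 by ring.
      rewrite Rplus_0_l. lra.
  - apply supnorm_le. intros x Hx. pose proof Hx as [Hx1 Hx2].
    replace eps with (2 * (eps / 2)) by field. apply Cmod_cp_le. intros b.
    unfold fsub. rewrite cp_minus, Ef, <- comp_I, <- X_past by auto.
    assert (B : Rabs (RInt (fun s => X b f x - X b f s) x (x + h)) <= eps / 2 * (x + h - x)).
    { apply RInt_bound; auto with cont; [lra|]. intros s Hs.
      assert (Rabs (x - s) <= h) by (rewrite Rabs_left1; lra).
      left. destruct b; [apply K1|apply K2]; lra. }
    rewrite RInt_sub, RInt_constR in B by auto with cont.
    replace (x + h - x) with h in B by ring.
    unfold av. replace (X b f x - / h * RInt (X b f) x (x + h))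
      with (/ h * (h * X b f x - RInt (X b f) x (x + h))) by (field; lra).
    assert (0 < / h) by (apply Rinv_0_lt_compat; lra).
    rewrite Rabs_mult, (Rabs_right (/ h)) by lra.
    apply Rle_trans with (/ h * (eps / 2 * h)).
    + apply Rmult_le_compat_l; lra.
    + right; field; lra.
Qed.

(** * Uniqueness of the semigroup generated by A *)

Lemma bounded_linear_fsub T f g : bounded_linear T -> inE f -> inE g ->
  eqE (T (fsub f g)) (fsub (T f) (T g)).
Proof.
  intros [_ [HE [HL _]]] Hf Hg x Hx.
  rewrite (HE _ (flin (RtoC 1) f (RtoC (-1)) g)); auto with cont.
  - rewrite HL by auto. symmetry. now apply fsub_flin.
  - apply fsub_flin.
Qed.

Lemma bounded_linear_fscal T a f : bounded_linear T -> inE f ->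
  eqE (T (fscal a f)) (fscal a (T f)).
Proof.
  intros [_ [HE [HL _]]] Hf x Hx.
  rewrite (HE _ (flin a f (RtoC 0) f)); auto with cont.
  - rewrite HL by auto. unfold flin, fscal. ring.
  - intros y _. unfold flin, fscal. ring.
Qed.

Lemma supnorm_eqE f g : eqE f g -> supnorm f = supnorm g.
Proof.
  intros E. unfold supnorm. f_equal. apply Lub_Rbar_eqset. intros r.
  split; intros [x [Hx ->]]; exists x; split; auto; now rewrite E.
Qed.

(** [T s] commutes with the difference quotients of the orbit, and its boundedness carries their
    limit along. *)
Lemma generates_domain_invariant T f g s : generates_A T -> Agraph f g -> 0 <= s ->
  Agraph (T s f) (T s g).
Proof.
  intros [HB [H0 [HS [HC HG]]]] HA Hs. pose proof HA as [Hf [Hg _]].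
  pose proof (HB s Hs) as BL. destruct BL as [B1 [B2 [B3 [M BM]]]].
  apply HG; auto. intros eps He.
  assert (HM : 0 < Rabs M + 1) by (pose proof (Rabs_pos M); lra).
  destruct (proj1 (HG f g Hf Hg) HA (eps / (Rabs M + 1))) as [d [Hd K]].
  { now apply Rdiv_lt_0_compat. }
  exists d; split; auto. intros h Hh. specialize (K h Hh).
  assert (Hh0 : 0 <= h) by lra.
  set (q := fsub (fscal (RtoC (/ h)) (fsub (T h f) f)) g) in *.
  assert (Hq1 : inE (T h f)) by (apply HB; auto).
  assert (Hq : inE q) by (unfold q; auto with cont).
  rewrite (supnorm_eqE _ (T s q)).
  - eapply Rle_lt_trans; [apply BM; auto|].
    apply Rle_lt_trans with (Rabs M * supnorm q).
    + apply Rmult_le_compat_r; [apply supnorm_pos|apply Rle_abs].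
    + pose proof (Rabs_pos M). pose proof (supnorm_pos q).
      apply (Rlt_div_r _ _ (Rabs M + 1)) in K; auto. nra.
  - intros x Hx. unfold q.
    rewrite (bounded_linear_fsub (T s)); auto with cont. unfold fsub at 1 3. f_equal.
    rewrite (bounded_linear_fscal (T s)); auto with cont. unfold fscal. f_equal.
    rewrite (bounded_linear_fsub (T s)); auto with cont. unfold fsub. f_equal.
    rewrite <- (HS h s) by auto. rewrite <- (HS s h) by auto. now rewrite Rplus_comm.
Qed.

(* [s |-> S (t - s) (T s f)] has right derivative [0] for [f] in the domain. *)
Lemma generates_unique_domain T f g t : generates_A T -> Agraph f g -> 0 <= t ->
  eqE (T t f) (semigroup t f).
Proof.
  intros HT HA Ht x Hx. pose proof HT as [HB [H0 [HS [HC HG]]]].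
  pose proof HA as [Hf [Hg _]]. pose proof Hx as [Hx1 Hx2].
  assert (HE : forall s, 0 <= s -> inE (T s f)) by (intros; apply HB; auto).
  apply cp_ext. intros b. rewrite cp_semigroup.
  set (psi := fun s => X b (T s f) (t - s + x)).
  assert (E : psi t = psi 0).
  { apply right_deriv0_const; auto.
    - intros s Hs eps He.
      destruct (HC f s Hf ltac:(lra) (eps / 6) ltac:(lra)) as [d1 [P1 K1]].
      destruct (proj1 (continuous_eps _ _) (X_cont b (T s f) (HE s ltac:(lra)) (t - s + x)) (eps/2) ltac:(lra))
        as [d2 [P2 K2]].
      exists (Rmin d1 d2). split; [now apply Rmin_glb_lt|].
      intros r Hr Hrs. pose proof (Rmin_l d1 d2). pose proof (Rmin_r d1 d2).
      specialize (K1 r ltac:(lra) ltac:(lra)).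
      specialize (K2 (t - r + x)).
      replace (t - r + x - (t - s + x)) with (- (r - s)) in K2 by ring.
      rewrite Rabs_Ropp in K2. specialize (K2 ltac:(lra)).
      unfold psi. replace (_ - _) with (X b (fsub (T r f) (T s f)) (t - r + x)
        + (X b (T s f) (t - r + x) - X b (T s f) (t - s + x)))
        by (rewrite X_fsub by (try apply HE; lra); ring).
      eapply Rle_lt_trans; [apply Rabs_triang|].
      pose proof (X_bound b (fsub (T r f) (T s f)) (t - r + x)
        (inE_fsub _ _ (HE r ltac:(lra)) (HE s ltac:(lra))) ltac:(lra)). lra.
    - intros s Hs eps He. set (v := T s f). set (w := T s g).
      assert (HA' : Agraph v w) by (apply generates_domain_invariant; auto; lra).
      pose proof HA' as [Hv [Hw _]].
      destruct (proj1 (HG v w Hv Hw) HA' (eps/6) ltac:(lra)) as [d1 [P1 K1]].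
      destruct (domain_generator v w HA' (eps/6) ltac:(lra)) as [d2 [P2 K2]].
      exists (Rmin d1 d2). split; [now apply Rmin_glb_lt|].
      intros h Hh Hsh. pose proof (Rmin_l d1 d2). pose proof (Rmin_r d1 d2).
      specialize (K1 h ltac:(lra)). specialize (K2 h ltac:(lra)).
      assert (Hh0 : 0 <= h) by lra.
      assert (HTv : inE (T h v)) by (apply HB; auto).
      (* Both semigroups have the same right derivative [w] at [v]: each quotient is within eps/6 of
         it. The remaining evolution by S multiplies this error by at most 3. *)
      assert (D : supnorm (fsub (T h v) (semigroup h v)) <= eps / 3 * h).
      { apply supnorm_le. intros y Hy.
        pose proof (supnorm_ge _ y (inE_fsub _ _ (inE_fscal (RtoC (/h)) _ (inE_fsub _ _ HTv Hv)) Hw) Hy) as A1.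
        pose proof (supnorm_ge _ y (inE_fsub _ _ (inE_fscal (RtoC (/h)) _ (inE_fsub _ _ (inE_semigroup h v Hv) Hv)) Hw) Hy) as A2.
        unfold fsub, fscal in *. rewrite quotient_eq, (Rabs_right h) in A1, A2 by lra.
        assert (A1' := Rle_lt_trans _ _ _ A1 K1). assert (A2' := Rle_lt_trans _ _ _ A2 K2).
        apply (Rlt_div_l _ _ h) in A1', A2'; try lra.
        match type of A1' with Cmod ?a < _ => match type of A2' with Cmod ?c < _ =>
          replace (Cminus (T h v y) (semigroup h v y)) with (Cplus a (Copp c)) by ring end end.
        eapply Rle_trans; [apply Cmod_triangle|]. rewrite Cmod_opp. lra. }
      unfold psi.
      rewrite (X_eqE b (T (s + h) f) (T h v)); [|apply HE; lra| |lra].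
      2: { rewrite Rplus_comm. apply HS; auto; lra. }
      (* Splitting off a step h of S leaves both trajectories with the same remaining time, so they
         can be subtracted. *)
      replace (t - s + x) with (t - (s + h) + x + h) by ring.
      rewrite <- (X_shift b (T s f)) by (auto; lra).
      rewrite <- X_fsub by (auto with cont; lra).
      eapply Rle_trans; [apply X_bound; auto with cont; lra|]. fold v. lra. }
  unfold psi in E. replace (t - t + x) with x in E by ring.
  rewrite X_past, comp_I in E by auto. rewrite E. rewrite Rminus_0_r.
  apply X_eqE; [apply HE; lra|apply H0; auto|lra].
Qed.

(** Both operators are bounded and agree on the dense domain; the constant 6 in the estimate is the
    bound of [semigroup]. *)
Lemma generates_unique T f t : generates_A T -> inE f -> 0 <= t ->
  eqE (T t f) (semigroup t f).
Proof.
  intros HT Hf Ht x Hx. pose proof HT as [HB _].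
  pose proof (HB t Ht) as BT. pose proof BT as [B1 [_ [_ [M BM]]]].
  assert (Z : Cminus (T t f x) (semigroup t f x) = RtoC 0).
  2: { replace (T t f x) with (Cplus (Cminus (T t f x) (semigroup t f x)) (semigroup t f x)) by ring.
       rewrite Z. ring. }
  apply Cmod_eq_0. apply Rle_antisym; [|apply Cmod_ge_0].
  apply le_epsilon. intros eps He. rewrite Rplus_0_l.
  assert (HM : 0 < Rabs M + 6) by (pose proof (Rabs_pos M); lra).
  destruct (domain_dense f (eps / (Rabs M + 6)) Hf) as [f' [g' [HA HD]]].
  { now apply Rdiv_lt_0_compat. }
  pose proof HA as [Hf' _].
  pose proof (generates_unique_domain T f' g' t HT HA Ht x Hx) as E.
  pose proof (bounded_linear_fsub (T t) f f' BT Hf Hf' x Hx) as E1.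
  pose proof (bounded_linear_fsub (semigroup t) f f' (semigroup_bounded_linear t Ht) Hf Hf' x Hx) as E2.
  unfold fsub at 2 in E1. unfold fsub at 2 in E2.
  replace (Cminus (T t f x) (semigroup t f x)) with
    (Cplus (T t (fsub f f') x) (Copp (semigroup t (fsub f f') x)))
    by (rewrite E1, E2, E; ring).
  eapply Rle_trans; [apply Cmod_triangle|]. rewrite Cmod_opp.
  assert (Hs : inE (fsub f f')) by auto with cont.
  pose proof (supnorm_ge _ x (B1 _ Hs) Hx) as N1. pose proof (BM _ Hs) as N2.
  pose proof (supnorm_ge _ x (inE_semigroup t _ Hs) Hx) as N3.
  pose proof (semigroup_bound t _ Hs Ht) as N4.
  pose proof (supnorm_pos (fsub f f')) as N0.
  assert (M * supnorm (fsub f f') <= Rabs M * supnorm (fsub f f'))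
    by (apply Rmult_le_compat_r; [auto|apply Rle_abs]).
  apply (Rle_div_r _ _ (Rabs M + 6)) in HD; auto. lra.
Qed.

(** * Complex exponentials and integrals *)

Definition ccont (F : R -> C) : Prop := forall b, cont (fun x => cp b (F x)).

Lemma ccont_const c : ccont (fun _ => c).
Proof. intros b; auto with cont. Qed.
Lemma ccont_plus F G : ccont F -> ccont G -> ccont (fun x => Cplus (F x) (G x)).
Proof.
  intros HF HG b. apply cont_ext with (fun x => cp b (F x) + cp b (G x)).
  - intros x. now rewrite cp_plus.
  - apply cont_plus; auto.
Qed.
Lemma ccont_mult F G : ccont F -> ccont G -> ccont (fun x => Cmult (F x) (G x)).
Proof.
  intros HF HG b.
  pose proof (HF true); pose proof (HF false); pose proof (HG true); pose proof (HG false).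
  destruct b; simpl in *; auto with cont.
Qed.
Lemma ccont_minus F G : ccont F -> ccont G -> ccont (fun x => Cminus (F x) (G x)).
Proof.
  intros HF HG b. apply cont_ext with (fun x => cp b (F x) - cp b (G x)).
  - intros x. now rewrite cp_minus.
  - apply cont_minus; auto.
Qed.
Lemma ccont_RtoC f : cont f -> ccont (fun x => RtoC (f x)).
Proof. intros H []; simpl; auto with cont. Qed.
#[global] Hint Resolve ccont_const ccont_plus ccont_mult ccont_minus ccont_RtoC : cont.

Definition cderive (F : R -> C) (x : R) (l : C) : Prop :=
  forall b, is_derive (fun t => cp b (F t)) x (cp b l).

Lemma cderive_ccont F dF : (forall x, cderive F x (dF x)) -> ccont F.
Proof. intros H b. apply cont_derive with (fun x => cp b (dF x)). intros x; apply H. Qed.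

Lemma cderive_const c x : cderive (fun _ => c) x (RtoC 0).
Proof. intros b. replace (cp b (RtoC 0)) with 0 by (now destruct b). apply @is_derive_const. Qed.

Lemma cderive_plus F G x l m : cderive F x l -> cderive G x m ->
  cderive (fun t => Cplus (F t) (G t)) x (Cplus l m).
Proof.
  intros HF HG b. rewrite cp_plus.
  apply is_derive_ext with (fun t => cp b (F t) + cp b (G t)).
  - intros t. now rewrite cp_plus.
  - apply (is_derive_plus (fun t => cp b (F t)) (fun t => cp b (G t))); auto.
Qed.

Lemma is_derive_Rmult (f g : R -> R) x l m : is_derive f x l -> is_derive g x m ->
  is_derive (fun t => f t * g t) x (l * g x + f x * m).
Proof. intros Hf Hg. apply (is_derive_mult f g x l m Hf Hg). intros; apply Rmult_comm. Qed.

Lemma cderive_mult F G x l m : cderive F x l -> cderive G x m ->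
  cderive (fun t => Cmult (F t) (G t)) x (Cplus (Cmult l (G x)) (Cmult (F x) m)).
Proof.
  intros HF HG b.
  pose proof (HF true) as F1; pose proof (HF false) as F2;
  pose proof (HG true) as G1; pose proof (HG false) as G2. simpl in F1, F2, G1, G2.
  destruct b; simpl; evar_last.
  - apply (is_derive_minus (fun t => fst (F t) * fst (G t)) (fun t => snd (F t) * snd (G t)));
      apply is_derive_Rmult; eauto.
  - unfold minus, plus, opp; simpl. ring.
  - apply (is_derive_plus (fun t => fst (F t) * snd (G t)) (fun t => snd (F t) * fst (G t)));
      apply is_derive_Rmult; eauto.
  - unfold minus, plus, opp; simpl. ring.
Qed.

(** Taken by components, to inherit the real lemmas; [RInt_C_CInt] identifies it with the integral
    in the contour formula. *)
Definition CInt (F : R -> C) (a b : R) : C :=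
  (RInt (fun s => fst (F s)) a b, RInt (fun s => snd (F s)) a b).

Lemma cp_CInt c F a b : cp c (CInt F a b) = RInt (fun s => cp c (F s)) a b.
Proof. now destruct c. Qed.

Lemma CInt_Chasles F a b c : ccont F -> Cplus (CInt F a b) (CInt F b c) = CInt F a c.
Proof.
  intros H. apply cp_ext. intros e. rewrite cp_plus, !cp_CInt. apply cont_Chasles, H.
Qed.

Lemma CInt_refl F a : CInt F a a = RtoC 0.
Proof. apply cp_ext. intros e. rewrite cp_CInt, RInt_refl. now destruct e. Qed.

Lemma CInt_ext F G a b : (forall x, Rmin a b <= x <= Rmax a b -> F x = G x) ->
  CInt F a b = CInt G a b.
Proof.
  intros H. apply cp_ext. intros e. rewrite !cp_CInt. apply RInt_ext.
  intros x Hx. rewrite H; auto; lra.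
Qed.

Lemma CInt_plus F G a b : ccont F -> ccont G ->
  CInt (fun s => Cplus (F s) (G s)) a b = Cplus (CInt F a b) (CInt G a b).
Proof.
  intros HF HG. apply cp_ext. intros e. rewrite cp_plus, !cp_CInt, <- RInt_add; auto.
  apply RInt_ext. intros; apply cp_plus.
Qed.

Lemma CInt_scal c F a b : ccont F ->
  CInt (fun s => Cmult c (F s)) a b = Cmult c (CInt F a b).
Proof.
  intros H. pose proof (H true) as H1. pose proof (H false) as H2. simpl in H1, H2.
  unfold CInt. apply injective_projections; simpl.
  - rewrite RInt_sub, !RInt_mulc by auto with cont. auto.
  - rewrite RInt_add, !RInt_mulc by auto with cont. auto.
Qed.

Lemma CInt_bound F a b M : ccont F -> a <= b ->
  (forall t, a <= t <= b -> Cmod (F t) <= M) -> Cmod (CInt F a b) <= 2 * (M * (b - a)).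
Proof.
  intros H Hab HM. apply Cmod_cp_le. intros e. rewrite cp_CInt.
  apply RInt_bound; auto. intros t Ht. eapply Rle_trans; [apply cp_Cmod|auto].
Qed.

Lemma CInt_derive F dF a b : (forall x, cderive F x (dF x)) -> ccont dF ->
  CInt dF a b = Cminus (F b) (F a).
Proof.
  intros H HC. apply cp_ext. intros e. rewrite cp_CInt, cp_minus.
  apply is_RInt_unique. apply (is_RInt_derive (fun t => cp e (F t))).
  - intros x _. apply H.
  - intros x _. apply HC.
Qed.

Lemma CInt_cderive F a x : ccont F -> cderive (fun t => CInt F a t) x (F x).
Proof.
  intros H e. apply is_derive_ext with (fun t => RInt (fun s => cp e (F s)) a t).
  - intros t. now rewrite cp_CInt.
  - apply (cont_RInt_derive (fun s => cp e (F s))), H.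
Qed.

Lemma CInt_cderive_lower F c x : ccont F ->
  cderive (fun t => CInt F t c) x (Copp (F x)).
Proof.
  intros H e. apply is_derive_ext with (fun t => - RInt (fun s => cp e (F s)) c t).
  - intros t. rewrite cp_CInt, (RInt_flip _ t c); auto.
  - rewrite cp_opp.
    apply (is_derive_opp (fun t => RInt (fun s => cp e (F s)) c t)).
    apply (cont_RInt_derive (fun s => cp e (F s))), H.
Qed.

Definition cexp (z : C) : C := (exp (fst z) * cos (snd z), exp (fst z) * sin (snd z)).

Lemma cexp_0 : cexp (RtoC 0) = RtoC 1.
Proof. unfold cexp; simpl. now rewrite exp_0, cos_0, sin_0, Rmult_1_l, Rmult_0_r. Qed.

Lemma cexp_plus z w : cexp (Cplus z w) = Cmult (cexp z) (cexp w).
Proof.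
  unfold cexp; simpl. rewrite exp_plus, cos_plus, sin_plus.
  apply injective_projections; simpl; ring.
Qed.

Lemma cexp_opp z : Cmult (cexp z) (cexp (Copp z)) = RtoC 1.
Proof. rewrite <- cexp_plus, <- cexp_0. f_equal. ring. Qed.

Lemma Cmod_cexp z : Cmod (cexp z) = exp (fst z).
Proof.
  unfold Cmod, cexp; simpl fst; simpl snd.
  replace (_ + _) with (exp (fst z) ^ 2).
  - apply sqrt_pow2. left; apply exp_pos.
  - pose proof (sin2_cos2 (snd z)) as E. unfold Rsqr in E.
    transitivity (exp (fst z) ^ 2 * (sin (snd z) * sin (snd z) + cos (snd z) * cos (snd z))).
    + rewrite E; ring.
    + ring.
Qed.

Lemma cexp_cderive lam x :
  cderive (fun t => cexp (Cmult lam (RtoC t))) x (Cmult lam (cexp (Cmult lam (RtoC x)))).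
Proof.
  assert (E : forall t, cexp (Cmult lam (RtoC t)) =
    (exp (fst lam * t) * cos (snd lam * t), exp (fst lam * t) * sin (snd lam * t))).
  { intros t. unfold cexp; simpl.
    replace (fst lam * t - snd lam * 0) with (fst lam * t) by ring.
    replace (fst lam * 0 + snd lam * t) with (snd lam * t) by ring. reflexivity. }
  intros b. rewrite E. eapply is_derive_ext.
  - intros t. rewrite E. reflexivity.
  - destruct b; simpl; auto_derive; auto; ring.
Qed.

Lemma cexp_ccont lam : ccont (fun t => cexp (Cmult lam (RtoC t))).
Proof. apply cderive_ccont with (fun x => Cmult lam (cexp (Cmult lam (RtoC x)))), cexp_cderive. Qed.
#[global] Hint Resolve cexp_ccont : cont.

Lemma exp_mono x y : x <= y -> exp x <= exp y.
Proof. intros [H| ->]; [left; now apply exp_increasing|right; auto]. Qed.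

Lemma cexp_bound lam x r : Rabs x <= r -> Cmod (cexp (Cmult lam (RtoC x))) <= exp (Cmod lam * r).
Proof.
  intros H. rewrite Cmod_cexp. apply exp_mono.
  eapply Rle_trans; [apply Rle_abs|].
  eapply Rle_trans; [apply (cp_Cmod true)|]. rewrite Cmod_mult, Cmod_R.
  apply Rmult_le_compat_l; auto. apply Cmod_ge_0.
Qed.

(** * The resolvent *)

Definition ext (g : fn) : fn := fun s => g (clamp s).

Lemma ext_ccont g : inE g -> ccont (ext g).
Proof. intros H b. now apply inE_comp. Qed.

Lemma ext_I g x : Ival x -> ext g x = g x.
Proof. intros H. unfold ext. now rewrite clamp_id. Qed.

(** Variation of constants: lam f - f' = g means f(x) = e^{lam x} (f(0) + Phi(x)). *)
Definition Phi (lam : C) (g : fn) (x : R) : C :=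
  CInt (fun s => Cmult (cexp (Cmult lam (RtoC (- s)))) (ext g s)) x 0.

(** Inserting that formula into f'(0) = f(-2) - f(-1), with f'(0) = lam f(0) - g(0), gives lam
    D(lam) f(0) = [num lam g]. *)
Definition num (lam : C) (g : fn) : C :=
  Cplus (g 0) (Cminus (Cmult (cexp (Cmult lam (RtoC (-2)))) (Phi lam g (-2)))
                      (Cmult (cexp (Cmult lam (RtoC (-1)))) (Phi lam g (-1)))).

(** The function D of the overview; the integral form is regular at lam = 0 and easy to bound for Re
    lam > 0. *)
Definition den (lam : C) : C :=
  Cplus (RtoC 1) (CInt (fun s => cexp (Cmult (Copp lam) (RtoC s))) 1 2).

Definition resolv (lam : C) : Op := fun g x =>
  Cmult (cexp (Cmult lam (RtoC x)))
    (Cplus (Cdiv (num lam g) (Cmult lam (den lam))) (Phi lam g x)).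

Lemma cexp_neg lam s : cexp (Cmult lam (RtoC (- s))) = cexp (Cmult (Copp lam) (RtoC s)).
Proof. f_equal. rewrite RtoC_opp. ring. Qed.

Lemma den_char lam : Cmult lam (den lam) =
  Cplus lam (Cminus (cexp (Cmult lam (RtoC (-1)))) (cexp (Cmult lam (RtoC (-2))))).
Proof.
  unfold den. rewrite Cmult_plus_distr_l, Cmult_1_r. f_equal.
  rewrite <- CInt_scal by auto with cont.
  rewrite (CInt_ext _ (fun s => Copp (Cmult (Copp lam) (cexp (Cmult (Copp lam) (RtoC s)))))).
  2: { intros; ring. }
  rewrite (CInt_derive (fun s => Cmult (Copp (RtoC 1)) (cexp (Cmult (Copp lam) (RtoC s))))).
  - rewrite <- !cexp_neg. replace (Ropp 1) with (-1) by ring. replace (Ropp 2) with (-2) by ring. ring.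
  - intros x. replace (Copp (Cmult (Copp lam) (cexp (Cmult (Copp lam) (RtoC x))))) with
      (Cplus (Cmult (RtoC 0) (cexp (Cmult (Copp lam) (RtoC x))))
      (Cmult (Copp (RtoC 1)) (Cmult (Copp lam) (cexp (Cmult (Copp lam) (RtoC x)))))) by ring.
    apply (cderive_mult (fun _ => Copp (RtoC 1))); [apply cderive_const|apply cexp_cderive].
  - intros b. apply cont_ext with (fun s => - cp b (Cmult (Copp lam) (cexp (Cmult (Copp lam) (RtoC s))))).
    + intros; now rewrite cp_opp.
    + apply cont_opp. apply (ccont_mult (fun _ => Copp lam)); auto with cont.
Qed.

Lemma Phi_ccont_integrand lam g : inE g ->
  ccont (fun s => Cmult (cexp (Cmult lam (RtoC (- s)))) (ext g s)).
Proof.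
  intros Hg. apply ccont_mult; [|now apply ext_ccont].
  intros b. apply (cont_comp (fun s => cp b (cexp (Cmult lam (RtoC s))))); auto with cont.
  apply cexp_ccont.
Qed.
#[global] Hint Resolve Phi_ccont_integrand : cont.

Lemma CInt_comp b (g : fn) x : inE g -> cp b (CInt (ext g) 0 x) = RInt (comp b g) 0 x.
Proof. intros H. now rewrite cp_CInt. Qed.

Lemma Agraph_CInt f h : inE f -> inE h ->
  (Agraph f h <-> (forall x, Ival x -> f x = Cplus (f 0) (CInt (ext h) 0 x)) /\ h 0 = Cminus (f (-2)) (f (-1))).
Proof.
  intros Hf Hh. unfold Agraph. rewrite (derivE_RInt f h Hf Hh). split.
  - intros [_ [_ [H H0]]]. split; auto. intros x Hx. apply cp_ext. intros b.
    rewrite cp_plus, CInt_comp, <- !(comp_I b f) by auto. apply H; auto.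
  - intros [H H0]. repeat split; auto. intros b x Hx.
    rewrite !comp_I by auto. rewrite (H x Hx) at 1. now rewrite cp_plus, CInt_comp.
Qed.

(** Integrating factor: the derivative of e^{-lam s} f(s) is - e^{-lam s} g(s), integrated over
    [x, 0]. *)
Lemma resolvent_formula lam f h g : Agraph f h -> eqE (fsub (fscal lam f) h) g ->
  forall x, Ival x -> f x = Cmult (cexp (Cmult lam (RtoC x))) (Cplus (f 0) (Phi lam g x)).
Proof.
  intros HA E x Hx. pose proof HA as [Hf [Hh _]].
  destruct (proj1 (Agraph_CInt f h Hf Hh) HA) as [HF _].
  (* [F] agrees with [f] on [-2, 0] but is differentiable on the whole line, as [CInt_derive]
     demands. *)
  set (F := fun s => Cplus (f 0) (CInt (ext h) 0 s)).
  assert (DF : forall s, cderive F s (ext h s)).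
  { intros s. replace (ext h s) with (Cplus (RtoC 0) (ext h s)) by ring.
    apply (cderive_plus (fun _ => f 0)); [apply cderive_const|].
    now apply CInt_cderive, ext_ccont. }
  set (dG := fun s => Cplus (Cmult (Cmult (Copp lam) (cexp (Cmult (Copp lam) (RtoC s)))) (F s))
                       (Cmult (cexp (Cmult (Copp lam) (RtoC s))) (ext h s))).
  assert (CF : ccont F) by (apply cderive_ccont with (ext h); auto).
  pose proof (ext_ccont h Hh) as Ch.
  assert (I : CInt dG x 0 = Cminus (F 0) (Cmult (cexp (Cmult (Copp lam) (RtoC x))) (F x))).
  { rewrite (CInt_derive (fun s => Cmult (cexp (Cmult (Copp lam) (RtoC s))) (F s))).
    - rewrite Cmult_0_r, cexp_0. ring.
    - intros s. apply cderive_mult; auto. apply cexp_cderive.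
    - unfold dG. apply ccont_plus; apply ccont_mult; auto with cont. }
  assert (J : CInt dG x 0 = Copp (Phi lam g x)).
  { unfold Phi. rewrite (CInt_ext dG (fun s => Cmult (Copp (RtoC 1))
      (Cmult (cexp (Cmult lam (RtoC (- s)))) (ext g s)))).
    - rewrite CInt_scal; [ring|]. apply Phi_ccont_integrand.
      apply inE_eqE with (1 := E). auto with cont.
    - intros s Hs. destruct Hx as [Hx1 Hx2]. rewrite Rmin_left, Rmax_right in Hs by lra.
      assert (Is : Ival s) by (split; lra).
      rewrite cexp_neg, (ext_I g s Is), <- (E s Is). unfold dG, fsub, fscal, F.
      rewrite <- HF, ext_I by auto. ring. }
  unfold F in I. rewrite <- (HF x), <- (HF 0) in I by auto.
  transitivity (Cmult (Cmult (cexp (Cmult lam (RtoC x))) (cexp (Copp (Cmult lam (RtoC x))))) (f x)).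
  { rewrite cexp_opp. ring. }
  rewrite <- Cmult_assoc. f_equal.
  replace (Copp (Cmult lam (RtoC x))) with (Cmult (Copp lam) (RtoC x)) by ring.
  rewrite J in I.
  replace (Phi lam g x) with (Copp (Copp (Phi lam g x))) by ring. rewrite I. ring.
Qed.

(** Only f(0) is left free by the differential equation, and the boundary condition fixes it when
    the characteristic function does not vanish. *)
Lemma resolvent_unique lam f h g : Cmult lam (den lam) <> RtoC 0 ->
  Agraph f h -> eqE (fsub (fscal lam f) h) g -> eqE f (resolv lam g).
Proof.
  intros HD HA E x Hx. pose proof (resolvent_formula lam f h g HA E) as HF.
  rewrite HF by auto. unfold resolv. do 2 f_equal.
  pose proof HA as [_ [_ [_ HB]]].
  assert (E0 : Cmult (Cmult lam (den lam)) (f 0) = num lam g).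
  { pose proof (E 0 Ival_0) as E1. unfold fsub, fscal in E1.
    unfold num. rewrite <- E1, HB, (HF (-2)), (HF (-1)), den_char by (unfold Ival; lra). ring. }
  rewrite <- E0. field. split; intros Z; apply HD; rewrite Z; ring.
Qed.

Lemma ext_lin a f c g s : ext (flin a f c g) s = Cplus (Cmult a (ext f s)) (Cmult c (ext g s)).
Proof. reflexivity. Qed.

Lemma Phi_flin lam a f c g x : inE f -> inE g ->
  Phi lam (flin a f c g) x = Cplus (Cmult a (Phi lam f x)) (Cmult c (Phi lam g x)).
Proof.
  intros Hf Hg. unfold Phi. rewrite <- !CInt_scal, <- CInt_plus by auto 10 with cont.
  apply CInt_ext. intros s _. rewrite ext_lin. ring.
Qed.

Lemma Phi_eqE lam f g x : eqE f g -> Phi lam f x = Phi lam g x.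
Proof.
  intros E. apply CInt_ext. intros s _. unfold ext. rewrite E; auto. apply clamp_I.
Qed.

Lemma Phi_bound lam g x : inE g -> Ival x ->
  Cmod (Phi lam g x) <= 4 * exp (Cmod lam * 2) * supnorm g.
Proof.
  intros Hg [Hx1 Hx2].
  pose proof (supnorm_pos g). pose proof (exp_pos (Cmod lam * 2)).
  eapply Rle_trans; [apply CInt_bound with (M := exp (Cmod lam * 2) * supnorm g); auto with cont|].
  - intros s Hs. rewrite Cmod_mult. apply Rmult_le_compat; try apply Cmod_ge_0.
    + apply cexp_bound. rewrite Rabs_right; lra.
    + unfold ext. apply supnorm_ge; auto. apply clamp_I.
  - assert (0 <= exp (Cmod lam * 2) * supnorm g) by (apply Rmult_le_pos; lra). nra.
Qed.

Lemma num_bound lam g : inE g ->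
  Cmod (num lam g) <= (1 + 8 * exp (Cmod lam * 2) ^ 2) * supnorm g.
Proof.
  intros Hg. unfold num.
  assert (B : forall x, Ival x -> Cmod (Cmult (cexp (Cmult lam (RtoC x))) (Phi lam g x))
     <= exp (Cmod lam * 2) * (4 * exp (Cmod lam * 2) * supnorm g)).
  { intros x Hx. rewrite Cmod_mult. apply Rmult_le_compat; try apply Cmod_ge_0.
    - apply cexp_bound. destruct Hx. apply Rabs_le_between; lra.
    - now apply Phi_bound. }
  eapply Rle_trans; [apply Cmod_triangle|].
  pose proof (supnorm_ge g 0 Hg Ival_0).
  assert (Cmod (Cminus (Cmult (cexp (Cmult lam (RtoC (-2)))) (Phi lam g (-2)))
                      (Cmult (cexp (Cmult lam (RtoC (-1)))) (Phi lam g (-1)))) <=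
     exp (Cmod lam * 2) * (4 * exp (Cmod lam * 2) * supnorm g) +
     exp (Cmod lam * 2) * (4 * exp (Cmod lam * 2) * supnorm g)).
  { eapply Rle_trans; [apply Cmod_triangle|]. rewrite Cmod_opp.
    apply Rplus_le_compat; apply B; unfold Ival; lra. }
  nra.
Qed.

Lemma resolv_bound lam : exists K, forall g, inE g -> supnorm (resolv lam g) <= K * supnorm g.
Proof.
  set (e := exp (Cmod lam * 2)).
  exists (e * (((1 + 8 * e ^ 2) * Cmod (/ (Cmult lam (den lam)))) + 4 * e)).
  intros g Hg. apply supnorm_le. intros x Hx. unfold resolv.
  rewrite Cmod_mult, Rmult_assoc. pose proof (exp_pos (Cmod lam * 2)).
  apply Rmult_le_compat; try apply Cmod_ge_0.
  - apply cexp_bound. destruct Hx. apply Rabs_le_between; lra.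
  - eapply Rle_trans; [apply Cmod_triangle|]. rewrite Rmult_plus_distr_r.
    apply Rplus_le_compat; [|now apply Phi_bound].
    unfold Cdiv. rewrite Cmod_mult.
    pose proof (num_bound lam g Hg). fold e in H0.
    pose proof (Cmod_ge_0 (/ (Cmult lam (den lam)))).
    eapply Rle_trans; [apply Rmult_le_compat_r; eauto|]. right; ring.
Qed.

Lemma resolv_cderive lam g : inE g -> forall x,
  cderive (resolv lam g) x (Cminus (Cmult lam (resolv lam g x)) (ext g x)).
Proof.
  intros Hg x. unfold resolv.
  set (a := Cdiv (num lam g) (Cmult lam (den lam))).
  replace (Cminus _ _) with
   (Cplus (Cmult (Cmult lam (cexp (Cmult lam (RtoC x)))) (Cplus a (Phi lam g x)))
      (Cmult (cexp (Cmult lam (RtoC x)))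
        (Cplus (RtoC 0) (Copp (Cmult (cexp (Cmult lam (RtoC (- x)))) (ext g x)))))).
  - apply cderive_mult; [apply cexp_cderive|].
    apply cderive_plus; [apply cderive_const|].
    apply (CInt_cderive_lower (fun s => Cmult (cexp (Cmult lam (RtoC (- s)))) (ext g s))).
    auto with cont.
  - replace (Cmult lam (RtoC (- x))) with (Copp (Cmult lam (RtoC x))) by (rewrite RtoC_opp; ring).
    transitivity (Cminus (Cmult lam (Cmult (cexp (Cmult lam (RtoC x))) (Cplus a (Phi lam g x))))
      (Cmult (Cmult (cexp (Cmult lam (RtoC x))) (cexp (Copp (Cmult lam (RtoC x))))) (ext g x))).
    + ring.
    + rewrite cexp_opp. ring.
Qed.

Lemma resolv_ccont lam g : inE g -> ccont (resolv lam g).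
Proof. intros Hg. eapply cderive_ccont. now apply resolv_cderive. Qed.

Lemma resolv_inE lam g : inE g -> inE (resolv lam g).
Proof. intros Hg. apply inE_fn. now apply resolv_ccont. Qed.
#[global] Hint Resolve resolv_inE resolv_ccont : cont.

Lemma resolv_Agraph lam g : Cmult lam (den lam) <> RtoC 0 -> inE g ->
  Agraph (resolv lam g) (fsub (fscal lam (resolv lam g)) g).
Proof.
  intros HD Hg. apply Agraph_CInt; auto with cont. split.
  - intros x Hx.
    rewrite (CInt_ext _ (fun s => Cminus (Cmult lam (resolv lam g s)) (ext g s))).
    + rewrite (CInt_derive (resolv lam g)).
      * ring.
      * now apply resolv_cderive.
      * pose proof (ext_ccont g Hg). auto with cont.
    + intros s Hs. destruct Hx as [Hx1 Hx2]. rewrite Rmin_right, Rmax_left in Hs by lra.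
      unfold fsub, fscal. rewrite !ext_I by (split; lra). reflexivity.
  - unfold fsub, fscal, resolv. rewrite Cmult_0_r, cexp_0.
    unfold Phi at 1. rewrite CInt_refl.
    set (a := Cdiv (num lam g) (Cmult lam (den lam))).
    assert (E : Cmult a (Cmult lam (den lam)) = num lam g).
    { unfold a. field. split; intros Z; apply HD; rewrite Z; ring. }
    rewrite den_char in E. unfold num in E.
    replace (g 0) with (Cminus (Cplus (g 0) (Cminus (Cmult (cexp (Cmult lam (RtoC (-2)))) (Phi lam g (-2)))
                      (Cmult (cexp (Cmult lam (RtoC (-1)))) (Phi lam g (-1)))))
      (Cminus (Cmult (cexp (Cmult lam (RtoC (-2)))) (Phi lam g (-2)))
                      (Cmult (cexp (Cmult lam (RtoC (-1)))) (Phi lam g (-1))))) by ring.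
    rewrite <- E. ring.
Qed.

Lemma resolv_is_resolvent lam : Cmult lam (den lam) <> RtoC 0 -> is_resolvent lam (resolv lam).
Proof.
  intros HD. split; [split; [|split; [|split]]|split].
  - apply resolv_inE.
  - intros f g Hf Hg E x Hx. unfold resolv, num.
    now rewrite !(Phi_eqE lam f g), (E 0) by auto.
  - intros a c f g Hf Hg x Hx. unfold flin at 2. unfold resolv, num.
    rewrite !Phi_flin by auto. unfold flin. unfold Cdiv. ring.
  - apply resolv_bound.
  - intros g Hg. exists (fsub (fscal lam (resolv lam g)) g). split.
    + now apply resolv_Agraph.
    + intros x _. unfold fsub, fscal. ring.
  - intros f h HA x Hx. symmetry. apply (resolvent_unique lam f h); auto.
    now intros y _.
Qed.

Lemma is_resolvent_unique lam Rs g : Cmult lam (den lam) <> RtoC 0 ->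
  is_resolvent lam Rs -> inE g -> eqE (Rs g) (resolv lam g).
Proof.
  intros HD [_ [H _]] Hg. destruct (H g Hg) as [h [HA E]].
  now apply (resolvent_unique lam _ h).
Qed.

Lemma char_root_eigen lam : Cmult lam (den lam) = RtoC 0 ->
  Agraph (fun x => cexp (Cmult lam (RtoC x))) (fscal lam (fun x => cexp (Cmult lam (RtoC x)))).
Proof.
  intros HD.
  assert (I : inE (fun x => cexp (Cmult lam (RtoC x)))) by (apply inE_fn, cexp_ccont).
  apply Agraph_CInt; auto with cont. split.
  - intros x Hx. rewrite (CInt_ext _ (fun s => Cmult lam (cexp (Cmult lam (RtoC s))))).
    + rewrite (CInt_derive (fun s => cexp (Cmult lam (RtoC s)))); [ring| |auto with cont].
      apply cexp_cderive.
    + intros s Hs. destruct Hx as [Hx1 Hx2]. rewrite Rmin_right, Rmax_left in Hs by lra.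
      rewrite ext_I by (split; lra). reflexivity.
  - unfold fscal. rewrite Cmult_0_r, cexp_0. rewrite den_char in HD.
    replace (cexp (Cmult lam (RtoC (-2)))) with (Cminus (Cplus lam (cexp (Cmult lam (RtoC (-1)))))
      (Cplus lam (Cminus (cexp (Cmult lam (RtoC (-1)))) (cexp (Cmult lam (RtoC (-2))))))) by ring.
    rewrite HD. ring.
Qed.

(** At a root, e^{lam x} is an eigenfunction: a left inverse of lam - A would send 0 to it, although
    its value at x = 0 is 1. *)
Lemma resolvent_char lam Rs : is_resolvent lam Rs -> Cmult lam (den lam) <> RtoC 0.
Proof.
  intros [BL [_ H]] HD. pose proof (char_root_eigen lam HD) as HA.
  set (v := fun x => cexp (Cmult lam (RtoC x))) in *.
  pose proof HA as [Hv _]. specialize (H v _ HA).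
  assert (Z : eqE (Rs (fsub (fscal lam v) (fscal lam v))) fzero).
  { intros x Hx. rewrite (bounded_linear_fsub Rs) by (auto with cont).
    unfold fsub, fzero. ring. }
  specialize (H 0 Ival_0). rewrite Z in H by auto. unfold v, fzero in H.
  rewrite Cmult_0_r, cexp_0 in H. injection H. lra.
Qed.

Lemma in_spec_char lam : in_spec lam <-> Cmult lam (den lam) = RtoC 0.
Proof.
  split.
  - intros H. apply NNPP. intros N. apply H. exists (resolv lam). now apply resolv_is_resolvent.
  - intros H [Rs HR]. now apply (resolvent_char lam Rs).
Qed.

(** * The spectrum *)

Lemma den_0 : den (RtoC 0) = RtoC 2.
Proof.
  unfold den. rewrite (CInt_ext _ (fun _ => RtoC 1)).
  - apply injective_projections; simpl; rewrite RInt_constR; ring.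
  - intros x _. rewrite <- cexp_0. f_equal. ring.
Qed.

(** The integral over [1, 2] has real part of size at most e^{-Re lam} < 1, so it cannot equal
    -1. *)
Lemma den_right lam : 0 < fst lam -> den lam <> RtoC 0.
Proof.
  intros Hl H. apply (f_equal fst) in H. unfold den in H. simpl in H.
  assert (B : Rabs (RInt (fun s => fst (cexp (Cmult (Copp lam) (RtoC s)))) 1 2)
     <= exp (- fst lam) * (2 - 1)).
  { apply RInt_bound; [exact (cexp_ccont (Copp lam) true)|lra|].
    intros t Ht. eapply Rle_trans; [apply (cp_Cmod true)|]. rewrite Cmod_cexp. simpl.
    apply exp_mono. nra. }
  assert (exp (- fst lam) < 1) by (rewrite <- exp_0; apply exp_increasing; lra).
  apply Rabs_le_between in B. simpl in B. lra.
Qed.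

(* On the imaginary axis a zero would force [cos w = -1/2] and [w = 2 sin w],
   i.e. [|w| = sqrt 3 < 2 PI / 3]. *)
Lemma char_imaginary w : w <> 0 -> Cmult (0, w) (den (0, w)) <> RtoC 0.
Proof.
  intros Hw H. rewrite den_char in H.
  assert (E1 := f_equal fst H). assert (E2 := f_equal snd H).
  unfold cexp in E1, E2. simpl in E1, E2.
  replace (0 * -1 - w * 0) with 0 in * by ring. replace (0 * -2 - w * 0) with 0 in * by ring.
  replace (0 * 0 + w * -1) with (- w) in * by ring.
  replace (0 * 0 + w * -2) with (- (2 * w)) in * by ring.
  rewrite exp_0, !cos_neg, !sin_neg, !Rmult_1_l in *.
  rewrite cos_2a_cos in E1. rewrite sin_2a in E2.
  pose proof (sin2_cos2 w) as T. unfold Rsqr in T.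
  (* The real part says cos w = cos 2w. The root cos w = 1 forces sin w = 0, and then the imaginary
     part forces w = 0. *)
  assert (K : (cos w - 1) * (2 * cos w + 1) = 0) by lra.
  apply Rmult_integral in K. destruct K as [K|K].
  - assert (Cw : cos w = 1) by lra. rewrite Cw in *.
    assert (S0 : sin w = 0) by nra. rewrite S0 in *. lra.
  - assert (Cw : cos w = - (1/2)) by lra. rewrite Cw in *.
    assert (Sw : w = 2 * sin w) by lra.
    assert (W2 : w * w = 3) by (rewrite Sw; lra).
    assert (Cabs : cos (Rabs w) = - (1/2)).
    { rewrite <- Cw. unfold Rabs. destruct Rcase_abs; auto. apply cos_neg. }
    assert (Aw : Rabs w * Rabs w = 3) by (rewrite <- Rabs_mult, W2; apply Rabs_right; lra).
    pose proof (Rabs_pos w). pose proof PI2_3_2 as HP. unfold PI2 in HP.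
    assert (L : Rabs w < 2 * (PI / 3)) by nra.
    apply cos_decreasing_1 in L; try nra.
    rewrite Cabs, cos_2PI3 in L. lra.
Qed.

Lemma char_closed_right lam : 0 <= Re lam -> lam <> RtoC 0 -> Cmult lam (den lam) <> RtoC 0.
Proof.
  intros Hl H0. destruct Hl as [Hl|Hl].
  - now apply Cmult_neq_0; [|apply den_right].
  - destruct lam as [a w]. simpl in Hl. subst a. apply char_imaginary.
    intros ->. now apply H0.
Qed.

Lemma in_spec_0 : in_spec (RtoC 0).
Proof. apply in_spec_char. ring. Qed.

Lemma in_spec_half_plane lam : in_spec lam -> 0 <= Re lam -> lam = RtoC 0.
Proof.
  intros H Hl. apply NNPP. intros N. apply in_spec_char in H.
  now apply (char_closed_right lam).
Qed.

Lemma spectral_bound_0 : spectral_bound = Finite 0.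
Proof.
  apply is_lub_Rbar_unique. split.
  - intros r [lam [H ->]]. simpl. apply Rnot_lt_le. intros C.
    rewrite (in_spec_half_plane lam H) in C by lra. simpl in C. lra.
  - intros l H. apply (H 0). exists (RtoC 0). split; [apply in_spec_0|reflexivity].
Qed.

Lemma dominant_0 : dominant_spectral_value (RtoC 0).
Proof.
  split; [apply in_spec_0|]. intros lam H E. apply in_spec_half_plane; auto.
  rewrite E; simpl; lra.
Qed.

(** * Compactness of the resolvent *)

Definition infinite (P : nat -> Prop) : Prop := forall N, exists n, (N <= n)%nat /\ P n.

(** Pigeonhole over n strips of height [e]: keep the top strip if it is visited infinitely often,
    otherwise drop it and recurse. *)
Lemma infinite_close_steps (v : nat -> R) lo e n (P : nat -> Prop) : 0 < e ->
  infinite P -> (forall i, P i -> lo <= v i <= lo + INR n * e) ->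
  exists Q, infinite Q /\ (forall i, Q i -> P i) /\
    forall i j, Q i -> Q j -> Rabs (v i - v j) <= e.
Proof.
  intros He. revert P. induction n as [|n IH]; intros P HP Hv.
  - exists P. repeat split; auto. intros i j Hi Hj.
    pose proof (Hv i Hi). pose proof (Hv j Hj). simpl in *. apply Rabs_le_between. lra.
  - rewrite S_INR in Hv.
    destruct (classic (infinite (fun i => P i /\ lo + INR n * e < v i))) as [H|H].
    + exists (fun i => P i /\ lo + INR n * e < v i). split; [|split]; auto.
      * now intros i [Hi _].
      * intros i j [Hi Li] [Hj Lj]. pose proof (Hv i Hi). pose proof (Hv j Hj).
        apply Rabs_le_between. lra.
    + apply not_all_ex_not in H. destruct H as [N HN].
      destruct (IH (fun i => P i /\ v i <= lo + INR n * e)) as [Q [Q1 [Q2 Q3]]].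
      * intros N'. destruct (HP (Nat.max N N')) as [i [Hi Pi]].
        exists i. split; [lia|]. split; auto. apply Rnot_lt_le. intros C.
        apply HN. exists i. split; [lia|auto].
      * intros i [Hi Li]. pose proof (Hv i Hi). lra.
      * exists Q. split; [|split]; auto. intros i Hi. now apply Q2.
Qed.

Lemma infinite_close (v : nat -> R) B e (P : nat -> Prop) : 0 < e ->
  infinite P -> (forall i, Rabs (v i) <= B) ->
  exists Q, infinite Q /\ (forall i, Q i -> P i) /\
    forall i j, Q i -> Q j -> Rabs (v i - v j) <= e.
Proof.
  intros He HP HB. destruct (INR_unbounded (2 * B / e)) as [n Hn].
  apply infinite_close_steps with (lo := - B) (n := n); auto.
  intros i _. pose proof (HB i) as K. apply Rabs_le_between in K.
  apply Rgt_lt, (Rlt_div_l _ _ e) in Hn; lra.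
Qed.

(** * Compactness of bounded equi-Lipschitz sequences *)

Section Ascoli.
Variables (F : nat -> fn) (B L : R).
Hypothesis L_pos : 0 <= L.
Hypothesis F_bound : forall n x, Ival x -> Cmod (F n x) <= B.
Hypothesis F_lip : forall n x y, Ival x -> Ival y ->
  Cmod (Cminus (F n x) (F n y)) <= L * Rabs (x - y).

Lemma infinite_close_grid e d (P : nat -> Prop) K : 0 < e -> infinite P ->
  exists Q, infinite Q /\ (forall i, Q i -> P i) /\
    forall i j, Q i -> Q j -> forall k, (k < K)%nat -> forall b,
      Rabs (cp b (F i (clamp (-2 + INR k * d))) - cp b (F j (clamp (-2 + INR k * d)))) <= e.
Proof.
  intros He HP. induction K as [|K [Q [Q1 [Q2 Q3]]]].
  - exists P. repeat split; auto. intros i j _ _ k Hk. lia.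
  - set (x := clamp (-2 + INR K * d)).
    assert (HB : forall b i, Rabs (cp b (F i x)) <= B).
    { intros b i. eapply Rle_trans; [apply cp_Cmod|]. apply F_bound, clamp_I. }
    destruct (infinite_close (fun i => cp true (F i x)) B e Q He Q1 (HB true)) as [S [S1 [S2 S3]]].
    destruct (infinite_close (fun i => cp false (F i x)) B e S He S1 (HB false)) as [T [T1 [T2 T3]]].
    exists T. split; [|split]; auto. intros i j Hi Hj k Hk b.
    destruct (Nat.eq_dec k K) as [->|Hne].
    + destruct b; [apply S3|apply T3]; auto.
    + apply Q3; auto. lia.
Qed.

Lemma infinite_close_unif e (P : nat -> Prop) : 0 < e -> infinite P ->
  exists Q, infinite Q /\ (forall i, Q i -> P i) /\
    forall i j, Q i -> Q j -> forall x, Ival x -> Cmod (Cminus (F i x) (F j x)) <= e.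
Proof.
  (* Passing from x to a grid point of step [d] costs at most e/4 for each of the two functions, and
     the grid point itself costs e/2; [L + 1] avoids division by zero. *)
  intros He HP. set (d := e / (4 * (L + 1))).
  assert (Hd : 0 < d) by (apply Rdiv_lt_0_compat; lra).
  assert (HLd : L * d <= e / 4).
  { assert (E : (L + 1) * d = e / 4) by (unfold d; field; lra). nra. }
  destruct (INR_unbounded (2 / d)) as [K HK]. apply Rgt_lt, (Rlt_div_l _ _ d) in HK; auto.
  destruct (infinite_close_grid (e/4) d P K ltac:(lra) HP) as [Q [Q1 [Q2 Q3]]].
  exists Q. split; [|split]; auto. intros i j Hi Hj x Hx. pose proof Hx as [Hx1 Hx2].
  destruct (nfloor_ex ((x + 2) / d)) as [k [Hk1 Hk2]].
  { apply Rle_div_r; lra. }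
  apply (Rle_div_r _ _ d) in Hk1; auto. apply (Rlt_div_l _ _ d) in Hk2; auto.
  assert (Iy : Ival (-2 + INR k * d)). { assert (0 <= INR k * d) by (apply Rmult_le_pos; [apply pos_INR|lra]). split; lra. }
  assert (HkK : (k < K)%nat).
  { apply INR_lt. apply Rmult_lt_reg_r with d; auto. destruct Iy. lra. }
  pose proof (Q3 i j Hi Hj k HkK) as G. rewrite (clamp_id _ Iy) in G.
  set (y := -2 + INR k * d) in *.
  assert (Axy : Rabs (x - y) <= d) by (unfold y; apply Rabs_le_between; lra).
  pose proof (F_lip i x y Hx Iy) as Li. pose proof (F_lip j y x Iy Hx) as Lj.
  rewrite Rabs_minus_sym in Lj.
  assert (L * Rabs (x - y) <= L * d) by (apply Rmult_le_compat_l; auto).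
  assert (Gij : Cmod (Cminus (F i y) (F j y)) <= 2 * (e / 4)).
  { apply Cmod_cp_le. intros b. rewrite cp_minus. apply G. }
  replace (Cminus (F i x) (F j x)) with
    (Cplus (Cplus (Cminus (F i x) (F i y)) (Cminus (F i y) (F j y))) (Cminus (F j y) (F j x))) by ring.
  eapply Rle_trans; [apply Cmod_triangle|].
  pose proof (Cmod_triangle (Cminus (F i x) (F i y)) (Cminus (F i y) (F j y))). lra.
Qed.

(** The choice axiom turns the existence statement into a function, so that the refinements can be
    iterated. *)
Definition refine_set (k : nat) (P : {P : nat -> Prop | infinite P}) :
  {Q : nat -> Prop | infinite Q /\ (forall i, Q i -> proj1_sig P i) /\
    forall i j, Q i -> Q j -> forall x, Ival x ->
      Cmod (Cminus (F i x) (F j x)) <= / (INR k + 1)}.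
Proof.
  apply constructive_indefinite_description. apply infinite_close_unif; [|apply (proj2_sig P)].
  apply Rinv_0_lt_compat. pose proof (pos_INR k). lra.
Defined.

Fixpoint nested (k : nat) : {P : nat -> Prop | infinite P} :=
  match k with
  | O => exist _ (fun _ => True) (fun N => ex_intro _ N (conj (le_n N) I))
  | S k => let Q := refine_set k (nested k) in exist _ (proj1_sig Q) (proj1 (proj2_sig Q))
  end.

Lemma nested_sub k m i : (k <= m)%nat -> proj1_sig (nested m) i -> proj1_sig (nested k) i.
Proof.
  intros H. induction H as [|m Hm IH]; auto. intros Hi. apply IH.
  simpl in Hi. destruct (refine_set m (nested m)) as [Q [Q1 [Q2 Q3]]]. simpl in Hi. auto.
Qed.

Lemma nested_close k i j x : proj1_sig (nested (S k)) i -> proj1_sig (nested (S k)) j ->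
  Ival x -> Cmod (Cminus (F i x) (F j x)) <= / (INR k + 1).
Proof.
  simpl. destruct (refine_set k (nested k)) as [Q [Q1 [Q2 Q3]]]. simpl. auto.
Qed.

Definition pick (k N : nat) : {n : nat | (N <= n)%nat /\ proj1_sig (nested k) n} :=
  constructive_indefinite_description _ (proj2_sig (nested k) N).

(** Term k is taken from level k + 1, because level 0 is all of [nat] and the bound 1/(k + 1) is
    imposed on level k + 1. *)
Fixpoint diagonal (k : nat) : nat :=
  match k with
  | O => proj1_sig (pick 1 0)
  | S k => proj1_sig (pick (S (S k)) (S (diagonal k)))
  end.

Lemma diagonal_nested k : proj1_sig (nested (S k)) (diagonal k).
Proof.
  destruct k; unfold diagonal; fold diagonal;
    match goal with |- context [pick ?a ?b] => destruct (pick a b) as [n [H1 H2]] end; auto.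
Qed.

Lemma diagonal_lt k : (diagonal k < diagonal (S k))%nat.
Proof.
  change (diagonal (S k)) with (proj1_sig (pick (S (S k)) (S (diagonal k)))).
  destruct (pick _ _) as [n [H1 H2]]. simpl. lia.
Qed.

Lemma diagonal_cauchy k i j x : (k <= i)%nat -> (k <= j)%nat -> Ival x ->
  Cmod (Cminus (F (diagonal i) x) (F (diagonal j) x)) <= / (INR k + 1).
Proof.
  intros Hi Hj Hx. apply nested_close; auto.
  - apply nested_sub with (S i); [lia|apply diagonal_nested].
  - apply nested_sub with (S j); [lia|apply diagonal_nested].
Qed.

Lemma small_inv_INR e : 0 < e -> exists k, / (INR k + 1) < e.
Proof.
  intros He. destruct (INR_unbounded (/ e)) as [k Hk]. exists k.
  pose proof (Rinv_0_lt_compat e He). rewrite <- (Rinv_inv e).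
  apply Rinv_lt_contravar; [apply Rmult_lt_0_compat; lra|lra].
Qed.

Definition diagonal_limit : fn := fun x =>
  (real (Lim_seq (fun n => fst (F (diagonal n) x))),
   real (Lim_seq (fun n => snd (F (diagonal n) x)))).

Lemma diagonal_limit_close k n x : (k <= n)%nat -> Ival x ->
  Cmod (Cminus (F (diagonal n) x) (diagonal_limit x)) <= 3 * / (INR k + 1).
Proof.
  intros Hn Hx. assert (Hk : 0 < / (INR k + 1)) by (apply Rinv_0_lt_compat; pose proof (pos_INR k); lra).
  apply Rle_trans with (2 * / (INR k + 1)); [|lra]. apply Cmod_cp_le. intros b.
  assert (C : ex_finite_lim_seq (fun n => cp b (F (diagonal n) x))).
  { apply ex_lim_seq_cauchy_corr. intros [e He]. simpl.
    destruct (small_inv_INR e He) as [m Hm]. exists m. intros i j Hi Hj.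
    rewrite <- cp_minus. eapply Rle_lt_trans; [apply cp_Cmod|].
    eapply Rle_lt_trans; [apply diagonal_cauchy with (k := m)|]; auto. }
  apply Lim_seq_correct' in C.
  replace (real (Lim_seq (fun n => cp b (F (diagonal n) x)))) with (cp b (diagonal_limit x)) in C
    by (now destruct b).
  rewrite cp_minus. apply le_epsilon. intros e He.
  apply is_lim_seq_spec in C. destruct (C (mkposreal e He)) as [N HN]. simpl in HN.
  specialize (HN (Nat.max N k) ltac:(lia)).
  replace (_ - _) with ((cp b (F (diagonal n) x) - cp b (F (diagonal (Nat.max N k)) x)) +
    (cp b (F (diagonal (Nat.max N k)) x) - cp b (diagonal_limit x))) by ring.
  eapply Rle_trans; [apply Rabs_triang|]. apply Rplus_le_compat; [|lra].
  rewrite <- cp_minus. eapply Rle_trans; [apply cp_Cmod|].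
  apply diagonal_cauchy; auto. lia.
Qed.

Lemma diagonal_limit_inE : inE diagonal_limit.
Proof.
  intros x Hx eps He. destruct (small_inv_INR (eps / 12) ltac:(lra)) as [k Hk].
  set (f := F (diagonal k)). exists (eps / (4 * (L + 1))).
  split; [apply Rdiv_lt_0_compat; lra|]. intros y Hy Hxy.
  apply (Rlt_div_r _ _ (4 * (L + 1))) in Hxy; [|lra].
  pose proof (diagonal_limit_close k k x (le_n k) Hx) as C1.
  pose proof (diagonal_limit_close k k y (le_n k) Hy) as C2.
  pose proof (F_lip (diagonal k) y x Hy Hx) as C3. fold f in C1, C2, C3.
  assert (C4 : L * Rabs (y - x) <= eps / 4) by (pose proof (Rabs_pos (y - x)); nra).
  replace (Cminus (diagonal_limit y) (diagonal_limit x)) with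
   (Cplus (Cplus (Cminus (f y) (f x)) (Cminus (f x) (diagonal_limit x)))
      (Copp (Cminus (f y) (diagonal_limit y)))) by ring.
  eapply Rle_lt_trans; [apply Cmod_triangle|]. rewrite Cmod_opp.
  pose proof (Cmod_triangle (Cminus (f y) (f x)) (Cminus (f x) (diagonal_limit x))). lra.
Qed.

Lemma ascoli : exists phi : nat -> nat, (forall n, (phi n < phi (S n))%nat) /\
  exists g, inE g /\ forall eps, 0 < eps -> exists N, forall n, (N <= n)%nat ->
    supnorm (fsub (F (phi n)) g) < eps.
Proof.
  exists diagonal. split; [apply diagonal_lt|]. exists diagonal_limit.
  split; [apply diagonal_limit_inE|]. intros eps He.
  destruct (small_inv_INR (eps / 3) ltac:(lra)) as [k Hk]. exists k. intros n Hn.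
  apply supnorm_lt with (3 * / (INR k + 1)); [lra|]. intros x Hx.
  now apply diagonal_limit_close.
Qed.
End Ascoli.

Lemma Agraph_lipschitz f h M : Agraph f h -> (forall x, Ival x -> Cmod (h x) <= M) ->
  forall x y, Ival x -> Ival y -> Cmod (Cminus (f x) (f y)) <= 2 * M * Rabs (x - y).
Proof.
  intros HA HM. pose proof HA as [Hf [Hh _]].
  destruct (proj1 (Agraph_CInt f h Hf Hh) HA) as [HF _].
  assert (W : forall x y, Ival x -> Ival y -> y <= x ->
     Cmod (Cminus (f x) (f y)) <= 2 * M * Rabs (x - y)).
  { intros x y Hx Hy Hyx. rewrite (HF x), (HF y) by auto.
    rewrite <- (CInt_Chasles (ext h) 0 y x) by (now apply ext_ccont).
    replace (Cminus _ _) with (CInt (ext h) y x) by ring.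
    rewrite (Rabs_right (x - y)) by lra. rewrite Rmult_assoc.
    apply CInt_bound; auto; [now apply ext_ccont|].
    intros t _. apply HM, clamp_I. }
  intros x y Hx Hy. destruct (Rle_dec y x); auto.
  replace (Cminus (f x) (f y)) with (Copp (Cminus (f y) (f x))) by ring.
  rewrite Cmod_opp, Rabs_minus_sym. apply W; auto; lra.
Qed.

(** For u in the unit ball the derivative lam R u - u of R u is bounded, so the images are
    equi-Lipschitz as well as bounded. *)
Lemma resolv_compact lam : Cmult lam (den lam) <> RtoC 0 -> compact_op (resolv lam).
Proof.
  intros HD u Hu. destruct (resolv_bound lam) as [K0 HK0].
  set (K := Rabs K0).
  assert (HK : forall n, supnorm (resolv lam (u n)) <= K).
  { intros n. destruct (Hu n) as [H1 H2]. eapply Rle_trans; [now apply HK0|].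
    pose proof (supnorm_pos (u n)). pose proof (Rle_abs K0). pose proof (Rabs_pos K0).
    unfold K. nra. }
  assert (K_pos : 0 <= K) by apply Rabs_pos. pose proof (Cmod_ge_0 lam) as Hl.
  assert (HLp : 0 <= Cmod lam * K) by (apply Rmult_le_pos; auto).
  apply (ascoli (fun n => resolv lam (u n)) K (2 * (Cmod lam * K + 1))).
  - lra.
  - intros n x Hx. destruct (Hu n) as [H1 _].
    eapply Rle_trans; [apply supnorm_ge; auto with cont|apply HK].
  - intros n. destruct (Hu n) as [H1 H2].
    apply Agraph_lipschitz with (fsub (fscal lam (resolv lam (u n))) (u n)).
    + now apply resolv_Agraph.
    + intros x Hx. unfold fsub, fscal. eapply Rle_trans; [apply Cmod_triangle|].
      rewrite Cmod_opp, Cmod_mult. apply Rplus_le_compat.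
      * apply Rmult_le_compat_l; auto.
        eapply Rle_trans; [apply supnorm_ge; auto with cont|apply HK].
      * eapply Rle_trans; [apply supnorm_ge; auto|auto].
Qed.

Lemma compact_resolvent_A : compact_resolvent.
Proof.
  assert (HD : Cmult (RtoC 1) (den (RtoC 1)) <> RtoC 0).
  { apply char_closed_right; simpl; [lra|]. intros E. injection E. lra. }
  exists (RtoC 1), (resolv (RtoC 1)). split.
  - now apply resolv_is_resolvent.
  - now apply resolv_compact.
Qed.

(** * Complex differentiability and the mean value property *)

(** Division-free form of complex differentiability, in which the increment k = 0 needs no separate
    treatment. *)
Definition cdiff (h : C -> C) (z l : C) : Prop :=
  forall eps, 0 < eps -> exists d, 0 < d /\ forall k, Cmod k < d ->
    Cmod (Cminus (Cminus (h (Cplus z k)) (h z)) (Cmult l k)) <= eps * Cmod k.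

Definition ccts (h : C -> C) (z : C) : Prop :=
  forall b, continuous (fun w : C => cp b (h w)) z.

Lemma ccts_const c z : ccts (fun _ => c) z.
Proof. intros b. apply continuous_const. Qed.
Lemma ccts_plus h g z : ccts h z -> ccts g z -> ccts (fun w => Cplus (h w) (g w)) z.
Proof.
  intros Hh Hg []; [specialize (Hh true); specialize (Hg true)|
    specialize (Hh false); specialize (Hg false)]; simpl in *; now apply @continuous_plus.
Qed.
Lemma ccts_mult h g z : ccts h z -> ccts g z -> ccts (fun w => Cmult (h w) (g w)) z.
Proof.
  intros Hh Hg.
  pose proof (Hh true); pose proof (Hh false); pose proof (Hg true); pose proof (Hg false).
  intros []; simpl in *.
  - apply @continuous_minus; now apply @continuous_mult.
  - apply @continuous_plus; now apply @continuous_mult.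
Qed.
Lemma ccts_opp h z : ccts h z -> ccts (fun w => Copp (h w)) z.
Proof.
  intros Hh []; [specialize (Hh true)|specialize (Hh false)]; simpl in *;
    now apply @continuous_opp.
Qed.
Lemma Cmod_sqr_neq_0 z : z <> RtoC 0 -> fst z ^ 2 + snd z ^ 2 <> 0.
Proof.
  intros H E. apply H. destruct z as [a b]. simpl in *.
  assert (a = 0) by nra. assert (b = 0) by nra. now subst.
Qed.
Lemma ccts_inv h z : h z <> RtoC 0 -> ccts h z -> ccts (fun w => Cinv (h w)) z.
Proof.
  intros H0 Hh. pose proof (Hh true) as H1; pose proof (Hh false) as H2; simpl in H1, H2.
  assert (N : continuous (fun w : C => / (fst (h w) ^ 2 + snd (h w) ^ 2)) z).
  { apply (continuous_comp (fun w : C => fst (h w) ^ 2 + snd (h w) ^ 2) Rinv);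
      [|now apply continuous_Rinv, Cmod_sqr_neq_0].
    apply @continuous_plus; simpl;
      repeat (apply @continuous_mult; auto; try apply continuous_const). }
  intros []; simpl; apply @continuous_mult; auto. now apply @continuous_opp.
Qed.

Lemma cdiff_ccts h z l : cdiff h z l -> ccts h z.
Proof.
  intros H b. apply filterlim_locally. intros [e He].
  destruct (H 1 Rlt_0_1) as [d [Hd K]].
  pose proof (Cmod_ge_0 l) as Hl.
  set (r := Rmin d (e / (Cmod l + 2))).
  assert (Hr : 0 < r) by (apply Rmin_glb_lt; auto; apply Rdiv_lt_0_compat; lra).
  assert (Hr2 : 0 < r / 2) by lra.
  exists (mkposreal _ Hr2). intros w [W1 W2]. simpl in W1, W2.
  set (k := Cminus w z).
  assert (Hk : Cmod k < r).
  { eapply Rle_lt_trans; [apply Cmod_cp|]. unfold k. rewrite !cp_minus.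
    change (Rabs (fst w - fst z) < r / 2) in W1. change (Rabs (snd w - snd z) < r / 2) in W2.
    simpl. lra. }
  pose proof (Rmin_l d (e / (Cmod l + 2))) as R1. pose proof (Rmin_r d (e / (Cmod l + 2))) as R2.
  fold r in R1, R2. specialize (K k ltac:(lra)).
  change (Rabs (cp b (h w) - cp b (h z)) < e). rewrite <- cp_minus.
  eapply Rle_lt_trans; [apply cp_Cmod|].
  assert (Ek : Cplus z k = w :> C) by (unfold k; ring). rewrite Ek in K.
  replace (Cminus (h w) (h z)) with
    (Cplus (Cminus (Cminus (h w) (h z)) (Cmult l k)) (Cmult l k)) by ring.
  eapply Rle_lt_trans; [apply Cmod_triangle|]. rewrite (Cmod_mult l k).
  assert (Cmod k * (Cmod l + 2) < e) by (apply Rlt_div_r; lra).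
  pose proof (Cmod_ge_0 k). nra.
Qed.

Lemma ccts_eps h z : ccts h z -> forall eps, 0 < eps -> exists d, 0 < d /\
  forall k, Cmod k < d -> Cmod (Cminus (h (Cplus z k)) (h z)) < eps.
Proof.
  intros H eps He. assert (He3 : 0 < eps / 3) by lra.
  destruct (proj1 (filterlim_locally _ _) (H true) (mkposreal _ He3)) as [d1 K1].
  destruct (proj1 (filterlim_locally _ _) (H false) (mkposreal _ He3)) as [d2 K2].
  exists (Rmin d1 d2). split; [apply Rmin_glb_lt; apply cond_pos|].
  intros k Hk. pose proof (Rmin_l d1 d2). pose proof (Rmin_r d1 d2).
  assert (B : forall d, Cmod k < d -> @ball (prod_UniformSpace R_UniformSpace R_UniformSpace) z d (Cplus z k)).
  { intros d Hd. pose proof (cp_Cmod true k) as A1. pose proof (cp_Cmod false k) as A2.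
    simpl in A1, A2. split.
    - change (Rabs (fst z + fst k - fst z) < d). replace (_ - _) with (fst k) by ring. lra.
    - change (Rabs (snd z + snd k - snd z) < d). replace (_ - _) with (snd k) by ring. lra. }
  specialize (K1 (Cplus z k) (B (pos d1) ltac:(lra))). specialize (K2 (Cplus z k) (B (pos d2) ltac:(lra))).
  change (Rabs (cp true (h (Cplus z k)) - cp true (h z)) < eps / 3) in K1.
  change (Rabs (cp false (h (Cplus z k)) - cp false (h z)) < eps / 3) in K2.
  eapply Rle_lt_trans; [apply Cmod_cp|]. rewrite !cp_minus. lra.
Qed.

Lemma cdiff_const c z : cdiff (fun _ => c) z (RtoC 0).
Proof.
  intros e He. exists 1; split; [lra|]. intros k _.
  replace (Cminus _ _) with (RtoC 0) by ring. rewrite Cmod_0.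
  apply Rmult_le_pos; [lra|apply Cmod_ge_0].
Qed.

Lemma cdiff_id z : cdiff (fun w => w) z (RtoC 1).
Proof.
  intros e He. exists 1; split; [lra|]. intros k _.
  replace (Cminus _ _) with (RtoC 0) by ring. rewrite Cmod_0.
  apply Rmult_le_pos; [lra|apply Cmod_ge_0].
Qed.

Lemma cdiff_plus h g z l m : cdiff h z l -> cdiff g z m ->
  cdiff (fun w => Cplus (h w) (g w)) z (Cplus l m).
Proof.
  intros Hh Hg e He. destruct (Hh (e/2) ltac:(lra)) as [d1 [P1 K1]].
  destruct (Hg (e/2) ltac:(lra)) as [d2 [P2 K2]].
  exists (Rmin d1 d2). split; [now apply Rmin_glb_lt|]. intros k Hk.
  pose proof (Rmin_l d1 d2). pose proof (Rmin_r d1 d2).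
  specialize (K1 k ltac:(lra)). specialize (K2 k ltac:(lra)).
  replace (Cminus _ _) with (Cplus (Cminus (Cminus (h (Cplus z k)) (h z)) (Cmult l k))
    (Cminus (Cminus (g (Cplus z k)) (g z)) (Cmult m k))) by ring.
  eapply Rle_trans; [apply Cmod_triangle|]. lra.
Qed.

Lemma cdiff_mult h g z l m : cdiff h z l -> cdiff g z m ->
  cdiff (fun w => Cmult (h w) (g w)) z (Cplus (Cmult l (g z)) (Cmult (h z) m)).
Proof.
  intros Hh Hg e He.
  pose proof (Cmod_ge_0 (g z)) as G0. pose proof (Cmod_ge_0 (h z)) as H0.
  pose proof (Cmod_ge_0 l) as L0.
  assert (E1 : 0 < e / (3 * (Cmod (g z) + 1))) by (apply Rdiv_lt_0_compat; lra).
  assert (E2 : 0 < e / (3 * (Cmod (h z) + 1))) by (apply Rdiv_lt_0_compat; lra).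
  assert (E3 : 0 < Rmin 1 (e / (3 * (Cmod l + 1))))
    by (apply Rmin_glb_lt; [lra|apply Rdiv_lt_0_compat; lra]).
  destruct (Hh _ E1) as [d1 [P1 K1]]. destruct (Hg _ E2) as [d2 [P2 K2]].
  destruct (ccts_eps g z (cdiff_ccts _ _ _ Hg) _ E3) as [d3 [P3 K3]].
  exists (Rmin d1 (Rmin d2 d3)). split; [repeat apply Rmin_glb_lt; auto|].
  intros k Hk. pose proof (Rmin_l d1 (Rmin d2 d3)). pose proof (Rmin_r d1 (Rmin d2 d3)).
  pose proof (Rmin_l d2 d3). pose proof (Rmin_r d2 d3).
  specialize (K1 k ltac:(lra)). specialize (K2 k ltac:(lra)). specialize (K3 k ltac:(lra)).
  pose proof (Rmin_l 1 (e / (3 * (Cmod l + 1)))). pose proof (Rmin_r 1 (e / (3 * (Cmod l + 1)))).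
  set (g' := g (Cplus z k)) in *. set (h' := h (Cplus z k)) in *.
  assert (Gb : Cmod g' <= Cmod (g z) + 1).
  { replace g' with (Cplus (Cminus g' (g z)) (g z)) by ring.
    eapply Rle_trans; [apply Cmod_triangle|]. lra. }
  (* The remainder of a product: remainder of h times the new g, slope of h times the change of g,
     and h times the remainder of g. Each part gets e/3. *)
  replace (Cminus _ _) with (Cplus (Cplus (Cmult (Cminus (Cminus h' (h z)) (Cmult l k)) g')
      (Cmult (Cmult l k) (Cminus g' (g z)))) (Cmult (h z) (Cminus (Cminus g' (g z)) (Cmult m k)))) by ring.
  eapply Rle_trans; [apply Cmod_triangle|].
  eapply Rle_trans; [apply Rplus_le_compat_r, Cmod_triangle|]. rewrite !Cmod_mult.
  pose proof (Cmod_ge_0 k) as k0.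
  assert (T1 : Cmod (Cminus (Cminus h' (h z)) (Cmult l k)) * Cmod g' <= e / 3 * Cmod k).
  { replace (e / 3 * Cmod k) with (e / (3 * (Cmod (g z) + 1)) * Cmod k * (Cmod (g z) + 1))
      by (field; lra).
    apply Rmult_le_compat; auto; apply Cmod_ge_0. }
  assert (T2 : Cmod l * Cmod k * Cmod (Cminus g' (g z)) <= e / 3 * Cmod k).
  { replace (e / 3 * Cmod k) with ((Cmod l + 1) * Cmod k * (e / (3 * (Cmod l + 1)))) by (field; lra).
    apply Rmult_le_compat; try apply Cmod_ge_0; try lra.
    now apply Rmult_le_pos. }
  assert (T3 : Cmod (h z) * Cmod (Cminus (Cminus g' (g z)) (Cmult m k)) <= e / 3 * Cmod k).
  { replace (e / 3 * Cmod k) with ((Cmod (h z) + 1) * (e / (3 * (Cmod (h z) + 1)) * Cmod k))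
      by (field; lra).
    apply Rmult_le_compat; auto; try apply Cmod_ge_0; lra. }
  lra.
Qed.

Lemma cdiff_inv h z l : h z <> RtoC 0 -> cdiff h z l ->
  cdiff (fun w => Cinv (h w)) z (Copp (Cmult l (Cmult (Cinv (h z)) (Cinv (h z))))).
Proof.
  intros H0 Hh e He. pose proof (cdiff_ccts _ _ _ Hh) as Hc.
  pose proof (ccts_inv h z H0 Hc) as Hi.
  set (i := Cinv (h z)). pose proof (Cmod_ge_0 i) as I0. pose proof (Cmod_ge_0 l) as L0.
  assert (Hz : 0 < Cmod (h z)) by (now apply Cmod_gt_0).
  assert (E1 : 0 < e / (2 * (Cmod i * (Cmod i + 1) + 1))) by (apply Rdiv_lt_0_compat; nra).
  assert (E2 : 0 < Rmin 1 (e / (2 * (Cmod l * Cmod i + 1))))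
    by (apply Rmin_glb_lt; [lra|apply Rdiv_lt_0_compat; nra]).
  destruct (Hh _ E1) as [d1 [P1 K1]]. destruct (ccts_eps _ _ Hi _ E2) as [d2 [P2 K2]].
  destruct (ccts_eps _ _ Hc _ Hz) as [d3 [P3 K3]].
  exists (Rmin d1 (Rmin d2 d3)). split; [repeat apply Rmin_glb_lt; auto|].
  intros k Hk. pose proof (Rmin_l d1 (Rmin d2 d3)). pose proof (Rmin_r d1 (Rmin d2 d3)).
  pose proof (Rmin_l d2 d3). pose proof (Rmin_r d2 d3).
  specialize (K1 k ltac:(lra)). specialize (K2 k ltac:(lra)). specialize (K3 k ltac:(lra)).
  pose proof (Rmin_l 1 (e / (2 * (Cmod l * Cmod i + 1)))).
  pose proof (Rmin_r 1 (e / (2 * (Cmod l * Cmod i + 1)))).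
  assert (N : h (Cplus z k) <> RtoC 0).
  { intros Z. rewrite Z in K3. replace (Cminus (RtoC 0) (h z)) with (Copp (h z)) in K3 by ring.
    rewrite Cmod_opp in K3. lra. }
  set (j := Cinv (h (Cplus z k))) in *. fold i in K2.
  assert (Jb : Cmod j <= Cmod i + 1).
  { replace j with (Cplus (Cminus j i) i) by ring.
    eapply Rle_trans; [apply Cmod_triangle|]. lra. }
  pose proof (Cmod_ge_0 j) as J0. pose proof (Cmod_ge_0 k) as k0.
  (* This rests on j - i = - i j (h(z + k) - h(z)) for the new and the old inverse. *)
  replace (Cminus _ _) with (Cplus
     (Copp (Cmult (Cmult i j) (Cminus (Cminus (h (Cplus z k)) (h z)) (Cmult l k))))
     (Copp (Cmult (Cmult (Cmult l i) k) (Cminus j i)))).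
  2: { unfold i, j. field. auto. }
  eapply Rle_trans; [apply Cmod_triangle|]. rewrite !Cmod_opp, !Cmod_mult.
  assert (T1 : Cmod i * Cmod j * Cmod (Cminus (Cminus (h (Cplus z k)) (h z)) (Cmult l k))
     <= e / 2 * Cmod k).
  { replace (e / 2 * Cmod k) with ((Cmod i * (Cmod i + 1) + 1) *
      (e / (2 * (Cmod i * (Cmod i + 1) + 1)) * Cmod k)) by (field; nra).
    apply Rmult_le_compat; auto; try apply Cmod_ge_0; nra. }
  assert (T2 : Cmod l * Cmod i * Cmod k * Cmod (Cminus j i) <= e / 2 * Cmod k).
  { replace (e / 2 * Cmod k) with ((Cmod l * Cmod i + 1) * Cmod k *
      (e / (2 * (Cmod l * Cmod i + 1)))) by (field; nra).
    apply Rmult_le_compat; try apply Cmod_ge_0; try lra.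
    repeat apply Rmult_le_pos; auto. }
  lra.
Qed.

(* Continuity of the derivative is part of the definition, as differentiation under the
   integral sign in the mean value property needs it. *)
Definition hol (U : C -> Prop) (h : C -> C) : Prop :=
  exists h', forall z, U z -> cdiff h z (h' z) /\ ccts h' z.

Lemma hol_const U c : hol U (fun _ => c).
Proof. exists (fun _ => RtoC 0). intros z _. split; [apply cdiff_const|apply ccts_const]. Qed.
Lemma hol_id U : hol U (fun w => w).
Proof. exists (fun _ => RtoC 1). intros z _. split; [apply cdiff_id|apply ccts_const]. Qed.
Lemma hol_plus U h g : hol U h -> hol U g -> hol U (fun w => Cplus (h w) (g w)).
Proof.
  intros [h' Hh] [g' Hg]. exists (fun w => Cplus (h' w) (g' w)). intros z Hz.
  destruct (Hh z Hz), (Hg z Hz). split; [now apply cdiff_plus|now apply ccts_plus].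
Qed.
Lemma hol_mult U h g : hol U h -> hol U g -> hol U (fun w => Cmult (h w) (g w)).
Proof.
  intros [h' Hh] [g' Hg].
  exists (fun w => Cplus (Cmult (h' w) (g w)) (Cmult (h w) (g' w))). intros z Hz.
  destruct (Hh z Hz) as [H1 H2], (Hg z Hz) as [H3 H4].
  pose proof (cdiff_ccts _ _ _ H1). pose proof (cdiff_ccts _ _ _ H3).
  split; [now apply cdiff_mult|apply ccts_plus; now apply ccts_mult].
Qed.
Lemma hol_inv (U : C -> Prop) h : (forall z, U z -> h z <> RtoC 0) -> hol U h ->
  hol U (fun w => Cinv (h w)).
Proof.
  intros H0 [h' Hh].
  exists (fun w => Copp (Cmult (h' w) (Cmult (Cinv (h w)) (Cinv (h w))))). intros z Hz.
  destruct (Hh z Hz) as [H1 H2]. pose proof (cdiff_ccts _ _ _ H1).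
  split; [apply cdiff_inv; auto|].
  apply ccts_opp, ccts_mult; auto. apply ccts_mult; apply ccts_inv; auto.
Qed.
Lemma hol_minus U h g : hol U h -> hol U g -> hol U (fun w => Cminus (h w) (g w)).
Proof.
  intros Hh Hg.
  destruct (hol_plus U _ _ Hh (hol_mult U _ _ (hol_const U (Copp (RtoC 1))) Hg)) as [d Hd].
  exists d. intros z Hz. destruct (Hd z Hz) as [H1 H2]. split; auto.
  intros e He. destruct (H1 e He) as [r [Hr K]]. exists r; split; auto.
  intros k Hk. specialize (K k Hk).
  replace (Cminus (Cminus (h (Cplus z k)) (g (Cplus z k))) (Cminus (h z) (g z))) with
   (Cminus (Cplus (h (Cplus z k)) (Cmult (Copp (RtoC 1)) (g (Cplus z k))))
     (Cplus (h z) (Cmult (Copp (RtoC 1)) (g z)))) by ring. auto.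
Qed.

Lemma cexp_taylor0 w : Cmod (Cminus (cexp w) (RtoC 1)) <= 2 * Cmod w * exp (Cmod w).
Proof.
  assert (E : Cminus (cexp w) (RtoC 1) =
    CInt (fun t => Cmult w (cexp (Cmult w (RtoC t)))) 0 1).
  { rewrite (CInt_derive (fun t => cexp (Cmult w (RtoC t)))).
    - rewrite Cmult_0_r, Cmult_1_r, cexp_0. reflexivity.
    - apply cexp_cderive.
    - auto with cont. }
  rewrite E. eapply Rle_trans.
  - apply CInt_bound with (M := Cmod w * exp (Cmod w * 1)); auto with cont; [lra|].
    intros t Ht. rewrite Cmod_mult. apply Rmult_le_compat_l; [apply Cmod_ge_0|].
    apply cexp_bound. apply Rabs_le_between; lra.
  - rewrite Rmult_1_r. right; ring.
Qed.

(** The remainder is the integral of w (e^{wt} - 1) over [0, 1], so [cexp_taylor0] applies under the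
    integral sign. *)
Lemma cexp_taylor1 w :
  Cmod (Cminus (Cminus (cexp w) (RtoC 1)) w) <= 4 * Cmod w ^ 2 * exp (Cmod w).
Proof.
  assert (E : Cminus (Cminus (cexp w) (RtoC 1)) w =
    CInt (fun t => Cmult w (Cminus (cexp (Cmult w (RtoC t))) (RtoC 1))) 0 1).
  { rewrite (CInt_ext _ (fun t => Cplus (Cmult w (cexp (Cmult w (RtoC t))))
       (Copp w))) by (intros; ring).
    rewrite CInt_plus, (CInt_derive (fun t => cexp (Cmult w (RtoC t)))); auto with cont.
    - rewrite Cmult_0_r, Cmult_1_r, cexp_0.
      rewrite (CInt_derive (fun t => Cmult (Copp w) (RtoC t)) (fun _ => Copp w)); auto with cont.
      + ring.
      + intros x []; simpl; auto_derive; auto; ring.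
    - apply cexp_cderive. }
  rewrite E. eapply Rle_trans.
  - apply CInt_bound with (M := Cmod w * (2 * Cmod w * exp (Cmod w))); auto with cont; [lra|].
    intros t Ht. rewrite Cmod_mult. apply Rmult_le_compat_l; [apply Cmod_ge_0|].
    eapply Rle_trans; [apply cexp_taylor0|].
    assert (B : Cmod (Cmult w (RtoC t)) <= Cmod w).
    { rewrite Cmod_mult, Cmod_R, Rabs_right by lra. pose proof (Cmod_ge_0 w). nra. }
    pose proof (Cmod_ge_0 (Cmult w (RtoC t))). pose proof (exp_pos (Cmod (Cmult w (RtoC t)))).
    apply Rmult_le_compat; try lra. now apply exp_mono.
  - right; ring.
Qed.

(** Common shape of [Phi] and of the integral in [den], so that holomorphy in lam is proved once. *)
Definition laplace (G : R -> C) (a b : R) (lam : C) : C :=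
  CInt (fun s => Cmult (cexp (Cmult lam (RtoC (- s)))) (G s)) a b.

Lemma cexp_neg_ccont lam : ccont (fun s => cexp (Cmult lam (RtoC (- s)))).
Proof.
  intros b. apply (cont_comp (fun s => cp b (cexp (Cmult lam (RtoC s))))); auto with cont.
  apply cexp_ccont.
Qed.
#[global] Hint Resolve cexp_neg_ccont : cont.

Lemma ccont_bounded_on G a b : ccont G -> exists M, 0 <= M /\
  forall s, a <= s <= b -> Cmod (G s) <= M.
Proof.
  intros HG. destruct (cont_bounded_on _ a b (HG true)) as [m1 [P1 H1]].
  destruct (cont_bounded_on _ a b (HG false)) as [m2 [P2 H2]].
  exists (m1 + m2). split; [lra|]. intros s Hs. eapply Rle_trans; [apply Cmod_cp|].
  apply Rplus_le_compat; auto.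
Qed.

(** Differentiation under the integral: e^{-ks} - 1 + ks is quadratic in k, uniformly for s in
    [a, b]. *)
Lemma laplace_cdiff G a b lam : ccont G -> a <= b ->
  cdiff (laplace G a b) lam (laplace (fun s => Cmult (RtoC (- s)) (G s)) a b lam).
Proof.
  intros HG Hab e He.
  set (r := Rabs a + Rabs b).
  assert (Hr : forall s, a <= s <= b -> Rabs (- s) <= r).
  { intros s Hs. unfold r. rewrite Rabs_Ropp. unfold Rabs. repeat destruct Rcase_abs; lra. }
  assert (r0 : 0 <= r) by (unfold r; pose proof (Rabs_pos a); pose proof (Rabs_pos b); lra).
  destruct (ccont_bounded_on (fun s => Cmult (cexp (Cmult lam (RtoC (- s)))) (G s)) a b)
    as [M [M0 HM]]; auto with cont.
  set (K := 4 * r ^ 2 * exp r * M).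
  assert (K0 : 0 <= K).
  { unfold K. pose proof (exp_pos r). pose proof (pow2_ge_0 r).
    repeat apply Rmult_le_pos; lra. }
  assert (D0 : 0 < 2 * K * (b - a) + 1) by nra.
  (* |k| <= 1 bounds the exponential factor by exp r; the second bound turns 2 K (b - a) |k|^2 into
     at most e |k|. *)
  exists (Rmin 1 (e / (2 * K * (b - a) + 1))).
  split; [apply Rmin_glb_lt; [lra|now apply Rdiv_lt_0_compat]|].
  intros k Hk.
  pose proof (Rmin_l 1 (e / (2 * K * (b - a) + 1))). pose proof (Rmin_r 1 (e / (2 * K * (b - a) + 1))).
  pose proof (Cmod_ge_0 k) as k0.
  unfold laplace.
  set (E := fun s => Cmult (Cminus (Cminus (cexp (Cmult k (RtoC (- s)))) (RtoC 1)) (Cmult k (RtoC (- s))))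
    (Cmult (cexp (Cmult lam (RtoC (- s)))) (G s))).
  assert (Cs : ccont (fun s => RtoC (- s))) by (apply ccont_RtoC; auto with cont).
  assert (CE : ccont E) by (unfold E; auto 10 with cont).
  rewrite (CInt_ext (fun s => Cmult (cexp (Cmult (Cplus lam k) (RtoC (- s)))) (G s))
    (fun s => Cplus (Cplus (E s) (Cmult (cexp (Cmult lam (RtoC (- s)))) (G s)))
      (Cmult k (Cmult (cexp (Cmult lam (RtoC (- s)))) (Cmult (RtoC (- s)) (G s)))))).
  2: { intros s _. rewrite Cmult_plus_distr_r, cexp_plus. unfold E. ring. }
  rewrite !CInt_plus, CInt_scal by auto 10 with cont.
  replace (Cminus _ _) with (CInt E a b) by ring.
  eapply Rle_trans; [apply CInt_bound with (M := K * Cmod k ^ 2); auto|].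
  - intros s Hs. unfold E. rewrite Cmod_mult.
    replace (K * Cmod k ^ 2) with (4 * (Cmod k * r) ^ 2 * exp r * M) by (unfold K; ring).
    apply Rmult_le_compat; try apply Cmod_ge_0; auto.
    eapply Rle_trans; [apply cexp_taylor1|].
    assert (B : Cmod (Cmult k (RtoC (- s))) <= Cmod k * r).
    { rewrite Cmod_mult, Cmod_R. apply Rmult_le_compat_l; auto. }
    pose proof (Cmod_ge_0 (Cmult k (RtoC (- s)))).
    apply Rmult_le_compat; try (left; apply exp_pos).
    + pose proof (pow2_ge_0 (Cmod (Cmult k (RtoC (- s))))). lra.
    + apply Rmult_le_compat_l; [lra|]. apply pow_incr; lra.
    + apply exp_mono. nra.
  - assert (Cmod k * (2 * K * (b - a) + 1) <= e) by (apply Rle_div_r; lra). nra.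
Qed.

Lemma laplace_hol U G a b : ccont G -> a <= b -> hol U (laplace G a b).
Proof.
  intros HG Hab. exists (laplace (fun s => Cmult (RtoC (- s)) (G s)) a b). intros z _.
  split; [now apply laplace_cdiff|]. eapply cdiff_ccts. apply laplace_cdiff; auto.
  apply ccont_mult; auto. apply ccont_RtoC; auto with cont.
Qed.

Lemma cexp_scaled_cdiff x z :
  cdiff (fun w => cexp (Cmult w (RtoC x))) z (Cmult (RtoC x) (cexp (Cmult z (RtoC x)))).
Proof.
  intros e He. set (M := Cmod (cexp (Cmult z (RtoC x)))). set (r := Rabs x).
  assert (r0 : 0 <= r) by apply Rabs_pos. assert (M0 : 0 <= M) by apply Cmod_ge_0.
  set (K := 4 * r ^ 2 * exp r * M).
  assert (K0 : 0 <= K).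
  { unfold K. pose proof (exp_pos r). pose proof (pow2_ge_0 r).
    repeat apply Rmult_le_pos; lra. }
  exists (Rmin 1 (e / (K + 1))). split; [apply Rmin_glb_lt; [lra|apply Rdiv_lt_0_compat; lra]|].
  intros k Hk. pose proof (Rmin_l 1 (e / (K + 1))). pose proof (Rmin_r 1 (e / (K + 1))).
  pose proof (Cmod_ge_0 k) as k0.
  rewrite Cmult_plus_distr_r, cexp_plus.
  replace (Cminus _ _) with (Cmult (Cminus (Cminus (cexp (Cmult k (RtoC x))) (RtoC 1)) (Cmult k (RtoC x)))
    (cexp (Cmult z (RtoC x)))) by ring.
  rewrite Cmod_mult. fold M.
  assert (B : Cmod (Cmult k (RtoC x)) = Cmod k * r) by (now rewrite Cmod_mult, Cmod_R).
  pose proof (cexp_taylor1 (Cmult k (RtoC x))) as T. rewrite B in T.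
  assert (exp (Cmod k * r) <= exp r) by (apply exp_mono; nra).
  assert (0 <= 4 * (Cmod k * r) ^ 2) by (pose proof (pow2_ge_0 (Cmod k * r)); lra).
  assert (T2 : Cmod (Cminus (Cminus (cexp (Cmult k (RtoC x))) (RtoC 1)) (Cmult k (RtoC x)))
    <= 4 * (Cmod k * r) ^ 2 * exp r).
  { eapply Rle_trans; [apply T|]. now apply Rmult_le_compat_l. }
  assert (T3 : Cmod k * (K + 1) <= e) by (apply Rle_div_r; lra).
  apply Rle_trans with (4 * (Cmod k * r) ^ 2 * exp r * M); [now apply Rmult_le_compat_r|].
  replace (4 * (Cmod k * r) ^ 2 * exp r * M) with (Cmod k * K * Cmod k) by (unfold K; ring).
  apply Rmult_le_compat_r; nra.
Qed.

Lemma cexp_scaled_hol U x : hol U (fun w => cexp (Cmult w (RtoC x))).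
Proof.
  exists (fun z => Cmult (RtoC x) (cexp (Cmult z (RtoC x)))). intros z _.
  split; [apply cexp_scaled_cdiff|]. apply ccts_mult; [apply ccts_const|].
  eapply cdiff_ccts. apply cexp_scaled_cdiff.
Qed.

Lemma cdiff_chain h g s v l : cderive g s v -> cdiff h (g s) l ->
  cderive (fun t => h (g t)) s (Cmult l v).
Proof.
  intros Hg Hh b. apply is_derive_Reals. intros e He.
  pose proof (Cmod_ge_0 l) as L0. pose proof (Cmod_ge_0 v) as V0.
  (* The cap 1 yields the a priori bound |k| <= (|v| + 1) |u| on the increment of the curve. *)
  set (e1 := Rmin 1 (e / (4 * (Cmod l + 1)))).
  assert (E1 : 0 < e1) by (apply Rmin_glb_lt; [lra|apply Rdiv_lt_0_compat; lra]).
  pose proof (Rmin_l 1 (e / (4 * (Cmod l + 1)))) as E1a.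
  pose proof (Rmin_r 1 (e / (4 * (Cmod l + 1)))) as E1b. fold e1 in E1a, E1b.
  assert (E2 : 0 < e / (4 * (Cmod v + 1))) by (apply Rdiv_lt_0_compat; lra).
  assert (Hg1 : exists d, 0 < d /\ forall u, u <> 0 -> Rabs u < d ->
    Cmod (Cminus (Cminus (g (s + u)) (g s)) (Cmult (RtoC u) v)) <= e1 * Rabs u).
  { assert (E3 : 0 < e1 / 2) by lra.
    destruct (proj1 (is_derive_Reals _ _ _) (Hg true) _ E3) as [d1 K1].
    destruct (proj1 (is_derive_Reals _ _ _) (Hg false) _ E3) as [d2 K2].
    exists (Rmin d1 d2). split; [apply Rmin_glb_lt; apply cond_pos|]. intros u Hu0 Hu.
    pose proof (Rmin_l d1 d2). pose proof (Rmin_r d1 d2).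
    specialize (K1 u Hu0 ltac:(lra)). specialize (K2 u Hu0 ltac:(lra)).
    assert (Au : 0 < Rabs u) by (now apply Rabs_pos_lt).
    replace (e1 * Rabs u) with (2 * (e1 / 2 * Rabs u)) by field. apply Cmod_cp_le. intros c.
    rewrite !cp_minus, cp_scal.
    replace (cp c (g (s + u)) - cp c (g s) - u * cp c v) with
      (((cp c (g (s + u)) - cp c (g s)) / u - cp c v) * u) by (field; auto).
    rewrite Rabs_mult. apply Rmult_le_compat_r; [lra|]. destruct c; lra. }
  destruct Hg1 as [d1 [P1 K1]]. destruct (Hh _ E2) as [d2 [P2 K2]].
  assert (D : 0 < Rmin d1 (d2 / (Cmod v + 1))) by
    (apply Rmin_glb_lt; auto; apply Rdiv_lt_0_compat; lra).
  exists (mkposreal _ D). simpl. intros u Hu0 Hu.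
  pose proof (Rmin_l d1 (d2 / (Cmod v + 1))). pose proof (Rmin_r d1 (d2 / (Cmod v + 1))).
  specialize (K1 u Hu0 ltac:(lra)).
  assert (Au : 0 < Rabs u) by (now apply Rabs_pos_lt).
  set (k := Cminus (g (s + u)) (g s)) in *.
  assert (Bk : Cmod k <= (Cmod v + 1) * Rabs u).
  { replace k with (Cplus (Cminus k (Cmult (RtoC u) v)) (Cmult (RtoC u) v)) by ring.
    eapply Rle_trans; [apply Cmod_triangle|]. rewrite Cmod_mult, Cmod_R. nra. }
  assert (Hk : Cmod k < d2).
  { assert (Rabs u * (Cmod v + 1) < d2) by (apply Rlt_div_r; lra). lra. }
  specialize (K2 k Hk). replace (Cplus (g s) k) with (g (s + u)) in K2 by (unfold k; ring).
  replace ((cp b (h (g (s + u))) - cp b (h (g s))) / u - cp b (Cmult l v)) with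
    ((cp b (h (g (s + u))) - cp b (h (g s)) - u * cp b (Cmult l v)) / u) by (field; auto).
  rewrite <- cp_scal, <- !cp_minus. unfold Rdiv. rewrite Rabs_mult, Rabs_inv.
  apply (Rlt_div_l _ _ (Rabs u)); auto. eapply Rle_lt_trans; [apply cp_Cmod|].
  replace (Cminus _ _) with (Cplus (Cminus (Cminus (h (g (s + u))) (h (g s))) (Cmult l k))
    (Cmult l (Cminus k (Cmult (RtoC u) v)))) by ring.
  eapply Rle_lt_trans; [apply Cmod_triangle|]. rewrite (Cmod_mult l).
  assert (T1 : e / (4 * (Cmod v + 1)) * Cmod k <= e / 4 * Rabs u).
  { replace (e / 4 * Rabs u) with (e / (4 * (Cmod v + 1)) * ((Cmod v + 1) * Rabs u)) by (field; lra).
    apply Rmult_le_compat_l; lra. }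
  assert (T2 : Cmod l * Cmod (Cminus k (Cmult (RtoC u) v)) <= e / 4 * Rabs u).
  { replace (e / 4 * Rabs u) with ((Cmod l + 1) * (e / (4 * (Cmod l + 1)) * Rabs u)) by (field; lra).
    apply Rmult_le_compat; try apply Cmod_ge_0; [lra|].
    eapply Rle_trans; [apply K1|]. apply Rmult_le_compat_r; lra. }
  assert (0 < e * Rabs u) by (now apply Rmult_lt_0_compat). lra.
Qed.

(** * The mean value property on circles *)

Definition cis (th : R) : C := (cos th, sin th).

Lemma Cmod_cis th : Cmod (cis th) = 1.
Proof.
  unfold cis, Cmod; simpl. pose proof (sin2_cos2 th) as E. unfold Rsqr in E.
  replace (_ + _) with 1 by lra. apply sqrt_1.
Qed.

Lemma cis_cderive th : cderive cis th (Cmult Ci (cis th)).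
Proof. intros []; unfold cis; simpl; auto_derive; auto; ring. Qed.

Lemma cis_ccont : ccont cis.
Proof. eapply cderive_ccont, cis_cderive. Qed.
#[global] Hint Resolve cis_ccont : cont.

Definition polar (u v : R) : C := (u * cos v, u * sin v).

Lemma polar_cis u v : polar u v = Cmult (RtoC u) (cis v).
Proof. unfold polar, cis. apply injective_projections; simpl; ring. Qed.

Lemma Cmod_polar u v : Cmod (polar u v) = Rabs u.
Proof. rewrite polar_cis, Cmod_mult, Cmod_R, Cmod_cis. ring. Qed.

Lemma polar_radial_cderive u v : cderive (fun z => polar z v) u (cis v).
Proof. intros []; unfold polar, cis; simpl; auto_derive; auto; ring. Qed.

Lemma polar_angular_cderive u v : cderive (polar u) v (Cmult (Cmult (RtoC u) Ci) (cis v)).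
Proof. intros []; unfold polar, cis; simpl; auto_derive; auto; ring. Qed.

Lemma ccts_polar_2d h b u v : ccts h (polar u v) ->
  continuity_2d_pt (fun u v => cp b (h (polar u v))) u v.
Proof.
  intros H. apply continuity_2d_pt_filterlim.
  assert (Cc : continuous (fun p : R * R => cos (snd p)) (u, v)).
  { apply (continuous_comp (fun p : R * R => snd p) cos); [apply continuous_snd|apply continuous_cos]. }
  assert (Cs : continuous (fun p : R * R => sin (snd p)) (u, v)).
  { apply (continuous_comp (fun p : R * R => snd p) sin); [apply continuous_snd|apply continuous_sin]. }
  apply (continuous_comp_2 (fun p : R * R => fst p * cos (snd p)) (fun p : R * R => fst p * sin (snd p))
    (fun x y => cp b (h (x, y)))).
  - apply @continuous_mult; auto. apply continuous_fst.
  - apply @continuous_mult; auto. apply continuous_fst.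
  - simpl. apply (continuous_ext (fun w : C => cp b (h w))); [|apply H].
    now intros [x y].
Qed.

Section MeanValue.
Variables (h h' : C -> C) (r : R).
Hypothesis r_pos : 0 < r.
Hypothesis h_hol : forall z, Cmod z <= r -> cdiff h z (h' z) /\ ccts h' z.

Let F (b : bool) (u v : R) : R := cp b (h (polar u v)).

Lemma F_radial b u v : Rabs u <= r ->
  is_derive (fun z => F b z v) u (cp b (Cmult (h' (polar u v)) (cis v))).
Proof.
  intros Hu. apply (cdiff_chain h (fun z => polar z v)).
  - apply polar_radial_cderive.
  - apply h_hol. now rewrite Cmod_polar.
Qed.

(** Cauchy-Riemann in polar coordinates: the angular derivative is i u times the radial one. *)
Lemma circle_angular u v : Rabs u <= r ->
  cderive (fun v => h (polar u v)) v
    (Cmult (Cmult (RtoC u) Ci) (Cmult (h' (polar u v)) (cis v))).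
Proof.
  intros Hu. replace (Cmult _ _) with
    (Cmult (h' (polar u v)) (Cmult (Cmult (RtoC u) Ci) (cis v))) by ring.
  apply (cdiff_chain h (polar u)).
  - apply polar_angular_cderive.
  - apply h_hol. now rewrite Cmod_polar.
Qed.

Lemma circle_ccont u : Rabs u <= r -> ccont (fun v => h (polar u v)).
Proof. intros Hu. eapply cderive_ccont. intros v. now apply circle_angular. Qed.

Lemma F_2d b u v : Rabs u <= r -> continuity_2d_pt (F b) u v.
Proof.
  intros Hu. apply ccts_polar_2d. eapply cdiff_ccts. apply h_hol. now rewrite Cmod_polar.
Qed.

Lemma radial_2d b u v : Rabs u <= r ->
  continuity_2d_pt (fun u v => cp b (Cmult (h' (polar u v)) (cis v))) u v.
Proof.
  intros Hu.
  assert (Hc : ccts h' (polar u v)) by (apply h_hol; now rewrite Cmod_polar).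
  pose proof (ccts_polar_2d h' true u v Hc) as C1.
  pose proof (ccts_polar_2d h' false u v Hc) as C2. simpl in C1, C2.
  assert (Cc : continuity_2d_pt (fun _ v => cos v) u v).
  { apply (continuity_1d_2d_pt_comp cos (fun _ v => v)); [apply continuity_cos|apply continuity_2d_pt_id2]. }
  assert (Cs : continuity_2d_pt (fun _ v => sin v) u v).
  { apply (continuity_1d_2d_pt_comp sin (fun _ v => v)); [apply continuity_sin|apply continuity_2d_pt_id2]. }
  destruct b; simpl.
  - apply continuity_2d_pt_minus; apply continuity_2d_pt_mult; auto.
  - apply continuity_2d_pt_plus; apply continuity_2d_pt_mult; auto.
Qed.

Lemma radial_ccont u : Rabs u <= r -> ccont (fun v => Cmult (h' (polar u v)) (cis v)).
Proof.
  intros Hu b v. pose proof (radial_2d b u v Hu) as H.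
  apply continuity_2d_pt_filterlim in H.
  apply (continuous_comp_2 (fun _ => u) (fun v => v)
    (fun u v => cp b (Cmult (h' (polar u v)) (cis v)))); auto.
  - apply continuous_const.
  - apply continuous_id.
Qed.

(** Multiplied by i u, the integrand becomes the angular derivative of a function of period 2 PI,
    whose integral vanishes. So circle means have zero radial derivative. *)
Lemma radial_integral u : 0 < u < r ->
  CInt (fun v => Cmult (h' (polar u v)) (cis v)) 0 (2 * PI) = RtoC 0.
Proof.
  intros Hu. assert (Au : Rabs u <= r) by (rewrite Rabs_right; lra).
  assert (E : Cmult (Cmult (RtoC u) Ci) (CInt (fun v => Cmult (h' (polar u v)) (cis v)) 0 (2 * PI)) = RtoC 0).
  { rewrite <- CInt_scal by now apply radial_ccont.
    rewrite (CInt_derive (fun v => h (polar u v))).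
    - unfold polar. rewrite cos_2PI, sin_2PI, cos_0, sin_0. ring.
    - intros x. now apply circle_angular.
    - apply ccont_mult; [auto with cont|now apply radial_ccont]. }
  apply NNPP. intros N. revert E. apply Cmult_neq_0; auto. apply Cmult_neq_0.
  - intros Z. injection Z. lra.
  - intros Z. injection Z. lra.
Qed.

Let J (b : bool) (u : R) : R := RInt (fun v => F b u v) 0 (2 * PI).

(** Differentiation under the integral sign uses a full neighbourhood of the radius, hence the
    strict inequality. *)
Lemma J_derive b u : Rabs u < r ->
  is_derive (J b) u (cp b (CInt (fun v => Cmult (h' (polar u v)) (cis v)) 0 (2 * PI))).
Proof.
  intros Hu.
  assert (Near : forall y, Rabs (y - u) < r - Rabs u -> Rabs y <= r).
  { intros y Hy. replace y with ((y - u) + u) by ring. eapply Rle_trans; [apply Rabs_triang|]. lra. }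
  assert (D0 : 0 < r - Rabs u) by lra.
  replace (cp b _) with (RInt (fun v => Derive (fun z => F b z v) u) 0 (2 * PI)).
  2: { rewrite cp_CInt. apply RInt_ext. intros v _. apply is_derive_unique, F_radial. lra. }
  apply (is_derive_RInt_param (F b)).
  - exists (mkposreal _ D0). intros y Hy t _.
    exists (cp b (Cmult (h' (polar y t)) (cis t))). apply F_radial. now apply Near.
  - intros t _. apply continuity_2d_pt_ext_loc with
      (fun u v => cp b (Cmult (h' (polar u v)) (cis v))); [|apply radial_2d; lra].
    exists (mkposreal _ D0). intros y v Hy _. symmetry.
    apply is_derive_unique, F_radial. now apply Near.
  - exists (mkposreal _ D0). intros y Hy. apply cont_ex_RInt.
    apply (circle_ccont y). now apply Near.
Qed.

Lemma J_inner b u : 0 <= u < r -> J b u = J b 0.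
Proof.
  intros [Hu0 Hu]. destruct (MVT_gen (J b) 0 u (fun _ => 0)) as [c [_ E]].
  - intros x. rewrite Rmin_left, Rmax_right by lra. intros Hx.
    pose proof (J_derive b x ltac:(rewrite Rabs_right; lra)) as D.
    rewrite radial_integral in D by lra. now destruct b.
  - intros x. rewrite Rmin_left, Rmax_right by lra. intros Hx.
    apply continuity_pt_filterlim. apply (@ex_derive_continuous R_AbsRing R_NormedModule).
    eexists. apply J_derive. rewrite Rabs_right; lra.
  - lra.
Qed.

(** Means are constant for radii below r; the boundary circle, on which no derivative of the mean is
    available, is reached by uniform continuity. *)
Lemma mean_value :
  CInt (fun v => h (polar r v)) 0 (2 * PI) = Cmult (RtoC (2 * PI)) (h (RtoC 0)).
Proof.
  pose proof PI_RGT_0 as HPI.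
  apply cp_ext. intros b. rewrite cp_scal, cp_CInt. change (J b r = 2 * PI * cp b (h (RtoC 0))).
  replace (2 * PI * cp b (h (RtoC 0))) with (J b 0).
  2: { unfold J. rewrite (RInt_ext _ (fun _ => cp b (h (RtoC 0)))).
       - rewrite RInt_constR. ring.
       - intros v _. unfold F, polar. now rewrite !Rmult_0_l. }
  apply cond_eq. intros eps He.
  assert (E1 : 0 < eps / (4 * PI)) by (apply Rdiv_lt_0_compat; lra).
  destruct (uniform_continuity_2d (F b) 0 r 0 (2 * PI)) with (eps := mkposreal _ E1) as [d Hd].
  { intros x y Hx _. apply F_2d. rewrite Rabs_right; lra. }
  simpl in Hd.
  (* An interior radius within [d] of r; [Rmax] covers the case where [d] exceeds the disc. *)
  set (u := Rmax 0 (r - d / 2)).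
  assert (Hu : 0 <= u < r /\ r - u <= d / 2).
  { pose proof (cond_pos d). unfold u, Rmax. destruct Rle_dec; lra. }
  rewrite <- (J_inner b u) by lra. unfold J.
  rewrite <- RInt_sub.
  2: apply (circle_ccont r); rewrite Rabs_right; lra.
  2: apply (circle_ccont u); rewrite Rabs_right; lra.
  eapply Rle_lt_trans; [apply RInt_bound with (M := eps / (4 * PI))|].
  - apply cont_minus; [apply (circle_ccont r)|apply (circle_ccont u)]; rewrite Rabs_right; lra.
  - lra.
  - intros t Ht. left. pose proof (cond_pos d). apply Hd; try lra.
    + rewrite Rabs_right; lra.
    + replace (t - t) with 0 by ring. rewrite Rabs_R0. lra.
  - replace (eps / (4 * PI) * (2 * PI - 0)) with (eps / 2) by (field; lra). lra.
Qed.
End MeanValue.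

(** * The spectral projection *)

Lemma den_laplace lam : den lam = Cplus (RtoC 1) (laplace (fun _ => RtoC 1) 1 2 lam).
Proof.
  unfold den, laplace. f_equal. apply CInt_ext. intros s _. rewrite cexp_neg. ring.
Qed.

Lemma hol_ext U h g : (forall z, h z = g z) -> hol U h -> hol U g.
Proof.
  intros E [h' Hh]. exists h'. intros z Hz. destruct (Hh z Hz) as [H1 H2]. split; auto.
  intros e He. destruct (H1 e He) as [d [Hd K]]. exists d. split; auto.
  intros k Hk. rewrite <- !E. auto.
Qed.

Lemma den_hol U : hol U den.
Proof.
  apply hol_ext with (fun lam => Cplus (RtoC 1) (laplace (fun _ => RtoC 1) 1 2 lam)).
  - intros; symmetry; apply den_laplace.
  - apply hol_plus; [apply hol_const|apply laplace_hol; [apply ccont_const|lra]].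
Qed.

Lemma Phi_hol U g x : inE g -> x <= 0 -> hol U (fun lam => Phi lam g x).
Proof. intros Hg Hx. apply (laplace_hol U (ext g) x 0); auto. now apply ext_ccont. Qed.

(* [lam * resolv lam g x], extended across the singularity at [lam = 0]. *)
Definition regularized (g : fn) (x : R) (lam : C) : C :=
  Cmult (cexp (Cmult lam (RtoC x)))
    (Cplus (Cmult (num lam g) (Cinv (den lam))) (Cmult lam (Phi lam g x))).

Lemma regularized_hol (U : C -> Prop) g x : inE g -> Ival x ->
  (forall z, U z -> den z <> RtoC 0) -> hol U (regularized g x).
Proof.
  intros Hg [Hx1 Hx2] HU. unfold regularized.
  apply (hol_mult U (fun lam => cexp (Cmult lam (RtoC x)))); [apply cexp_scaled_hol|].
  apply (hol_plus U (fun lam => Cmult (num lam g) (Cinv (den lam)))).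
  - apply (hol_mult U (fun lam => num lam g)).
    + unfold num. apply (hol_plus U (fun _ => g 0)); [apply hol_const|].
      apply (hol_minus U (fun lam => Cmult (cexp (Cmult lam (RtoC (-2)))) (Phi lam g (-2))));
      [apply (hol_mult U (fun lam => cexp (Cmult lam (RtoC (-2)))))
      |apply (hol_mult U (fun lam => cexp (Cmult lam (RtoC (-1)))))];
      try apply cexp_scaled_hol; apply Phi_hol; auto; lra.
    + apply hol_inv; auto. apply den_hol.
  - apply (hol_mult U (fun lam => lam)); [apply hol_id|apply Phi_hol; auto].
Qed.

Lemma regularized_resolv g x lam : lam <> RtoC 0 -> den lam <> RtoC 0 ->
  Cmult lam (resolv lam g x) = regularized g x lam.
Proof. intros H1 H2. unfold resolv, regularized. field. auto. Qed.

Definition mean_op : Op := fun f _ => (functional true f / 2, functional false f / 2).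

Lemma cp_mean_op b f x : cp b (mean_op f x) = functional b f / 2.
Proof. now destruct b. Qed.

(** At lam = 0 the exponentials are 1, the difference of the two [Phi] terms is the integral of [g]
    over [-2, -1], and [den] is 2. *)
Lemma regularized_0 g x : inE g -> regularized g x (RtoC 0) = mean_op g x.
Proof.
  intros Hg. unfold regularized, num. rewrite !Cmult_0_l, cexp_0, den_0.
  assert (E : Cminus (Phi (RtoC 0) g (-2)) (Phi (RtoC 0) g (-1)) = CInt (ext g) (-2) (-1)).
  { assert (P : forall y, Phi (RtoC 0) g y = CInt (ext g) y 0).
    { intros y. apply CInt_ext. intros s _. rewrite Cmult_0_l, cexp_0. ring. }
    rewrite !P, <- (CInt_Chasles (ext g) (-2) (-1) 0) by now apply ext_ccont. ring. }
  rewrite !Cmult_1_l, E, Cplus_0_r. apply cp_ext. intros b. rewrite cp_mean_op.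
  unfold functional. rewrite comp_I by auto.
  replace (Cinv (RtoC 2)) with (RtoC (/ 2)) by (rewrite RtoC_inv; [auto|lra]).
  rewrite Cmult_comm, cp_scal, cp_plus, cp_CInt. unfold comp, ext. field.
Qed.

Lemma RInt_C_CInt (G : R -> C) a b : ccont G ->
  @RInt C_R_CompleteNormedModule G a b = CInt G a b.
Proof.
  intros H. apply (@is_RInt_unique C_R_CompleteNormedModule).
  apply (@is_RInt_fct_extend_pair R_NormedModule R_NormedModule).
  - apply (RInt_correct (fun t => fst (G t))). apply cont_ex_RInt, (H true).
  - apply (RInt_correct (fun t => snd (G t))). apply cont_ex_RInt, (H false).
Qed.

(** On the circle (r / 2 PI) e^{i th} R(z) = (1 / 2 PI) z R(z), so the contour integral is the
    circle mean of [regularized]. *)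
Lemma contour_integral r (Res : C -> Op) f x : 0 < r ->
  (forall lam, 0 < Cmod (Cminus lam (RtoC 0)) <= r -> is_resolvent lam (Res lam)) ->
  inE f -> Ival x ->
  @RInt C_R_CompleteNormedModule
    (fun th => Cmult (Cmult (RtoC (r / (2 * PI))) (cos th, sin th))
        (Res (Cplus (RtoC 0) (Cmult (RtoC r) (cos th, sin th))) f x)) 0 (2 * PI)
  = mean_op f x.
Proof.
  intros Hr HRes Hf Hx. pose proof PI_RGT_0 as HPI.
  assert (HR : forall z, z <> RtoC 0 -> Cmod z <= r -> is_resolvent z (Res z)).
  { intros z Hz Hzr. apply HRes. replace (Cminus z (RtoC 0)) with z by ring.
    split; auto. now apply Cmod_gt_0. }
  (* The radius is given, not chosen small: zeros of [den] are excluded away from 0 by the existence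
     of resolvents, and at 0 by [den_0]. *)
  assert (HD : forall z, Cmod z <= r -> den z <> RtoC 0).
  { intros z Hzr E. destruct (classic (z = RtoC 0)) as [->|N].
    - rewrite den_0 in E. injection E. lra.
    - apply (resolvent_char z (Res z)); auto. rewrite E. ring. }
  destruct (regularized_hol (fun z => Cmod z <= r) f x Hf Hx HD) as [h' Hh].
  assert (CG : ccont (fun v => regularized f x (polar r v))).
  { apply (circle_ccont (regularized f x) h' r); auto. rewrite Rabs_right; lra. }
  assert (E : forall th, Cmult (Cmult (RtoC (r / (2 * PI))) (cos th, sin th))
        (Res (Cplus (RtoC 0) (Cmult (RtoC r) (cos th, sin th))) f x) =
      Cmult (RtoC (/ (2 * PI))) (regularized f x (polar r th))).
  { intros th. change (cos th, sin th) with (cis th). rewrite Cplus_0_l, <- (polar_cis r th).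
    assert (Hm : Cmod (polar r th) = r) by (rewrite Cmod_polar; apply Rabs_right; lra).
    assert (Hz : polar r th <> RtoC 0).
    { intros Z. rewrite Z, Cmod_0 in Hm. lra. }
    assert (Hd : den (polar r th) <> RtoC 0) by (apply HD; lra).
    rewrite <- regularized_resolv by auto.
    rewrite (is_resolvent_unique (polar r th) (Res (polar r th)) f); auto.
    - generalize (resolv (polar r th) f x). intros w. rewrite polar_cis. unfold Rdiv. rewrite RtoC_mult. ring.
    - now apply Cmult_neq_0.
    - apply HR; auto; lra. }
  rewrite (@RInt_ext C_R_CompleteNormedModule _
    (fun th => Cmult (RtoC (/ (2 * PI))) (regularized f x (polar r th)))) by (intros; apply E).
  rewrite RInt_C_CInt, CInt_scal by auto with cont.
  rewrite (mean_value (regularized f x) h' r) by auto.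
  rewrite regularized_0, Cmult_assoc, <- RtoC_mult by auto.
  rewrite Rinv_l by lra. match goal with |- ?a = ?b => change (@eq C a b) end. ring.
Qed.

Lemma den_nonzero_disc : exists r, 0 < r /\ forall z, Cmod z <= r -> den z <> RtoC 0.
Proof.
  destruct (den_hol (fun _ => True)) as [d' H]. destruct (H (RtoC 0) I) as [H1 _].
  destruct (ccts_eps _ _ (cdiff_ccts _ _ _ H1) 1 Rlt_0_1) as [d [Hd K]].
  exists (d / 2). split; [lra|]. intros z Hz E. specialize (K z ltac:(lra)).
  rewrite Cplus_0_l, E, den_0 in K.
  replace (Cminus (RtoC 0) (RtoC 2)) with (Copp (RtoC 2)) in K by ring.
  rewrite Cmod_opp, Cmod_R, Rabs_right in K; lra.
Qed.

Lemma mean_op_spectral : is_spectral_projection (RtoC 0) mean_op.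
Proof.
  destruct den_nonzero_disc as [r [Hr HD]].
  assert (HR : forall lam, 0 < Cmod (Cminus lam (RtoC 0)) <= r -> is_resolvent lam (resolv lam)).
  { intros lam. replace (Cminus lam (RtoC 0)) with lam by ring. intros [H1 H2].
    apply resolv_is_resolvent. apply Cmult_neq_0; auto. now apply Cmod_gt_0. }
  exists r. split; auto. exists resolv. split; auto.
  intros f Hf x Hx. symmetry. now apply contour_integral.
Qed.

Lemma spectral_projection_mean P : is_spectral_projection (RtoC 0) P ->
  forall f, inE f -> eqE (P f) (mean_op f).
Proof.
  intros [r [Hr [Res [HR HP]]]] f Hf x Hx. rewrite HP by auto.
  now apply contour_integral.
Qed.

Lemma mean_op_one x : mean_op (fun _ => RtoC 1) x = RtoC 1.
Proof.
  apply cp_ext. intros b. rewrite cp_mean_op. unfold functional, comp.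
  rewrite RInt_constR. destruct b; simpl; field.
Qed.

Lemma one_nonzero : ~ eqE (fun _ => RtoC 1) fzero.
Proof. intros E. specialize (E 0 Ival_0). injection E. lra. Qed.

Lemma mean_op_rank_one : rank_one mean_op.
Proof.
  exists (fun _ => RtoC 1). split; [apply inE_const|]. split; [apply one_nonzero|]. split.
  - exists (fun _ => RtoC 1). split; [apply inE_const|]. intros x _. apply mean_op_one.
  - intros f Hf. exists (mean_op f 0). intros x _. unfold fscal. rewrite Cmult_1_r. reflexivity.
Qed.

Lemma algebraically_simple_0 : algebraically_simple (RtoC 0).
Proof.
  split.
  - assert (HD : Cmult (RtoC 0) (den (RtoC 0)) = RtoC 0) by ring.
    exists (fun x => cexp (Cmult (RtoC 0) (RtoC x))),
      (fscal (RtoC 0) (fun x => cexp (Cmult (RtoC 0) (RtoC x)))).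
    split; [now apply char_root_eigen|]. split; [|now intros x _].
    intros E. apply one_nonzero. intros x Hx. rewrite <- (E x Hx), Cmult_0_l. now rewrite cexp_0.
  - exists mean_op. split; [apply mean_op_spectral|apply mean_op_rank_one].
Qed.

Lemma functional_pos f : posE f -> 0 <= functional true f /\ functional false f = 0.
Proof.
  intros [Hf HP]. unfold functional.
  assert (A : forall x, comp true f x >= 0 /\ comp false f x = 0).
  { intros x. destruct (HP (clamp x) (clamp_I x)) as [H1 H2]. unfold comp; simpl.
    unfold Re, Im in *. split; lra. }
  split.
  - assert (0 <= RInt (comp true f) (-2) (-1)).
    { apply RInt_ge_0; [lra|apply cont_ex_RInt, inE_comp; auto|].
      intros x _. apply Rge_le, A. }
    destruct (A 0). lra.
  - rewrite (RInt_ext _ (fun _ => 0)) by (intros; apply A).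
    rewrite RInt_constR. destruct (A 0) as [_ ->]. ring.
Qed.

Lemma mean_op_pos f : posE f -> posE (mean_op f).
Proof.
  intros Hf. destruct (functional_pos f Hf) as [H1 H2]. split; [apply inE_const|].
  intros x _. unfold mean_op, Re, Im; simpl. lra.
Qed.

Lemma posE_eqE f g : eqE f g -> posE f -> posE g.
Proof.
  intros E [Hf HP]. split; [now apply inE_eqE with f|]. intros x Hx. rewrite <- E; auto.
Qed.

Lemma spectral_projection_positive P : is_spectral_projection (RtoC 0) P -> positive_op P.
Proof.
  intros HP f Hf. apply posE_eqE with (mean_op f); [|now apply mean_op_pos].
  intros x Hx. symmetry. apply spectral_projection_mean; auto. apply Hf.
Qed.

(** * Asymptotic positivity *)

(** P f is positive, so the distance of S(t) f to the cone is at most |S(t) f - P f|, which decays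
    uniformly on bounded sets. *)
Lemma semigroup_asymp_positive T : generates_A T -> unif_asymp_positive T 0.
Proof.
  intros HT.
  assert (E : forall t f, 0 <= t -> inE f ->
     eqE (fscal (RtoC (exp (- 0 * t))) (T t f)) (semigroup t f)).
  { intros t f Ht Hf x Hx. unfold fscal. rewrite Ropp_0, Rmult_0_l, exp_0.
    rewrite Cmult_1_l. now apply generates_unique. }
  split.
  - exists 6. intros t f Ht Hf. rewrite (supnorm_eqE _ _ (E t f Ht Hf)).
    now apply semigroup_bound.
  - intros eps He.
    destruct (pow_lt_1_zero (63/64) ltac:(rewrite Rabs_right; lra) (eps / 4) ltac:(lra)) as [n Hn].
    (* The decay is needed at times t + x with x >= -2, which matches the threshold 5 n - 2; the
       factor 4 hidden in eps / 4 comes from the two components and from 2 |f|. *)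
    specialize (Hn n (le_n n)). exists (5 * INR n). intros t f Ht Ht0 Hf.
    pose proof Hf as [Hf0 _].
    eapply Rle_trans; [apply dist_pos_le, mean_op_pos, Hf|].
    apply supnorm_le. intros x Hx. pose proof Hx as [Hx1 Hx2]. unfold fsub.
    rewrite (E t f Ht0 Hf0 x Hx).
    replace (eps * supnorm f) with (2 * (eps / 4 * (2 * supnorm f))) by field.
    apply Cmod_cp_le. intros b. rewrite cp_minus, cp_semigroup, cp_mean_op.
    eapply Rle_trans; [apply (X_decay b f n); auto; lra|].
    apply Rmult_le_compat_r.
    + pose proof (supnorm_pos f). lra.
    + left. eapply Rle_lt_trans; [apply Rle_abs|apply Hn].
Qed.

(** * Failure of positivity and of eventual strong positivity *)

Lemma posE_real (F : R -> R) : cont F -> (forall x, Ival x -> 0 <= F x) ->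
  posE (fun x => RtoC (F x)).
Proof.
  intros HF HP. split.
  - apply inE_fn. now apply ccont_RtoC.
  - intros x Hx. simpl. auto.
Qed.

Lemma not_positive T : generates_A T -> ~ positive_semigroup T.
Proof.
  intros HT HP.
  (* [q] vanishes at 0 and is concentrated in the middle: its integral is 2/3 over [-2, -1] and
     11/12 over [-3/2, -1/2], so x(1/2) = 2/3 - 11/12. *)
  set (q := fun x : R => - x * (x + 2)).
  assert (Cq : cont q) by (unfold q; auto 10 with cont).
  assert (Pq : posE (fun x => RtoC (q x))).
  { apply posE_real; auto. intros x [H1 H2]. unfold q. nra. }
  pose proof Pq as [Eq _].
  destruct (HP (1/2) _ ltac:(lra) Pq) as [_ K]. destruct (K 0 Ival_0) as [_ K0].
  rewrite (generates_unique T _ (1/2) HT Eq ltac:(lra) 0 Ival_0) in K0.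
  change (0 <= cp true (semigroup (1/2) (fun x => RtoC (q x)) 0)) in K0.
  rewrite cp_semigroup, Rplus_0_r in K0.
  set (x := X true (fun x => RtoC (q x))) in *.
  assert (Cx : cont x) by (unfold x; auto with cont).
  pose proof (X_renewal true _ Eq (1/2) ltac:(lra)) as R1.
  pose proof (X_renewal true _ Eq 0 ltac:(lra)) as R0. fold x in R1, R0.
  replace (1/2 - 2) with (-3/2) in R1 by field. replace (1/2 - 1) with (-1/2) in R1 by field.
  replace (0 - 2) with (-2) in R0 by ring. replace (0 - 1) with (-1) in R0 by ring.
  assert (Ex : forall s, Ival s -> x s = q s).
  { intros s Hs. unfold x. rewrite X_past, comp_I by (auto; apply Hs). reflexivity. }
  assert (I : forall a b, -2 <= a <= b -> b <= 0 -> RInt x a b =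
     (- b^3 / 3 - b^2) - (- a^3 / 3 - a^2)).
  { intros a b Ha Hb. rewrite (RInt_eq x q) by (try lra; intros; apply Ex; split; lra).
    apply is_RInt_unique. apply (is_RInt_derive (fun s => - s^3 / 3 - s^2)).
    - intros s _. unfold q. auto_derive; auto. field.
    - intros s _. apply Cq. }
  rewrite <- R0, !I, (Ex 0 Ival_0) in R1 by lra. unfold q in R1. simpl in R1. lra.
Qed.

(** If u(0) = 0, every function dominated by a multiple of u vanishes at 0 and stays at distance 1
    from the constant 1. *)
Lemma quasi_interior_pos u : quasi_interior u -> 0 < Re (u 0).
Proof.
  intros [[Hu HP] HQ].
  destruct (HQ (fun _ => RtoC 1) (inE_const _) (1/2) ltac:(lra)) as [f [c [Hf [Hc HN]]]].
  destruct (HP 0 Ival_0) as [_ H0]. destruct H0 as [H0|H0]; auto. exfalso.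
  specialize (Hc 0 Ival_0). rewrite <- H0, Rmult_0_r in Hc.
  pose proof (supnorm_ge (fsub (fun _ => RtoC 1) f) 0 (inE_fsub _ _ (inE_const _) Hf) Ival_0) as K.
  unfold fsub at 1 in K.
  assert (Z : f 0 = RtoC 0) by (apply Cmod_eq_0, Rle_antisym; auto; apply Cmod_ge_0).
  rewrite Z in K. replace (Cminus (RtoC 1) (RtoC 0)) with (RtoC 1) in K by ring.
  rewrite Cmod_1 in K. lra.
Qed.

(* Positive functions supported in [-1, 0) lie in the kernel of the conserved
   functional, which is strictly positive on any [g >= c u]. *)
Lemma not_strongly_positive T u : generates_A T -> quasi_interior u ->
  ~ ind_ev_strongly_positive T u.
Proof.
  intros HT HQ HS. pose proof (quasi_interior_pos u HQ) as Hu0.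
  destruct HQ as [[Hu HuP] _].
  (* A bump on (-1, 0): it vanishes on [-2, -1] and at 0, the only places that the conserved
     functional sees. *)
  set (q := fun x : R => Rmax 0 (- x * (x + 1))).
  assert (Cq : cont q).
  { unfold q. apply (cont_comp (Rmax 0)); auto 10 with cont. }
  assert (Pq : posE (fun x => RtoC (q x))).
  { apply posE_real; auto. intros x _. apply Rmax_l. }
  pose proof Pq as [Eq _].
  assert (Nq : ~ eqE (fun x => RtoC (q x)) fzero).
  { intros E. specialize (E (-1/2) ltac:(unfold Ival; lra)). injection E. unfold q, Rmax.
    destruct Rle_dec; lra. }
  destruct (HS _ Pq Nq) as [t0 [Ht0 H]]. destruct (H t0 (Rle_refl _)) as [c [Hc [_ K]]].
  pose proof (X_renewal true _ Eq t0 ltac:(lra)) as R1.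
  set (x := X true (fun x => RtoC (q x))) in *.
  assert (Cx : cont x) by (unfold x; auto with cont).
  assert (F0 : functional true (fun x => RtoC (q x)) = 0).
  { unfold functional. rewrite (RInt_eq _ (fun _ => 0)), RInt_constR, comp_I; auto.
    - simpl. unfold q. replace (- 0 * (0 + 1)) with 0 by ring. rewrite Rmax_left by lra. ring.
    - lra.
    - intros s Hs. rewrite comp_I by (split; lra). simpl. unfold q. apply Rmax_left. nra. }
  assert (Low : forall s, Ival s -> c * Re (u s) <= x (t0 + s)).
  { intros s Hs. destruct (K s Hs) as [_ K1]. unfold fsub, fscal in K1.
    rewrite (generates_unique T _ t0 HT Eq ltac:(lra) s Hs) in K1.
    change (0 <= cp true (Cminus (semigroup t0 (fun x => RtoC (q x)) s) (Cmult (RtoC c) (u s)))) in K1.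
    rewrite cp_minus, cp_scal, cp_semigroup in K1. unfold x. unfold Re. simpl in K1. lra. }
  (* Conservation makes x(t0) plus this integral equal to 0, whereas x(t0) >= c u(0) > 0. *)
  assert (I : 0 <= RInt x (t0 - 2) (t0 - 1)).
  { apply RInt_ge_0; [lra|auto with cont|]. intros s Hs.
    replace s with (t0 + (s - t0)) by ring.
    assert (Is : Ival (s - t0)) by (split; lra).
    eapply Rle_trans; [|apply Low; auto]. destruct (HuP _ Is). apply Rmult_le_pos; lra. }
  pose proof (Low 0 Ival_0) as L0. rewrite Rplus_0_r in L0.
  assert (0 < c * Re (u 0)) by (now apply Rmult_lt_0_compat). lra.
Qed.

Theorem theorem9p8 :
  (exists T : R -> Op, generates_A T) /\
  (* (i) *)
  compact_resolvent /\ spectral_bound = Finite 0 /\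
  dominant_spectral_value (RtoC (real spectral_bound)) /\
  (* (ii) *)
  algebraically_simple (RtoC (real spectral_bound)) /\
  (forall P, is_spectral_projection (RtoC (real spectral_bound)) P -> positive_op P) /\
  (* (iii) *)
  (forall T : R -> Op, generates_A T ->
     unif_asymp_positive T (real spectral_bound) /\
     ~ positive_semigroup T /\
     (forall u, quasi_interior u -> ~ ind_ev_strongly_positive T u)).
Proof.
  rewrite spectral_bound_0. simpl.
  split; [exists semigroup; apply semigroup_generates|].
  split; [apply compact_resolvent_A|]. split; [reflexivity|].
  split; [apply dominant_0|]. split; [apply algebraically_simple_0|].
  split; [apply spectral_projection_positive|].
  intros T HT. split; [now apply semigroup_asymp_positive|].
  split; [now apply not_positive|]. intros u Hu. now apply not_strongly_positive.
Qed.
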